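(* For any $\varepsilon\in(0,1)$ there is an algorithm that, given an $n$-vertex graph $(V,M)$ with oracle access to its adjacency matrix, with high probability reports a multiplicative $(1+\varepsilon)$-approximation to the value $|\mathrm{RGMIS}(\pi)|$ for some permutation $\pi$ of $V$, and runs in $\widetilde{O}(n^{3/2}/\varepsilon^2)$ time.
   Context: Adjacency matrix oracle: a query $(u,v)$ reports whether $(u,v)\in M$. For a permutation $\pi$ of $V$ (a bijection $\{1,\dots,n\}\to V$), $\mathrm{RGMIS}(\pi)$ is the set $I$ obtained by starting with $I=\emptyset$ and, for $i=1,\dots,n$, adding $\pi(i)$ to $I$ if none of its neighbors is in $I$; it is a maximal independent set. An estimate $\tilde x$ is a multiplicative $(1+\varepsilon)$-approximation of $x$ if $x\le \tilde x\le (1+\varepsilon)x$. ''With high probability'' means with probability $1-1/\mathrm{poly}(n)$; $\widetilde{O}$ hides polylogarithmic factors in $n$. *)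

(* Defs.v *)
From mathcomp Require Import all_boot all_order all_algebra all_fingroup.
From mathcomp Require Import reals exp.

Set Implicit Arguments.
Unset Strict Implicit.
Unset Printing Implicit Defensive.

Import Order.TTheory GRing.Theory Num.Theory.

Definition rgmis (n : nat) (M : rel 'I_n) (pi : {perm 'I_n}) : {set 'I_n} :=
  foldl (fun (I : {set 'I_n}) v =>
           if [exists u in I, M u v] then I else v |: I) set0
        [seq pi i | i <- enum 'I_n].

Definition is_mult_approx (R : realType) (eps x xt : R) : bool :=
  (x <= xt <= (1 + eps) * x)%R.

(* Finite computation trees.  [Unif m k] draws i uniformly from {0, ..., m}
   and continues as [k i]; [Tick t p] spends t units of time. *)
Inductive ctree (A : Type) : Type :=
| Ret of A
| OutOfFuel
| Tick of nat & ctree A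
| Unif (m : nat) of ('I_m.+1 -> ctree A).

Arguments OutOfFuel {A}.

Fixpoint cbind (A B : Type) (p : ctree A) (f : A -> ctree B) : ctree B :=
  match p with
  | Ret a => f a
  | OutOfFuel => OutOfFuel
  | Tick t q => Tick t (cbind q f)
  | Unif m k => Unif (fun i => cbind (k i) f)
  end.

(* Probability that the computation returns a value satisfying E. *)
Fixpoint pr (R : realType) (A : Type) (E : pred A) (p : ctree A) : R :=
  match p with
  | Ret a => ((E a)%:R)%R
  | OutOfFuel => 0%R
  | Tick _ q => pr R E q
  | Unif m k => (m.+1%:R^-1 * \sum_(i < m.+1) pr R E (k i))%R
  end.

(* Every branch, whatever the random draws, returns within time T. *)
Fixpoint halts_within (A : Type) (T : nat) (p : ctree A) : Prop :=
  match p with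
  | Ret _ => True
  | OutOfFuel => False
  | Tick t q => t <= T /\ halts_within (T - t) q
  | Unif m k => forall i, halts_within T (k i)
  end.

(* Randomized random-access machine with logarithmic cost, presented as a
   while-language over a memory of natural numbers.  Every evaluated
   subexpression is charged the bit length of its value, so large numbers
   cannot be used to do more than the charged amount of work. *)
Definition memory := nat -> nat.

Definition upd (s : memory) (a v : nat) : memory := fun x => if x == a then v else s x.

Inductive binop := OAdd | OSub | OMul | ODiv | OLeq.

Definition eval_binop (o : binop) (x y : nat) : nat :=
  match o with
  | OAdd => x + y
  | OSub => x - y
  | OMul => x * y
  | ODiv => x %/ y
  | OLeq => x <= y
  end.

Inductive expr :=
| Const of nat
| Fetch of expr
| Bin of binop & expr & expr.

Fixpoint eval (s : memory) (e : expr) : nat :=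
  match e with
  | Const k => k
  | Fetch a => s (eval s a)
  | Bin o e1 e2 => eval_binop o (eval s e1) (eval s e2)
  end.

Definition bitlen (v : nat) : nat := (trunc_log 2 v).+1.

Fixpoint ecost (s : memory) (e : expr) : nat :=
  bitlen (eval s e) +
  match e with
  | Const _ => 0
  | Fetch a => ecost s a
  | Bin _ e1 e2 => ecost s e1 + ecost s e2
  end.

(* The first argument of [Store], [Rand] and [Query] is the address at which
   the result is written. *)
Inductive cmd :=
| Skip
| Store of expr & expr
| Rand of expr & expr
| Query of expr & expr & expr
| Seq of cmd & cmd
| If of expr & cmd & cmd
| While of expr & cmd.

(* Adjacency matrix oracle on vertex names; out-of-range names are answered
   negatively. *)
Definition oracle (n : nat) (M : rel 'I_n) (u v : nat) : bool :=
  match insub u, insub v with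
  | Some i, Some j => M i j
  | _, _ => false
  end.

(* Every execution of a loop is cut after [fuel] iterations; the cut branches
   end in [OutOfFuel], which [halts_within] forbids and [pr] does not count.
   [Rand a e] draws uniformly from {0, ..., e - 1} (and writes 0 if e = 0). *)
Fixpoint exec (n : nat) (M : rel 'I_n) (fuel : nat) (c : cmd) (s : memory)
    : ctree memory :=
  match c with
  | Skip => Tick 1 (Ret s)
  | Store a e =>
      Tick (1 + ecost s a + ecost s e) (Ret (upd s (eval s a) (eval s e)))
  | Rand a e =>
      Tick (1 + ecost s a + ecost s e)
        (@Unif _ (eval s e).-1 (fun i => Ret (upd s (eval s a) i)))
  | Query a eu ev =>
      Tick (1 + ecost s a + ecost s eu + ecost s ev)
        (Ret (upd s (eval s a) (oracle M (eval s eu) (eval s ev))))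
  | Seq c1 c2 => cbind (exec M fuel c1 s) (exec M fuel c2)
  | If e c1 c2 =>
      Tick (1 + ecost s e)
        (if eval s e != 0 then exec M fuel c1 s else exec M fuel c2 s)
  | While e c1 =>
      (fix loop (f : nat) (s : memory) : ctree memory :=
         match f with
         | 0 => OutOfFuel
         | f'.+1 =>
             Tick (1 + ecost s e)
               (if eval s e != 0 then cbind (exec M fuel c1 s) (loop f')
                else Ret s)
         end) fuel s
  end.

(* The only direct input is n, at address 0; all other cells start at 0. *)
Definition init_memory (n : nat) : memory := upd (fun=> 0) 0 n.

Definition run (n : nat) (M : rel 'I_n) (fuel : nat) (P : cmd) : ctree memory :=
  exec M fuel P (init_memory n).

(* The reported estimate is the fraction (cell 0) / (cell 1). *)
Definition output (R : realType) (s : memory) : R := ((s 0)%:R / (s 1)%:R)%R.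

(* Main.v *)
Require Import Defs.
From mathcomp Require Import all_boot all_order all_algebra all_fingroup.
From mathcomp Require Import reals exp.
From mathcomp Require Import zify ring lra.

(* Draw a sequence y of n lambda vertices independently and uniformly, where
   lambda is a large multiple of log n.  With high probability y contains every
   vertex, and then the greedy set I of y is a maximal independent set, hence
   equal to RGMIS(pi) for some pi.

   If |I| is at most about sqrt n / eps^2, the greedy algorithm computes it
   within about n |I| queries.  Otherwise sqrt n lambda uniform vertices are
   sampled, the fraction lying in I is determined by the recursive test "scan y
   from the start; v is in I if v itself comes up before any neighbour of v
   that is in I", and the multiplicative Chernoff bound applies.

   The recursive test costs about n queries on average.  Let U be the set of
   vertices undecided by a prefix of y and T(x) the cost of testing x within that
   prefix.  A further vertex z increases T(x) by 1 + [x ~ z] T(z) for x in U.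
   With m the number of ordered edges inside U and Psi the sum of T(w) over
   x in U and w ~ x, averaging over z gives
     E[sum T'] = sum T + |U| + Psi / n,   E[Psi'] <= Psi + m,
     E[m'] <= m - m^2 / n^2,
   hence E[m] <= n^2 / (t + 1) after t steps, Psi = O(n^2 log n) and
   sum T = O(n^2 log^2 n) up to further logarithms.

   This average bound only gives a running time with constant probability, so
   the program makes lambda independent attempts, each cut off after a fixed
   number of steps of one flat loop.  All random draws are made beforehand. *)

Set Implicit Arguments.
Unset Strict Implicit.
Unset Printing Implicit Defensive.

Import Order.TTheory GRing.Theory Num.Theory.
Local Open Scope ring_scope.

(** The permutation is never computed: any maximal independent set, listed before its complement, is
    its own greedy set, so coverage of all vertices by the draws is enough. Repeated draws are
    harmless because a repeated vertex is already decided.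

    Once the drawing loop is over the machine is deterministic, so the success probability is an
    average over lists of draws, cut into independent blocks, one per attempt. Whether an attempt
    finishes in time and whether its answer is accurate depend on the same draws. Conditioning on
    finishing is avoided: a union bound makes all blocks accurate, and independence makes at least
    one of them cheap.

    The real [eps] enters through an integer E with 1/E <= [eps], cut down to e = min(E, n). With S
    a power of two, S^2 >= n, the size threshold S e^2 is the one at which S lambda samples give
    relative precision 1/(4e) with failure probability exponentially small in lambda.

    Logarithmic cost calls for a bound on every memory cell. Code repeated many times is shown to
    enlarge cells by an additive constant only; code that multiplies is bounded by its polynomial
    degree. *)

Local Notation expR := sequences.expR.

(** * Expectation over independent uniform draws *)

Section Expectation.
Variables (R : realType) (n : nat).
Implicit Types (k : nat) (f g : seq 'I_n -> R).

(** The average is nested one draw at a time, which is how [pr] unfolds on the drawing loop;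
    [pr_draws] identifies the two. *)
Fixpoint Ex k f : R :=
  if k is k'.+1 then n%:R^-1 * \sum_(i < n) Ex k' (fun l => f (i :: l))
  else f [::].

Lemma eq_Ex k f g : (forall l, size l = k -> f l = g l) -> Ex k f = Ex k g.
Proof.
elim: k f g => [|k IH] f g fg /=; first exact: fg.
congr (_ * _); apply: eq_bigr => i _; apply: IH => l sl.
by apply: fg; rewrite /= sl.
Qed.

Lemma Ex_le k f g : (forall l, size l = k -> f l <= g l) -> Ex k f <= Ex k g.
Proof.
elim: k f g => [|k IH] f g fg /=; first exact: fg.
rewrite ler_wpM2l ?invr_ge0 ?ler0n//; apply: ler_sum => i _; apply: IH => l sl.
by apply: fg; rewrite /= sl.
Qed.

Lemma ExD k f g : Ex k (fun l => f l + g l) = Ex k f + Ex k g.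
Proof.
elim: k f g => [|k IH] f g //=.
rewrite -mulrDr -big_split /=; congr (_ * _); apply: eq_bigr => i _.
exact: IH.
Qed.

Lemma ExZ k a f : Ex k (fun l => a * f l) = a * Ex k f.
Proof.
elim: k f => [|k IH] f //=.
rewrite [RHS]mulrCA; congr (_ * _); rewrite mulr_sumr.
by apply: eq_bigr => i _; exact: IH.
Qed.

Lemma ExB k f g : Ex k (fun l => f l - g l) = Ex k f - Ex k g.
Proof.
rewrite ExD -[X in _ + X = _]/(Ex k (fun l => - g l)).
congr (_ + _); rewrite -mulN1r -ExZ; apply: eq_Ex => l _; by rewrite mulN1r.
Qed.

Lemma Ex_cat k1 k2 f :
  Ex (k1 + k2) f = Ex k1 (fun l1 => Ex k2 (fun l2 => f (l1 ++ l2))).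
Proof.
elim: k1 f => [|k IH] f //=.
by congr (_ * _); apply: eq_bigr => i _; rewrite IH.
Qed.

Lemma Ex_rcons k f :
  Ex k.+1 f = Ex k (fun l => n%:R^-1 * \sum_(i < n) f (rcons l i)).
Proof.
rewrite -addn1 Ex_cat; apply: eq_Ex => l _ /=.
by congr (_ * _); apply: eq_bigr => i _; rewrite cats1.
Qed.

Lemma Ex_sum (I : Type) (r : seq I) k (F : I -> seq 'I_n -> R) :
  Ex k (fun l => \sum_(i <- r) F i l) = \sum_(i <- r) Ex k (F i).
Proof.
elim: r => [|i r IH].
  rewrite big_nil -[RHS](mul0r (Ex k (fun=> 0))) -ExZ; apply: eq_Ex => l _.
  by rewrite big_nil mul0r.
by rewrite big_cons -IH -ExD; apply: eq_Ex => l _; rewrite big_cons.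
Qed.

Hypothesis n_gt0 : (0 < n)%N.

Lemma avg_cst (a : R) : n%:R^-1 * \sum_(i < n) a = a.
Proof.
rewrite sumr_const card_ord -[a *+ n]mulr_natl mulrA mulVf ?mul1r//.
by rewrite pnatr_eq0 -lt0n.
Qed.

Lemma Ex_cst k a : Ex k (fun=> a) = a.
Proof. by elim: k => [|k IH] //=; rewrite IH avg_cst. Qed.

Lemma Ex_markov k f (a : R) (E : pred (seq 'I_n)) :
  0 < a -> (forall l, size l = k -> 0 <= f l) ->
  (forall l, size l = k -> E l -> a <= f l) ->
  Ex k (fun l => (E l)%:R) <= Ex k f / a.
Proof.
move=> a0 f0 Ef; rewrite mulrC -ExZ; apply: Ex_le => l sl.
rewrite mulrC ler_pdivlMr//; case: (boolP (E l)) => El; rewrite ?mul1r ?mul0r.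
- exact: Ef.
- exact: f0.
Qed.

Lemma Ex_union k (E F G : pred (seq 'I_n)) :
  (forall l, size l = k -> E l -> F l || G l) ->
  Ex k (fun l => (E l)%:R) <= Ex k (fun l => (F l)%:R) + Ex k (fun l => (G l)%:R).
Proof.
move=> EFG; rewrite -ExD; apply: Ex_le => l sl.
rewrite -natrD ler_nat; move: (EFG l sl).
by case: (E l); case: (F l); case: (G l) => // /(_ isT).
Qed.

Lemma Ex_never k (v : 'I_n) :
  Ex k (fun l => (v \notin l)%:R) = (1 - n%:R^-1) ^+ k.
Proof.
elim: k => [|k IH] //=.
rewrite exprS -{}IH (bigD1 v)//=.
rewrite (_ : Ex k _ = 0) ?add0r; last first.
  rewrite -[RHS](mul0r (Ex k (fun=> 0))) -ExZ; apply: eq_Ex => l _.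
  by rewrite in_cons eqxx mul0r.
rewrite (eq_bigr (fun=> Ex k (fun l => (v \notin l)%:R))); last first.
  move=> i iv; apply: eq_Ex => l _.
  by rewrite in_cons eq_sym (negbTE iv).
rewrite sumr_const cardC1 card_ord.
set e := Ex k _; rewrite -[e *+ _]mulr_natl mulrA; congr (_ * _).
have n0 : n%:R != 0 :> R by rewrite pnatr_eq0 -lt0n.
by rewrite -subn1 natrB// mulrBr mulVf// mulr1.
Qed.

(** Squaring [1 - t/2 <= expR (- t/2)] bounds [expR t] by the inverse square of [1 - t/2]. The
    product of that square with [1 + t + t^2] exceeds 1 by [t^2 (1 - 3 t + t^2) / 4], which is
    nonnegative in this range. *)
Lemma expR_le_quad (t : R) : `|t| <= 1 / 4 -> expR t <= 1 + t + t ^+ 2.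
Proof.
rewrite ler_norml => /andP[t1 t2].
have h1 : 1 - t / 2 <= expR (- (t / 2)) by have := expR_ge1Dx (- (t / 2)).
have e0 := expR_gt0 (- (t / 2)).
have -> : expR t = (expR (- (t / 2)) ^+ 2)^-1.
  by rewrite -expRM_natl -expRN; congr expR; field.
rewrite -[_^-1]mul1r ler_pdivrMr ?exprn_gt0//.
have h2 : (1 - t / 2) ^+ 2 <= expR (- (t / 2)) ^+ 2.
  by apply: lerXn2r; rewrite ?nnegrE ?expR_ge0//; lra.
have q0 : 0 <= 1 + t + t ^+ 2 by rewrite expr2; nra.
apply: le_trans (ler_wpM2l q0 h2).
have -> : (1 + t + t ^+ 2) * (1 - t / 2) ^+ 2 =
  1 + t ^+ 2 * ((1 - 3 * t + t ^+ 2) / 4) by field.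
rewrite lerDl mulr_ge0 ?sqr_ge0//.
have := sqr_ge0 t; lra.
Qed.

(** * Hits of a fixed set by independent draws: the Chernoff bound *)

Section Counting.
Variable A : {set 'I_n}.

Definition hits (l : seq 'I_n) := count [in A] l.

Lemma Ex_hits_mgf k (x : R) :
  Ex k (fun l => x ^+ hits l) = (1 + #|A|%:R / n%:R * (x - 1)) ^+ k.
Proof.
elim: k => [|k IH] //=; rewrite exprS -{}IH.
under eq_bigr => i _.
  rewrite (_ : Ex k _ = x ^+ (i \in A) * Ex k (fun l => x ^+ hits l)); last first.
    by rewrite -ExZ; apply: eq_Ex => l _; rewrite /hits /= exprD.
  over.
rewrite -mulr_suml mulrA; congr (_ * _).
rewrite (bigID [in A])/=.
rewrite (eq_bigr (fun=> x)); last by move=> i ->; rewrite expr1.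
rewrite [X in _ + X](eq_bigr (fun=> 1)); last by move=> i /negbTE ->; rewrite expr0.
rewrite sumr_const sumr_const.
have -> : #|[pred i | i \notin A]| = (n - #|A|)%N.
  by rewrite -[X in (X - _)%N]card_ord -(cardC [in A]) addKn.
have n0 : n%:R != 0 :> R by rewrite pnatr_eq0 -lt0n.
rewrite -[x *+ _]mulr_natl natrB; last by rewrite -[X in (_ <= X)%N]card_ord max_card.
by field.
Qed.

Lemma Ex_hits_expR k (t : R) : `|t| <= 1 / 4 ->
  Ex k (fun l => expR (t * (hits l)%:R)) <=
  expR (k%:R * (#|A|%:R / n%:R) * (t + t ^+ 2)).
Proof.
move=> ht; set p := _ / _.
have p0 : 0 <= p by rewrite divr_ge0 ?ler0n.
rewrite (@eq_Ex k _ (fun l => expR t ^+ hits l)); last first.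
  by move=> l _; rewrite expRM_natr.
rewrite Ex_hits_mgf -[k%:R * p * _]mulrA expRM_natl.
have p1 : p <= 1.
  rewrite ler_pdivrMr ?ltr0n// mul1r ler_nat -[X in (_ <= X)%N]card_ord.
  exact: max_card.
have e0 := expR_gt0 t.
apply: lerXn2r; rewrite ?nnegrE ?expR_ge0//; first by rewrite -/p; nra.
apply: le_trans (expR_ge1Dx _); rewrite lerD2l ler_wpM2l//.
have := expR_le_quad ht; lra.
Qed.

(** Exponential Markov inequality with parameter [d / 2] for the upper tail and [- d / 2] for the
    lower one. Both leave the exponent [- d^2 mu / 4], and [d <= 1/2] keeps the parameter within the
    range of [expR_le_quad]. *)
Lemma chernoff k (d mu : R) :
  0 < d -> d <= 1 / 2 -> mu = k%:R * (#|A|%:R / n%:R) ->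
  Ex k (fun l => (~~ ((1 - d) * mu <= (hits l)%:R <= (1 + d) * mu))%:R) <=
  2 * expR (- (d ^+ 2 * mu / 4)).
Proof.
move=> d0 d1 mu_def.
have tail (t b : R) : `|t| <= 1 / 4 ->
    Ex k (fun l => (t * b < t * (hits l)%:R)%R%:R) <= expR (mu * (t + t ^+ 2) - t * b).
  move=> ht; rewrite expRB.
  apply: le_trans (Ex_markov (f := fun l => expR (t * (hits l)%:R)) (expR_gt0 (t * b)) _ _) _.
  - by move=> l _; exact: expR_ge0.
  - by move=> l _ h; rewrite ler_expR ltW.
  - by rewrite ler_wpM2r ?invr_ge0 ?expR_ge0// mu_def; exact: Ex_hits_expR.
apply: le_trans (Ex_union (F := fun l => d / 2 * ((1 + d) * mu) < d / 2 * (hits l)%:R)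
   (G := fun l => - (d / 2) * ((1 - d) * mu) < - (d / 2) * (hits l)%:R) _) _.
  move=> l _; rewrite negb_and -!ltNge => /orP[h|h]; apply/orP; [right|left].
    by rewrite ltr_nM2l// oppr_lt0 divr_gt0.
  by rewrite ltr_pM2l// divr_gt0.
have dbl (x : R) : 2 * x = x + x by ring.
rewrite dbl; apply: lerD.
  apply: le_trans (tail _ _ _) _; first by rewrite ger0_norm; lra.
  rewrite ler_expR; lra.
apply: le_trans (tail _ _ _) _; first by rewrite normrN ger0_norm; lra.
rewrite ler_expR; lra.
Qed.

End Counting.

End Expectation.

(** * Greedy sets and the expected cost of the recursive test *)

Section Greedy.
Variables (n : nat) (M : rel 'I_n).
Implicit Types (I U : {set 'I_n}) (y : seq 'I_n) (v w x z : 'I_n).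
Local Open Scope nat_scope.

Definition gadd I z := if [exists u in I, M u z] then I else z |: I.
Definition greedy y := foldl gadd set0 y.
(** The set U of the overview. For independent [I], emptiness of [alive I] means that [I] is
    maximal. *)
Definition alive I : {set 'I_n} :=
  [set v | (v \notin I) && ~~ [exists u in I, M u v]].

Definition charge I (T : 'I_n -> nat) z x :=
  T x + (if x \in alive I then 1 + (if M x z then T z else 0) else 0).
Definition wstep (p : {set 'I_n} * ('I_n -> nat)) z :=
  (gadd p.1 z, charge p.1 p.2 z).
(* [work y v] bounds, up to a constant, the number of machine steps after which
   the recursive membership test for [v] has scanned all of [y] or stopped. *)
Definition work y := (foldl wstep (set0, fun=> 1) y).2.

Lemma greedy_rcons y z : greedy (rcons y z) = gadd (greedy y) z.
Proof. by rewrite /greedy foldl_rcons. Qed.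

Lemma work_rcons y z x :
  work (rcons y z) x = charge (greedy y) (work y) z x.
Proof.
rewrite /work foldl_rcons /= /greedy; congr charge.
by elim/last_ind: y => [|y u IH] //; rewrite !foldl_rcons /= IH.
Qed.

Lemma work_gt0 y v : 0 < work y v.
Proof.
elim/last_ind: y => [|y z IH] //.
by rewrite work_rcons /charge addn_gt0 IH.
Qed.

Lemma charge_ge I T z x : T x <= charge I T z x.
Proof. by rewrite leq_addr. Qed.

Hypothesis M_sym : symmetric M.
Hypothesis M_irr : irreflexive M.

Definition indep I := forall u v, u \in I -> v \in I -> ~~ M u v.

Lemma gadd_indep I z : indep I -> indep (gadd I z).
Proof.
rewrite /gadd; case: ifPn => // /existsPn nz indI u v.
have Mz w : w \in I -> M w z = false.
  by move=> wI; have := nz w; rewrite wI /= => /negbTE.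
rewrite !inE => /predU1P[->|uI] /predU1P[->|vI].
- by rewrite M_irr.
- by rewrite M_sym Mz.
- by rewrite Mz.
- exact: indI.
Qed.

Lemma greedy_indep y : indep (greedy y).
Proof.
elim/last_ind: y => [|y z IH]; first by move=> u v; rewrite in_set0.
by rewrite greedy_rcons; exact: gadd_indep.
Qed.

Lemma aliveP I v :
  reflect (v \notin I /\ forall u, u \in I -> ~~ M u v) (v \in alive I).
Proof.
rewrite inE; apply: (iffP andP) => -[vI].
  by move=> /existsPn h; split=> // u uI; have := h u; rewrite uI.
by move=> h; split=> //; apply/existsPn => u; case: (boolP (u \in I)) => //= /h.
Qed.

Lemma gadd_alive I z : z \in alive I -> gadd I z = z |: I.
Proof. by rewrite inE /gadd => /andP[_ /negbTE ->]. Qed.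

Lemma gadd_dead I z : indep I -> z \notin alive I -> gadd I z = I.
Proof.
move=> indI; rewrite /gadd; case: ifPn => // nz.
by rewrite inE negb_and nz orbF negbK => zI; apply/setUidPr; rewrite sub1set.
Qed.

Lemma gadd_sub I z : I \subset gadd I z.
Proof. by rewrite /gadd; case: ifP => // _; rewrite subsetUr. Qed.

Lemma alive_gadd_sub I z : alive (gadd I z) \subset alive I.
Proof.
apply/subsetP => v /aliveP[vI h]; apply/aliveP; split.
  by apply: contra vI; apply: subsetP; exact: gadd_sub.
by move=> u uI; apply: h; apply: subsetP uI; exact: gadd_sub.
Qed.

Lemma alive_gadd_nbr I z v :
  v \in alive (gadd I z) -> z \in alive I -> ~~ M v z.
Proof.
move=> /aliveP[_ h] za; rewrite M_sym; apply: h.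
by rewrite gadd_alive// setU11.
Qed.

Lemma alive_gadd_self I z : z \notin alive (gadd I z).
Proof.
apply/negP => /aliveP[]; rewrite /gadd; case: ifPn => [|_].
  by move=> /existsP[u /andP[uI Muz]] _ /(_ u uI); rewrite Muz.
by rewrite setU11.
Qed.

Lemma alive_catl y1 y2 : alive (greedy (y1 ++ y2)) \subset alive (greedy y1).
Proof.
elim/last_ind: y2 => [|y2 z IH]; first by rewrite cats0.
by rewrite -rcons_cat greedy_rcons; apply: subset_trans (alive_gadd_sub _ _) IH.
Qed.

(** A drawn vertex is decided one way or the other. Hence a sequence containing every vertex leaves
    nothing alive. *)
Lemma alive_mem y z : z \in y -> z \notin alive (greedy y).
Proof.
move=> /splitPr[y1 y2]; rewrite -cat_rcons.
apply: contra (alive_gadd_self (greedy y1) z) => h.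
by rewrite -greedy_rcons; apply: subsetP h; exact: alive_catl.
Qed.

Section Step.
Variables (I : {set 'I_n}) (T : 'I_n -> nat).
Let U := alive I.
Let U' z := alive (gadd I z).

(** These are m and Psi of the overview. In [load] the neighbour [w] need not be alive: drawing a
    dominated neighbour of an alive vertex still costs a full test. *)
Definition edges U := \sum_(x in U) \sum_(w in U | M x w) 1.
Definition load U T := \sum_(x in U) \sum_(w | M x w) T w.

Lemma step_split (g g' : 'I_n -> nat) z : (forall x, g x <= g' x) ->
  \sum_(x in U' z) g' x + \sum_(x in U | (z \in U) && M x z) g x <=
  \sum_(x in U) g' x.
Proof.
move=> gg'; rewrite [leqRHS](bigID (fun x => (z \in U) && M x z)) /= addnC.
apply: leq_add; first by apply: leq_sum.
rewrite [leqLHS]big_mkcond [leqRHS]big_mkcond; apply: leq_sum => x _.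
case: ifPn => // xU'; rewrite (subsetP (alive_gadd_sub I z)) //=.
by case: (boolP (z \in U)) => //= zU; rewrite (alive_gadd_nbr xU' zU).
Qed.

Lemma sum_cst (a : nat) : n * a = \sum_(z : 'I_n) a.
Proof. by rewrite sum_nat_const card_ord. Qed.

Lemma work_step :
  \sum_z \sum_x charge I T z x = n * (\sum_x T x + #|U|) + load U T.
Proof.
have -> : load U T = \sum_z \sum_(x in U) (if M x z then T z else 0).
  rewrite /load exchange_big /=; apply: eq_bigr => x _.
  by rewrite big_mkcond.
rewrite sum_cst -big_split /=; apply: eq_bigr => z _.
rewrite /charge big_split /= -addnA; congr (_ + _).
by rewrite -big_mkcond /= big_split /= sum1_card.
Qed.

(* Once [z] joins the greedy set its alive neighbours stop being charged; on
   average over [z], this loses the weight of the paths [z - x - w] with [z] and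
   [x] alive, which is what charging [T z] to the alive neighbours of [z]
   gains. *)
Lemma load_step :
  \sum_z load (U' z) (charge I T z) <= n * (load U T + edges U).
Proof.
pose g x := \sum_(w | M x w) T w.
pose A := \sum_z \sum_(x in U | (z \in U) && M x z) g x.
rewrite -(leq_add2r A) /A -big_split /=.
apply: leq_trans (_ : _ <= \sum_z \sum_(x in U) \sum_(w | M x w) charge I T z w) _.
  apply: leq_sum => z _; apply: step_split => x; apply: leq_sum => w _.
  exact: charge_ge.
rewrite sum_cst.
have -> : \sum_z \sum_(x in U) \sum_(w | M x w) charge I T z w =
  \sum_(z : 'I_n) (load U T + edges U) +
   \sum_z \sum_(x in U) \sum_(w in U | M x w) (if M w z then T z else 0).
  rewrite -big_split /=; apply: eq_bigr => z _.
  rewrite /load /edges -!big_split /=; apply: eq_bigr => x _.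
  rewrite /charge big_split /= -addnA; congr (_ + _).
  rewrite -big_split /= -big_mkcondr /=.
  by apply: eq_bigl => w; rewrite andbC.
rewrite leq_add2l; apply: eq_leq.
pose F z x w := if [&& z \in U, x \in U, M z x & M x w] then T w else 0.
transitivity (\sum_z \sum_x \sum_w F x w z).
  apply: eq_bigr => z _; rewrite big_mkcond; apply: eq_bigr => x _.
  rewrite /F; case: ifP => xU; last by rewrite big1 // => w _; rewrite andbF.
  rewrite big_mkcond; apply: eq_bigr => w _.
  by case: (w \in U); case: (M x w).
rewrite exchange_big; apply: eq_bigr => z _ /=.
rewrite exchange_big [RHS]big_mkcond; apply: eq_bigr => x _ /=.
rewrite /g /F andbCA (M_sym x z); case: ifP => h.
  case/andP: h => xU /andP[zU ->]; rewrite [RHS]big_mkcond; apply: eq_bigr => w _.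
  by rewrite xU zU.
rewrite big1 // => w _; move: h.
by case: (x \in U); case: (z \in U); case: (M z x).
Qed.

(** An alive [z] removes each alive neighbour [x] with its [d x] edges. Over all [z] this happens
    [d x] times to each [x], hence the squares. *)
Lemma edges_step (d : 'I_n -> nat) : (forall x, d x = \sum_(w in U | M x w) 1) ->
  \sum_z edges (U' z) + \sum_(x in U) d x ^ 2 <= n * edges U.
Proof.
move=> dE; rewrite sum_cst.
have -> : \sum_(x in U) d x ^ 2 = \sum_z \sum_(x in U | (z \in U) && M x z) d x.
  rewrite (exchange_big_dep [in U]) /=; last by move=> z x _ /andP[].
  apply: eq_bigr => x xU; rewrite expnS expn1 {2}dE big_distrr /=.
  by apply: eq_big => [z|z _]; rewrite ?xU ?muln1.
rewrite -big_split /=; apply: leq_sum => z _.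
apply: leq_trans (_ : _ <= \sum_(x in U' z) d x + \sum_(x in U | (z \in U) && M x z) d x) _.
  rewrite leq_add2r; apply: leq_sum => x _; rewrite dE.
  rewrite [leqLHS]big_mkcond [leqRHS]big_mkcond; apply: leq_sum => w _.
  case: ifPn => // /andP[wU' ->].
  by rewrite (subsetP (alive_gadd_sub I z) _ wU').
apply: leq_trans (step_split z (fun x => leqnn _)) _ => //.
by rewrite /edges; under [leqRHS]eq_bigr do rewrite -dE.
Qed.

End Step.

Lemma edges_le I : edges (alive I) <= n ^ 2.
Proof.
rewrite /edges; apply: leq_trans (_ : \sum_(x in alive I) n <= _).
  apply: leq_sum => x _; rewrite sum1_card -[leqRHS]card_ord; exact: max_card.
by rewrite sum_nat_const leq_mul2r -[X in _ <= X]card_ord max_card orbT.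
Qed.

Lemma load1_le I : load (alive I) (fun=> 1) <= n ^ 2.
Proof.
rewrite /load; apply: leq_trans (_ : \sum_(x in alive I) n <= _).
  apply: leq_sum => x _; rewrite sum1_card -[leqRHS]card_ord; exact: max_card.
by rewrite sum_nat_const leq_mul2r -[X in _ <= X]card_ord max_card orbT.
Qed.

End Greedy.

(** * Harmonic sums *)

Section Harmonic.
Variable R : realType.

Definition harmonic t : R := \sum_(j < t) j.+1%:R^-1.

Lemma harmonicS t : harmonic t.+1 = harmonic t + t.+1%:R^-1.
Proof. by rewrite /harmonic big_ord_recr. Qed.

Lemma harmonic_le s t : (s <= t)%N -> harmonic s <= harmonic t.
Proof.
elim: t => [|t IH]; first by rewrite leqn0 => /eqP ->.
rewrite leq_eqVlt => /predU1P[->//|/IH h].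
by apply: le_trans h _; rewrite harmonicS lerDl invr_ge0 ler0n.
Qed.

(** Each doubling of the range adds at most 1: the [2^j] new terms are each at most [2^-j]. *)
Lemma harmonic_exp2 j : harmonic (2 ^ j) <= j.+1%:R.
Proof.
elim: j => [|j IH]; first by rewrite /harmonic expn0 big_ord1 invr1.
rewrite expnS mul2n -addnn -natr1.
suff h k : harmonic (2 ^ j + k) <= harmonic (2 ^ j) + k%:R / (2 ^ j)%:R.
  apply: le_trans (h _) _; rewrite divff ?lerD2r//.
  by rewrite pnatr_eq0 expn_eq0.
elim: k => [|k IHk]; first by rewrite addn0 mul0r addr0.
rewrite addnS harmonicS -[k.+1%:R]natr1 mulrDl addrA mul1r; apply: lerD => //.
rewrite lef_pV2 ?posrE ?ltr0n ?expn_gt0// ler_nat; lia.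
Qed.

End Harmonic.

(** * Expected edges, load and work after a random prefix *)

Section ExpectedWork.
Variables (R : realType) (n : nat) (M : rel 'I_n).
Hypotheses (M_sym : symmetric M) (M_irr : irreflexive M) (n_gt0 : (0 < n)%N).
Local Notation Ex := (@Ex R n).
Local Notation N := (n%:R : R).
Local Notation alv y := (alive M (greedy M y)).

Let N_gt0 : 0 < N. Proof. by rewrite ltr0n. Qed.
Let N_neq0 : N != 0. Proof. by rewrite lt0r_neq0. Qed.

(** The tangent inequality [d^2 >= 2 a d - a^2] replaces Cauchy-Schwarz. The bound becomes linear in
    the number of edges, so it passes through the expectation, and [a] can be chosen anew at each
    step. *)
Lemma Ex_edges_step (a : R) (y : seq 'I_n) : 
  N^-1 * \sum_z (edges M (alv (rcons y z)))%:R <=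
  (edges M (alv y))%:R * (1 - 2 * a / N) + a ^+ 2.
Proof.
pose d x := (\sum_(w in alv y | M x w) 1)%N.
set e := edges M (alv y).
have := edges_step M_sym (I := greedy M y) (d := d) (fun=> erefl).
rewrite -/e -(ler_nat R) natrD natrM [X in X + _ <= _]natr_sum.
rewrite [X in _ + X <= _]natr_sum => h.
rewrite ler_pdivrMl// (eq_bigr (fun z => (edges M (alive M (gadd M (greedy M y) z)))%:R)); last first.
  by move=> z _; rewrite greedy_rcons.
have {}h : \sum_z (edges M (alive M (gadd M (greedy M y) z)))%:R <=
   N * e%:R - \sum_(x in alv y) ((d x) ^ 2)%:R :> R by lra.
apply: le_trans h _.
have h2 : \sum_(x in alv y) (2 * a * (d x)%:R - a ^+ 2) <=
    \sum_(x in alv y) ((d x) ^ 2)%:R :> R.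
  apply: ler_sum => x _; rewrite natrX; have := sqr_ge0 ((d x)%:R - a).
  rewrite !expr2; nra.
move: h2; rewrite sumrB -mulr_sumr -natr_sum -/(edges M (alv y)) -/e sumr_const => h2.
have : a ^+ 2 *+ #|alv y| <= N * a ^+ 2.
  rewrite -[leLHS]mulr_natl ler_wpM2r ?sqr_ge0// ler_nat -[leqRHS]card_ord.
  exact: max_card.
have -> : N * (e%:R * (1 - 2 * a / N) + a ^+ 2) =
  N * e%:R - 2 * a * e%:R + N * a ^+ 2 by field.
lra.
Qed.

Lemma Ex_edges t :
  Ex t (fun y => (edges M (alv y))%:R) <= N ^+ 2 / t.+1%:R.
Proof.
have le0 (y : seq 'I_n) : (edges M (alv y))%:R <= N ^+ 2.
  by rewrite -natrX ler_nat edges_le.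
elim: t => [|[|t] IH]; first by rewrite /= divr1.
  (* The first draw is treated apart: the choice of [a] made below would here give the edge count a
     negative coefficient. The edge count of the empty prefix is a constant, so [a] is tuned to it
     directly. *)
  rewrite Ex_rcons /=; set m := (edges M (alv [::]))%:R : R.
  apply: le_trans (Ex_edges_step (m / N) [::]) _; rewrite -/m.
  have -> : m * (1 - 2 * (m / N) / N) + (m / N) ^+ 2 = m - (m / N) ^+ 2 by field.
  rewrite ler_pdivlMr//.
  have := sqr_ge0 (m / N - N / 2); have -> : m = m / N * N by rewrite divfK.
  set r := m / N; rewrite !expr2 mulfK//; nra.
rewrite Ex_rcons.
(* The optimal parameter if the previous edge count equals its bound [N^2 / t.+2]. The induction
   closes because [(u + 1) (u + 3) <= (u + 2)^2]. *)
set a := N / t.+2%:R.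
apply: le_trans (Ex_le (g := fun y => (edges M (alv y))%:R * (1 - 2 * a / N) + a ^+ 2) _) _.
  by move=> y _; exact: Ex_edges_step.
have t0 : (t.+2%:R != 0 :> R) by rewrite pnatr_eq0.
have aN : 2 * a / N = 2 / t.+2%:R by rewrite /a mulrA mulrAC mulfK.
rewrite ExD (Ex_cst n_gt0) (eq_Ex (g := fun y => (1 - 2 * a / N) * (edges M (alv y))%:R)); last first.
  by move=> y _; rewrite mulrC.
rewrite ExZ aN.
have c0 : 0 <= 1 - 2 / t.+2%:R :> R.
  by rewrite subr_ge0 ler_pdivrMr ?ltr0n// mul1r ler_nat.
apply: le_trans (lerD (ler_wpM2l c0 IH) (lexx _)) _.
rewrite /a; have : 0 <= t%:R :> R by rewrite ler0n.
rewrite -[t.+3%:R]natr1 -[t.+2%:R]natr1 -[t.+1%:R]natr1; set u := t%:R => u0.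
have -> : (1 - 2 / (u + 1 + 1)) * (N ^+ 2 / (u + 1 + 1)) + (N / (u + 1 + 1)) ^+ 2 =
  N ^+ 2 * ((u + 1) / (u + 2) ^+ 2) by field; lra.
rewrite ler_wpM2l ?sqr_ge0// ler_pdivrMr ?exprn_gt0//; last by lra.
rewrite mulrC ler_pdivlMr; last by lra.
rewrite expr2; nra.
Qed.

Lemma Ex_load t :
  Ex t (fun y => (load M (alv y) (work M y))%:R) <= N ^+ 2 * (1 + harmonic R t).
Proof.
elim: t => [|t IH].
  by rewrite /= /harmonic big_ord0 addr0 mulr1 -natrX ler_nat load1_le.
rewrite Ex_rcons.
apply: le_trans (Ex_le (g := fun y => (load M (alv y) (work M y))%:R + (edges M (alv y))%:R) _) _.
  move=> y _; rewrite ler_pdivrMl// -natr_sum -natrD -natrM ler_nat.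
  apply: leq_trans (load_step M_sym _ _); apply: eq_leq; apply: eq_bigr => z _.
  rewrite greedy_rcons /load; apply: eq_bigr => x _; apply: eq_bigr => w _.
  by rewrite work_rcons.
rewrite ExD harmonicS addrA mulrDr; apply: lerD => //; exact: Ex_edges.
Qed.

Lemma Ex_work t :
  Ex t (fun y => (\sum_v work M y v)%:R) <= N * (1 + t%:R * (2 + harmonic R t)).
Proof.
(* Freezing the harmonic number at [t] makes the claimed bound affine in [s]. *)
suff h s : (s <= t)%N ->
    Ex s (fun y => (\sum_v work M y v)%:R) <= N * (1 + s%:R * (2 + harmonic R t)).
  exact: h.
elim: s => [_|s IH st].
  by rewrite /= mul0r addr0 mulr1 ler_nat sum_nat_const card_ord muln1.
rewrite Ex_rcons.
apply: le_trans (Ex_le (g := fun y => (\sum_v work M y v)%:R + N +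
   N^-1 * (load M (alv y) (work M y))%:R) _) _.
  move=> y _; rewrite -natr_sum ler_pdivrMl//.
  have -> : (\sum_i \sum_v work M (rcons y i) v =
     \sum_i \sum_v charge M (greedy M y) (work M y) i v)%N.
    by apply: eq_bigr => z _; apply: eq_bigr => x _; rewrite work_rcons.
  rewrite work_step natrD natrM natrD [leRHS]mulrDr mulVKf// lerD2r.
  rewrite ler_wpM2l ?ler0n// lerD2l ler_nat -[leqRHS]card_ord; exact: max_card.
rewrite !ExD ExZ (Ex_cst n_gt0) -natr1.
have := IH (ltnW st); have := Ex_load s.
have /(ler_wpM2l (sqr_ge0 N)) := harmonic_le R (ltnW st).
set e1 := Ex s _; set e2 := Ex s _; set H := harmonic R t => h1 h2 h3.
have h4 : N^-1 * e1 <= N * (1 + H).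
  rewrite ler_pdivrMl// mulrA -expr2; lra.
lra.
Qed.

End ExpectedWork.

(** * Computation trees and loops *)

Section Trees.
Variables A : Type.
Implicit Types (p : ctree A) (Q : A -> Prop).
Local Open Scope nat_scope.

(** Running out of fuel is excluded as well, so [pr_post] can conclude probability exactly 1. *)
Fixpoint post p Q : Prop :=
  match p with
  | Ret a => Q a
  | OutOfFuel => False
  | Tick _ q => post q Q
  | Unif m k => forall i, post (k i) Q
  end.

Lemma post_mono p Q Q' : (forall a, Q a -> Q' a) -> post p Q -> post p Q'.
Proof. by move=> QQ'; elim: p => //= m k IH h i; exact: IH (h i). Qed.

Lemma halts_mono p T1 T2 : T1 <= T2 -> halts_within T1 p -> halts_within T2 p.
Proof.
elim: p T1 T2 => //= [t q IH|m k IH] T1 T2 T12.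
  case=> tT /IH h; split; first exact: leq_trans T12.
  by apply: h; exact: leq_sub2r.
by move=> h i; exact: IH (h i).
Qed.

Section Probability.
Variable R : realType.

Lemma pr_ge0 E p : (0 <= pr R E p)%R.
Proof.
elim: p => //= m k IH.
by rewrite mulr_ge0 ?invr_ge0 ?ler0n//; apply: sumr_ge0 => i _.
Qed.

Lemma pr_post (E : pred A) p : post p E -> pr R E p = 1%R.
Proof.
elim: p => //= [a ->//|m k IH h].
rewrite (eq_bigr (fun=> 1%R)) ?avg_cst// => i _; exact: IH.
Qed.

End Probability.
End Trees.

Lemma halts_bind (A B : Type) (p : ctree A) (f : A -> ctree B) (T1 T2 : nat) :
  halts_within T1 p -> post p (fun a => halts_within T2 (f a)) ->
  halts_within ((T1 + T2)%N) (cbind p f).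
Proof.
elim: p T1 => //= [a|t q IH|m k IH] T1.
- by move=> _; apply: halts_mono (leq_addl _ _).
- case=> tT h1 h2; split; first exact: leq_trans (leq_addr _ _).
  by rewrite -addnBAC//; exact: IH.
- by move=> h1 h2 i; exact: IH.
Qed.

Lemma post_bind (A B : Type) (p : ctree A) (f : A -> ctree B) (Q : B -> Prop) :
  post (cbind p f) Q <-> post p (fun a => post (f a) Q).
Proof. by elim: p => //= m k IH; split=> h i; apply/IH. Qed.

(** Associativity is stated for [pr] only: below [Unif] the two trees are functions that are
    compared branch by branch. *)
Lemma cbindA (A B C : Type) (p : ctree A) (f : A -> ctree B) (g : B -> ctree C) (Q : pred C) (R : realType) :
  pr R Q (cbind (cbind p f) g) = pr R Q (cbind p (fun a => cbind (f a) g)).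
Proof.
elim: p => //= m k IH; congr (_ * _); apply: eq_bigr => i _; exact: IH.
Qed.

Lemma bitlen_mono x y : (x <= y)%N -> (bitlen x <= bitlen y)%N.
Proof. by move=> xy; rewrite ltnS leq_trunc_log. Qed.

Lemma bitlen_expn b x k : (x < 2 ^ b)%N -> (0 < b)%N -> (0 < k)%N -> (bitlen (x ^ k) <= k * b)%N.
Proof.
move=> xb b0 k0; rewrite /bitlen; have [->|x0] := posnP x.
  by rewrite exp0n // trunc_log0 muln_gt0 k0.
rewrite -(ltn_exp2l _ _ (isT : (1 < 2)%N)).
apply: leq_ltn_trans (trunc_logP _ _) _ => //; first by rewrite expn_gt0 x0.
by rewrite mulnC expnM ltn_exp2r.
Qed.

Lemma bitlen_le b x : (x < 2 ^ b)%N -> (0 < b)%N -> (bitlen x <= b)%N.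
Proof. by move=> xb b0; have := bitlen_expn xb b0 (isT : (0 < 1)%N); rewrite expn1 mul1n. Qed.

(** * Deterministic commands and counted loops *)

Section Machine.
Variables (n : nat) (M : rel 'I_n).
Implicit Types (c : cmd) (s : memory) (e : expr) (Q : memory -> Prop).
Local Open Scope nat_scope.

(** Commands without loops or randomness. They have a single outcome [dexec] and a single cost
    [dcost], so their trees need not be unfolded again. *)
Fixpoint simple c : bool :=
  match c with
  | Skip | Store _ _ | Query _ _ _ => true
  | Seq c1 c2 | If _ c1 c2 => simple c1 && simple c2
  | Rand _ _ | While _ _ => false
  end.

Fixpoint dexec c s : memory :=
  match c with
  | Store a e => upd s (eval s a) (eval s e)
  | Query a eu ev => upd s (eval s a) (oracle M (eval s eu) (eval s ev))
  | Seq c1 c2 => dexec c2 (dexec c1 s)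
  | If e c1 c2 => if eval s e != 0 then dexec c1 s else dexec c2 s
  | _ => s
  end.

Fixpoint dcost c s : nat :=
  match c with
  | Store a e => 1 + ecost s a + ecost s e
  | Query a eu ev => 1 + ecost s a + ecost s eu + ecost s ev
  | Seq c1 c2 => dcost c1 s + dcost c2 (dexec c1 s)
  | If e c1 c2 => 1 + ecost s e + (if eval s e != 0 then dcost c1 s else dcost c2 s)
  | _ => 1
  end.

Variable F : nat.

Lemma post_simple c s Q : simple c -> post (exec M F c s) Q <-> Q (dexec c s).
Proof.
elim: c s Q => //= [c1 IH1 c2 IH2|e c1 IH1 c2 IH2] s Q /andP[h1 h2].
  by rewrite post_bind IH1// IH2.
by case: ifP => _; [exact: IH1|exact: IH2].
Qed.

Lemma halts_simple c s : simple c -> halts_within (dcost c s) (exec M F c s).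
Proof.
elim: c s => //= [c1 IH1 c2 IH2|e c1 IH1 c2 IH2] s; try by split.
  case/andP => h1 h2; apply: halts_bind; first exact: IH1.
  by apply/post_simple => //; exact: IH2.
case/andP => h1 h2; split; first by rewrite leq_addr.
by rewrite addnC addnK; case: ifP => _; [exact: IH1|exact: IH2].
Qed.

(** The local fixpoint of [exec], named so that an induction can vary the fuel of the loop while
    that of its body stays fixed. *)
Definition wloop e (b : memory -> ctree memory) :=
  fix loop (f : nat) s : ctree memory :=
    match f with
    | 0 => OutOfFuel
    | f'.+1 =>
        Tick (1 + ecost s e) (if eval s e != 0 then cbind (b s) (loop f') else Ret s)
    end.

Lemma exec_While e c s : exec M F (While e c) s = wloop e (exec M F c) F s.
Proof. by []. Qed.

Definition decr (r : nat) := Store (Const r) (Bin OSub (Fetch (Const r)) (Const 1)).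
(** The counter is decremented before the body runs. Invariants are indexed by the number of rounds
    still to come, which is the value of the counter. *)
Definition For (r : nat) c := While (Fetch (Const r)) (Seq (decr r) c).

Section ForRule.
Variables (r : nat) (c : cmd) (I : nat -> memory -> Prop) (K : nat).
Hypothesis step_post : forall k s, k < K -> I k.+1 s -> s r = k.+1 ->
  post (exec M F c (upd s r k)) (fun s' => I k s' /\ s' r = k).

Lemma wloop_post f k s : k < f -> k <= K -> I k s -> s r = k ->
  post (wloop (Fetch (Const r)) (exec M F (Seq (decr r) c)) f s)
    (fun s' => I 0 s' /\ s' r = 0).
Proof.
elim: f k s => // f IH [|k] s kf kK Is sr /=; rewrite sr //=.
rewrite subn1 /=; apply/post_bind; apply: post_mono (step_post kK Is sr) => s' [Is' sr'].
by apply: (IH k) => //; exact: ltnW.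
Qed.

Lemma For_post s : K < F -> I K s -> s r = K ->
  post (exec M F (For r c) s) (fun s' => I 0 s' /\ s' r = 0).
Proof. by move=> KF Is sr; rewrite /For exec_While; exact: wloop_post Is sr. Qed.

Variables (t b : nat).
Hypothesis step_halts : forall k s, k < K -> I k.+1 s -> s r = k.+1 ->
  halts_within t (exec M F c (upd s r k)).
Hypotheses (r_b : bitlen r <= b) (K_b : bitlen K <= b).

(** Test and decrement together cost nine terms per round: three units, three times the bit length
    of the address, and three bit lengths of counter values. The last test, which leaves the loop,
    accounts for [k.+1] in place of [k]. *)
Lemma wloop_halts f k s : k < f -> k <= K -> I k s -> s r = k ->
  halts_within (k.+1 * (t + 9 * b))
    (wloop (Fetch (Const r)) (exec M F (Seq (decr r) c)) f s).
Proof.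
have b1 : 0 < b by apply: leq_trans r_b.
elim: f k s => // f IH [|k] s kf kK Is sr /=; rewrite sr /=.
  split=> //; rewrite mul1n.
  apply: leq_trans (leq_addl _ _).
  have := leq_trans (bitlen_mono (leq0n K)) K_b; lia.
have k1 := leq_trans (bitlen_mono kK) K_b.
have k2 := leq_trans (bitlen_mono (ltnW kK)) K_b.
have -> : k.+2 * (t + 9 * b) = t + 9 * b + k.+1 * (t + 9 * b) by rewrite mulSn.
set X := k.+1 * _.
split; first by lia.
rewrite subn1 /=.
have b11 : bitlen 1 = 1 by [].
split; first by rewrite b11; lia.
apply: (@halts_mono _ _ (t + X)); first by rewrite b11; lia.
apply: halts_bind; first exact: step_halts.
apply: post_mono (step_post kK Is sr) => s' [Is' sr'].
by apply: IH => //; exact: ltnW.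
Qed.

Lemma For_halts s : K < F -> I K s -> s r = K ->
  halts_within (K.+1 * (t + 9 * b)) (exec M F (For r c) s).
Proof. by move=> KF Is sr; rewrite /For exec_While; exact: wloop_halts Is sr. Qed.

End ForRule.
End Machine.

(** * Bounds on memory growth and running time of deterministic commands *)

Section Costs.
Variables (n : nat) (M : rel 'I_n).
Implicit Types (c : cmd) (s : memory) (e : expr).
Local Open Scope nat_scope.

Fixpoint esize e : nat :=
  match e with
  | Const _ => 1
  | Fetch a => (esize a).+1
  | Bin _ e1 e2 => (esize e1 + esize e2).+1
  end.

Fixpoint csize c : nat :=
  match c with
  | Store a e => 1 + esize a + esize e
  | Query a eu ev => 1 + esize a + esize eu + esize ev
  | Seq c1 c2 => csize c1 + csize c2
  | If e c1 c2 => 1 + esize e + (csize c1 + csize c2)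
  | _ => 1
  end.

(* In a tame expression the only additions are of a constant, so that its value
   exceeds the largest memory cell by at most [egrowth]. *)
Fixpoint etame e : bool :=
  match e with
  | Const _ => true
  | Fetch a => etame a
  | Bin OAdd e1 (Const _) => etame e1
  | Bin OSub e1 e2 | Bin OLeq e1 e2 => etame e1 && etame e2
  | _ => false
  end.

Fixpoint egrowth e : nat :=
  match e with
  | Const k => k
  | Fetch a => egrowth a
  | Bin OLeq e1 e2 => 1 + (egrowth e1 + egrowth e2)
  | Bin _ e1 e2 => egrowth e1 + egrowth e2
  end.

Fixpoint ctame c : bool :=
  match c with
  | Skip => true
  | Store a e => etame a && etame e
  | Query a eu ev => [&& etame a, etame eu & etame ev]
  | Seq c1 c2 => ctame c1 && ctame c2
  | If e c1 c2 => [&& etame e, ctame c1 & ctame c2]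
  | _ => false
  end.

Fixpoint cgrowth c : nat :=
  match c with
  | Store a e => egrowth a + egrowth e
  | Query a eu ev => 1 + egrowth a + egrowth eu + egrowth ev
  | Seq c1 c2 => cgrowth c1 + cgrowth c2
  | If e c1 c2 => egrowth e + (cgrowth c1 + cgrowth c2)
  | _ => 0
  end.

Definition mbound (V : nat) s := forall x, s x <= V.

Lemma mbound_le V V' s : V <= V' -> mbound V s -> mbound V' s.
Proof. by move=> VV' h x; exact: leq_trans VV'. Qed.

Lemma mbound_upd V s a v : mbound V s -> v <= V -> mbound V (upd s a v).
Proof. by move=> h vV x; rewrite /upd; case: ifP. Qed.

Lemma eval_tame V s e : etame e -> mbound V s -> eval s e <= V + egrowth e.
Proof.
move=> + h; elim: e => [k _|a IH /IH ha|o e1 IH1 e2 IH2] /=.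
- by rewrite leq_addl.
- exact: leq_trans (h _) (leq_addr _ _).
case: o => //=.
- by case: e2 IH2 => // k _ /IH1; rewrite /=; lia.
- by move=> /andP[/IH1 h1 /IH2 h2]; lia.
- by move=> _; apply: leq_trans (leq_b1 _) _; lia.
Qed.

Lemma ecost_tame V s e : etame e -> mbound V s ->
  ecost s e <= esize e * bitlen (V + egrowth e).
Proof.
move=> + h; elim: e => [k _|a IH ta|o e1 IH1 e2 IH2 te] /=.
- by rewrite addn0 mul1n bitlen_mono ?leq_addl.
- rewrite mulSn leq_add//; last exact: IH.
  by apply: bitlen_mono; exact: (@eval_tame V s (Fetch a)).
have -> : (esize e1 + esize e2).+1 = 1 + esize e1 + esize e2 by [].
rewrite !mulnDl mul1n -addnA leq_add//.
  by apply: bitlen_mono; exact: (@eval_tame V s (Bin o e1 e2)).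
have [te1 te2 [g1 g2]] : [/\ etame e1, etame e2 &
    egrowth e1 <= egrowth (Bin o e1 e2) /\ egrowth e2 <= egrowth (Bin o e1 e2)].
  move: te; case: o => //=.
  - by case: e2 {IH2} => // k ->; split=> //=; lia.
  - by case/andP=> -> ->; split=> //; lia.
  - by case/andP=> -> ->; split=> //; lia.
apply: leq_add; [apply: leq_trans (IH1 te1) _ | apply: leq_trans (IH2 te2) _];
  rewrite leq_mul2l bitlen_mono ?orbT//; by rewrite leq_add2l.
Qed.

Lemma dexec_tame V s c : ctame c -> mbound V s -> mbound (V + cgrowth c) (dexec M c s).
Proof.
elim: c V s => //= [|a e|a eu ev|c1 IH1 c2 IH2|e c1 IH1 c2 IH2] V s.
- by rewrite addn0.
- case/andP => ta te h; apply: mbound_upd; first exact: mbound_le (leq_addr _ _) h.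
  by apply: leq_trans (eval_tame te h) _; lia.
- move=> _ h; apply: mbound_upd; first exact: mbound_le (leq_addr _ _) h.
  by apply: leq_trans (leq_b1 _) _; lia.
- by case/andP => t1 t2 h; rewrite addnA; apply: IH2 => //; exact: IH1.
- case/and3P => te t1 t2 h; case: ifP => _.
  + by apply: mbound_le (IH1 _ _ t1 h); lia.
  + by apply: mbound_le (IH2 _ _ t2 h); lia.
Qed.

Lemma dcost_tame V s c b : ctame c -> mbound V s -> bitlen (V + cgrowth c) <= b ->
  dcost M c s <= csize c * b.
Proof.
have bm x y : x <= y -> bitlen y <= b -> bitlen x <= b.
  by move=> xy; apply: leq_trans; exact: bitlen_mono.
have ec W u e : etame e -> mbound W u -> bitlen (W + egrowth e) <= b ->
    ecost u e <= esize e * b.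
  move=> te h hb; apply: leq_trans (ecost_tame te h) _.
  by rewrite leq_mul2l hb orbT.
have b1 x : bitlen x <= b -> 1 <= b by apply: leq_trans.
elim: c V s => //= [|a e|a eu ev|c1 IH1 c2 IH2|e c1 IH1 c2 IH2] V s.
- by move=> _ _ hb; rewrite mul1n (b1 _ hb).
- case/andP => ta te h hb; rewrite !mulnDl mul1n.
  have B1 := b1 _ hb.
  by rewrite !leq_add// (ec V)//; apply: bm hb; lia.
- case/and3P => ta tu tv h hb; rewrite !mulnDl mul1n.
  have B1 := b1 _ hb.
  by rewrite !leq_add// (ec V)//; apply: bm hb; lia.
- case/andP => t1 t2 h hb; rewrite mulnDl leq_add//.
    by apply: IH1 h _ => //; apply: bm hb; lia.
  by apply: IH2 (dexec_tame t1 h) _ => //; apply: bm hb; lia.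
- case/and3P => te t1 t2 h hb; rewrite !mulnDl mul1n.
  have B1 := b1 _ hb.
  rewrite !leq_add//.
    by apply: (ec V) => //; apply: bm hb; lia.
  case: ifP => _; [apply: leq_trans (leq_addr _ _)|apply: leq_trans (leq_addl _ _)].
    by apply: IH1 h _ => //; apply: bm hb; lia.
  by apply: IH2 h _ => //; apply: bm hb; lia.
Qed.

(** A second growth measure, for code that multiplies registers: values stay below [V ^ edeg e] once
    cells and constants are at most [V]. Degrees multiply under [Seq], so this suits code started
    from a known bound; the repeated [body] is handled by the tame measure. *)
Fixpoint edeg e : nat :=
  match e with
  | Const _ => 1
  | Fetch a => edeg a
  | Bin _ e1 e2 => 1 + (edeg e1 + edeg e2)
  end.

Fixpoint econst e : nat :=
  match e with
  | Const k => k
  | Fetch a => econst a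
  | Bin _ e1 e2 => econst e1 + econst e2
  end.

Fixpoint cdeg c : nat :=
  match c with
  | Store a e => edeg a + edeg e
  | Query a eu ev => edeg a + edeg eu + edeg ev
  | Seq c1 c2 => cdeg c1 * cdeg c2
  | If e c1 c2 => edeg e + (cdeg c1 + cdeg c2)
  | _ => 1
  end.

Fixpoint cconst c : nat :=
  match c with
  | Store a e => econst a + econst e
  | Query a eu ev => econst a + econst eu + econst ev
  | Seq c1 c2 => cconst c1 + cconst c2
  | If e c1 c2 => econst e + (cconst c1 + cconst c2)
  | _ => 0
  end.

Lemma edeg_gt0 e : 0 < edeg e.
Proof. by elim: e. Qed.

Lemma cdeg_gt0 c : 0 < cdeg c.
Proof.
elim: c => //= *; rewrite ?muln_gt0 ?addn_gt0 ?edeg_gt0//.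
by apply/andP.
Qed.

Lemma leq_expW V a b : 1 < V -> a <= b -> V ^ a <= V ^ b.
Proof. by move=> V1 ab; rewrite leq_exp2l. Qed.

Lemma eval_deg V s e : 1 < V -> econst e <= V -> mbound V s ->
  eval s e <= V ^ edeg e.
Proof.
move=> V1 + h; elim: e => [k /= kV|a IH /= ha|o e1 IH1 e2 IH2 /= ce].
- by rewrite expn1.
- by apply: leq_trans (h _) _; rewrite -[X in X <= _]expn1 leq_expW// edeg_gt0.
have /IH1 h1 : econst e1 <= V by lia.
have /IH2 h2 : econst e2 <= V by lia.
have d1 := edeg_gt0 e1; have d2 := edeg_gt0 e2.
have V0 : 0 < V by lia.
have p1 : V ^ edeg e1 <= V ^ (edeg e1 + edeg e2) by rewrite leq_expW// leq_addr.
have p2 : V ^ edeg e2 <= V ^ (edeg e1 + edeg e2) by rewrite leq_expW// leq_addl.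
have pS : 2 * V ^ (edeg e1 + edeg e2) <= V ^ (1 + (edeg e1 + edeg e2)).
  by rewrite add1n expnS leq_mul2r V1 orbT.
have pp : 0 < V ^ (edeg e1 + edeg e2) by rewrite expn_gt0 V0.
case: o => /=; try lia.
- apply: leq_trans (leq_mul h1 h2) _; rewrite -expnD; lia.
- apply: leq_trans (leq_div _ _) _; lia.
Qed.

Lemma ecost_deg V s e b : 1 < V -> econst e <= V -> mbound V s ->
  bitlen (V ^ edeg e) <= b -> ecost s e <= esize e * b.
Proof.
move=> V1 + h; elim: e => [k /= kV|a IH /= ca hb|o e1 IH1 e2 IH2 ce hb].
- by rewrite expn1 addn0 mul1n; apply: leq_trans; exact: bitlen_mono.
- rewrite mulSn leq_add//; last exact: IH.
  by apply: leq_trans hb; apply: bitlen_mono; exact: (@eval_deg V s (Fetch a)).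
rewrite /= -add1n !mulnDl mul1n leq_add//.
  by apply: leq_trans hb; apply: bitlen_mono; exact: (@eval_deg V s (Bin o e1 e2)).
move: ce => /= ce; apply: leq_add; [apply: IH1 | apply: IH2]; try lia;
  apply: leq_trans hb; apply: bitlen_mono; rewrite leq_expW//=; lia.
Qed.

Lemma dexec_deg V s c : 1 < V -> simple c -> cconst c <= V -> mbound V s ->
  mbound (V ^ cdeg c) (dexec M c s).
Proof.
move=> V1; have V0 : 0 < V by lia.
have up W k u : 1 < W -> 0 < k -> mbound W u -> mbound (W ^ k) u.
  move=> W1 k0; apply: mbound_le; by rewrite -[X in X <= _]expn1 leq_expW.
elim: c V s V1 V0 => //= [a e|a eu ev|c1 IH1 c2 IH2|e c1 IH1 c2 IH2] V s V1 V0.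
- move=> _ hc h; apply: mbound_upd; first by apply: up => //; rewrite addn_gt0 edeg_gt0.
  apply: leq_trans (eval_deg V1 _ h) _; first by lia.
  by rewrite leq_expW// leq_addl.
- move=> _ hc h; have d0 := edeg_gt0 a; apply: mbound_upd; first by apply: up => //; lia.
  by apply: leq_trans (leq_b1 _) _; rewrite expn_gt0 V0.
- case/andP => s1 s2 hc h; rewrite expnM; have d1 := cdeg_gt0 c1.
  have VV : V <= V ^ cdeg c1 by rewrite -[X in X <= _]expn1 leq_expW.
  apply: IH2 => //; try lia; apply: IH1 => //; lia.
- case/andP => s1 s2 hc h; case: ifP => _.
  + apply: mbound_le (IH1 V s V1 V0 s1 _ h); last by lia.
    rewrite leq_expW//; lia.
  + apply: mbound_le (IH2 V s V1 V0 s2 _ h); last by lia.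
    rewrite leq_expW//; lia.
Qed.

Lemma dcost_deg V s c b : 1 < V -> simple c -> cconst c <= V -> mbound V s ->
  bitlen (V ^ cdeg c) <= b -> dcost M c s <= csize c * b.
Proof.
have ec W k u e : 1 < W -> econst e <= W -> mbound W u -> edeg e <= k ->
    bitlen (W ^ k) <= b -> ecost u e <= esize e * b.
  move=> W1 cW h ek hb; apply: ecost_deg h _ => //.
  by apply: leq_trans hb; apply: bitlen_mono; rewrite leq_expW.
have bm W j k : 1 < W -> j <= k -> bitlen (W ^ k) <= b -> bitlen (W ^ j) <= b.
  by move=> W1 jk; apply: leq_trans; apply: bitlen_mono; rewrite leq_expW.
have b1 x : bitlen x <= b -> 1 <= b by apply: leq_trans.
elim: c V s => //= [|a e|a eu ev|c1 IH1 c2 IH2|e c1 IH1 c2 IH2] V s V1.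
- by move=> _ _ _ hb; rewrite mul1n (b1 _ hb).
- move=> _ hc h hb; rewrite !mulnDl mul1n; have B1 := b1 _ hb.
  by rewrite !leq_add// (ec V _ _ _ _ _ h _ hb)//; lia.
- move=> _ hc h hb; rewrite !mulnDl mul1n; have B1 := b1 _ hb.
  by rewrite !leq_add// (ec V _ _ _ _ _ h _ hb)//; lia.
- case/andP => s1 s2 hc h hb; rewrite mulnDl.
  have d1 := cdeg_gt0 c1; have d2 := cdeg_gt0 c2.
  have VV : V <= V ^ cdeg c1 by rewrite -[X in X <= _]expn1 leq_expW.
  rewrite leq_add//.
    apply: IH1 h _ => //; first by lia.
    by apply: bm hb => //; rewrite leq_pmulr.
  apply: IH2 (dexec_deg V1 s1 _ h) _ => //; try lia.
  by rewrite -expnM.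
- case/andP => s1 s2 hc h hb; rewrite !mulnDl mul1n; have B1 := b1 _ hb.
  rewrite !leq_add//; first by rewrite (ec V _ _ _ _ _ h _ hb)//; lia.
  case: ifP => _; [apply: leq_trans (leq_addr _ _)|apply: leq_trans (leq_addl _ _)].
    apply: IH1 h _ => //; first by lia.
    by apply: bm hb => //; lia.
  apply: IH2 h _ => //; first by lia.
  by apply: bm hb => //; lia.
Qed.

End Costs.

(** * The main loop *)

(* Registers.  The drawn vertices are stored from address [data] on, up to the
   address held by [rStk]; from there on lie the list of picked vertices in the
   exact phase, and the recursion stack in the sampling phase. *)
Local Notation rDen := 1%N.
Local Notation rI := 2%N.
Local Notation rAtt := 3%N.
Local Notation rB := 4%N.
Local Notation rE := 5%N.
Local Notation rS := 6%N.
Local Notation rL := 7%N.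
Local Notation rLen := 8%N.
Local Notation rSmp := 9%N.
Local Notation rK := 10%N.
Local Notation rBud := 11%N.
Local Notation rBase := 12%N.
Local Notation rEnd := 13%N.
Local Notation rStop := 14%N.
Local Notation rStk := 15%N.
Local Notation rP := 16%N.
Local Notation rQ := 17%N.
Local Notation rTop := 18%N.
Local Notation rMode := 19%N.
Local Notation rCnt := 20%N.
Local Notation rW := 21%N.
Local Notation rT := 22%N.
Local Notation rW0 := 23%N.
Local Notation rDen0 := 24%N.
Local Notation data := 30%N.

Local Arguments upd : simpl never.

Definition Reg (r : nat) := Fetch (Const r).
Definition Set_ (r : nat) (e : expr) := Store (Const r) e.
Definition Incr (r : nat) := Set_ r (Bin OAdd (Reg r) (Const 1)).
Definition Leq (e1 e2 : expr) := Bin OLeq e1 e2.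
Definition Eq (e1 e2 : expr) :=
  Bin OSub (Leq e1 e2) (Bin OSub (Const 1) (Leq e2 e1)).
Definition Ask := Query (Const rT) (Fetch (Reg rQ)) (Fetch (Reg rP)).
Definition Pop := Seq (decr rTop) (Set_ rQ (Fetch (Reg rTop))).

(** The vertex is stored before the length is compared with [rK], so the list may hold one vertex
    too many. It is then discarded, and sampling begins with the vertex at [rEnd]. *)
Definition exact_append :=
  Seq (Store (Reg rTop) (Fetch (Reg rP))) (Seq (Incr rTop) (Seq (Incr rP)
    (Seq (Set_ rQ (Reg rStk))
      (If (Leq (Bin OSub (Reg rTop) (Reg rStk)) (Reg rK)) Skip
        (Seq (Set_ rQ (Reg rEnd)) (Seq (Set_ rP (Reg rBase))
          (Seq (Set_ rTop (Reg rStk)) (Set_ rMode (Const 1))))))))).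
Definition exact_finish :=
  Seq (Set_ rCnt (Bin OSub (Reg rTop) (Reg rStk))) (Seq (Set_ rW (Const 1))
    (Seq (Set_ rDen (Const 1)) (Set_ rMode (Const 3)))).
(** Comparing [1 - rT] with the equality bit expresses a disjunction: a vertex is rejected if it
    equals a picked vertex or is adjacent to one. *)
Definition exact_test :=
  Seq Ask
    (If (Leq (Bin OSub (Const 1) (Reg rT)) (Eq (Fetch (Reg rQ)) (Fetch (Reg rP))))
      (Seq (Incr rP) (Set_ rQ (Reg rStk))) (Incr rQ)).
Definition exact_step :=
  If (Leq (Reg rEnd) (Reg rP)) exact_finish
    (If (Leq (Reg rTop) (Reg rQ)) exact_append exact_test).

(** A vertex that meets itself belongs to the greedy set. A root is counted; for a child it follows
    that the parent, popped into [rQ], is dominated. Mode 2 is correct in both cases. *)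
Definition scan_match :=
  Seq (If (Leq (Reg rTop) (Reg rStk)) (Incr rCnt) Pop) (Set_ rMode (Const 2)).
Definition scan_push :=
  Seq (Store (Reg rTop) (Reg rQ)) (Seq (Incr rTop)
    (Seq (Set_ rQ (Reg rP)) (Set_ rP (Reg rBase)))).
Definition scan_step :=
  If (Eq (Fetch (Reg rQ)) (Fetch (Reg rP))) scan_match
    (Seq Ask (If (Reg rT) scan_push (Incr rP))).

Definition next_sample :=
  Seq (Incr rQ) (Seq (Set_ rP (Reg rBase))
    (If (Leq (Reg rStop) (Reg rQ)) (Set_ rMode (Const 3)) (Set_ rMode (Const 1)))).
(** A child is named by the address at which its parent's scan was interrupted, so no scan position
    is saved on the stack: the parent resumes at [rQ + 1]. *)
Definition return_step :=
  If (Leq (Reg rTop) (Reg rStk)) next_sample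
    (Seq (Set_ rP (Bin OAdd (Reg rQ) (Const 1))) (Seq Pop (Set_ rMode (Const 1)))).

(* Modes: 0, exact greedy phase; 1, scanning the sequence for the vertex at
   address [rQ]; 2, that vertex was found to be dominated (or, at the root of
   the recursion, its test is over); 3, finished. *)
Definition body :=
  If (Leq (Reg rMode) (Const 0)) exact_step
    (If (Leq (Reg rMode) (Const 1)) scan_step
      (If (Leq (Reg rMode) (Const 2)) return_step Skip)).

Lemma body_tame : ctame body. Proof. by []. Qed.

(** * Simulation of the main loop by abstract configurations *)

Section Body.
Variables (n : nat) (M : rel 'I_n).
Implicit Types s : memory.
Local Open Scope nat_scope.
Local Notation dx := (dexec M).

Lemma eval_Eq s e1 e2 : eval s (Eq e1 e2) = (eval s e1 == eval s e2).
Proof. by rewrite /= eqn_leq; case: (_ <= _); case: (_ <= _). Qed.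

(** The registers that [body] may write. Its other writes go to addresses from the stack base on. *)
Definition dyn : seq nat := [:: rDen; rP; rQ; rTop; rMode; rCnt; rW; rT].

Variable s0 : memory.
Hypothesis stk_gt : data <= s0 rStk.
Local Notation stk := (s0 rStk).

(* The flag tells whether the loop counter [rB] is allowed to vary. *)
Definition Inv_ (fl : bool) s :=
  (forall x, x < stk -> x \notin dyn -> ~~ (fl && (x == rB)) -> s x = s0 x) /\
  stk <= s rTop.

Section Flag.
Variable fl : bool.
Local Notation Inv := (Inv_ fl).

Lemma Inv_reg s x : Inv s -> x < data -> x \notin rB :: dyn -> s x = s0 x.
Proof.
case=> h _ xd; rewrite inE negb_or => /andP[xB xn]; apply: h => //.
  exact: leq_trans stk_gt.
by rewrite (negbTE xB) andbF.
Qed.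

Lemma Inv_dyn s x v : Inv s -> x \in dyn -> x != rTop -> Inv (upd s x v).
Proof.
case=> h ht xd xt; split; last by rewrite /upd eq_sym (negbTE xt).
move=> z zs zd zB; rewrite /upd; case: eqP => [zx|_]; last exact: h.
by rewrite zx xd in zd.
Qed.

Lemma Inv_top s v : Inv s -> stk <= v -> Inv (upd s rTop v).
Proof.
case=> h ht sv; split=> // z zs zd zB; rewrite /upd; case: eqP => [zx|_]; last exact: h.
by rewrite zx in zd.
Qed.

Lemma Inv_mem s a v : Inv s -> stk <= a -> Inv (upd s a v).
Proof.
case=> h ht sa; split=> [z zs zd zB|]; rewrite /upd.
  by case: eqP => [zx|_]; [move: sa; rewrite -zx leqNgt zs|exact: h].
by case: eqP => // e; move: sa stk_gt; rewrite -e; lia.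
Qed.

Lemma Inv_Set s r e : Inv s -> (r \in dyn) && (r != rTop) -> Inv (dx (Set_ r e) s).
Proof. by move=> h /andP[h1 h2]; exact: Inv_dyn. Qed.

Lemma Inv_Seq s c1 c2 : (forall u, Inv u -> Inv (dx c2 u)) -> Inv (dx c1 s) ->
  Inv (dx (Seq c1 c2) s).
Proof. by move=> h1 h2; exact: h1. Qed.

Lemma Inv_SeqA s a b c : (forall u, Inv u -> Inv (dx c u)) ->
  Inv (dx (Seq a b) s) -> Inv (dx (Seq a (Seq b c)) s).
Proof. by move=> h1 h2; exact: h1. Qed.

Lemma Inv_If s e c1 c2 : (eval s e != 0 -> Inv (dx c1 s)) ->
  (eval s e == 0 -> Inv (dx c2 s)) -> Inv (dx (If e c1 c2) s).
Proof. by move=> h1 h2 /=; case: ifPn => [/h1|/negPn/h2]. Qed.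

Lemma Inv_Ask s : Inv s -> Inv (dx Ask s).
Proof. by move=> h; exact: Inv_dyn. Qed.

Lemma Inv_push s e : Inv s -> Inv (dx (Seq (Store (Reg rTop) e) (Incr rTop)) s).
Proof.
move=> h /=; have [_ ht] := h; apply: Inv_top; first exact: Inv_mem.
by have [_ h2] := Inv_mem (eval s e) h ht; lia.
Qed.

Lemma Inv_Pop s : Inv s -> eval s (Leq (Reg rTop) (Reg rStk)) == 0 -> Inv (dx Pop s).
Proof.
move=> h; rewrite /= (@Inv_reg s rStk h) //; case: (leqP (s rTop) stk) => // ht _.
by apply: Inv_dyn => //; apply: Inv_top => //; lia.
Qed.

Lemma Inv_body s : Inv s -> Inv (dx body s).
Proof.
move=> h; apply: Inv_If => _.
  apply: Inv_If => _.
    by do 3! (apply: Inv_Seq => [{h s} s h|]; last exact: Inv_Set); exact: Inv_Set.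
  apply: Inv_If => _.
    apply: Inv_SeqA; last exact: Inv_push.
    move=> {h s} s h; apply: Inv_Seq => [{h s} s h|]; last exact: Inv_Set.
    apply: Inv_Seq => [{h s} s h|]; last exact: Inv_Set.
    apply: Inv_If => _ //; apply: Inv_Seq => [{h s} s h|]; last exact: Inv_Set.
    apply: Inv_Seq => [{h s} s h|]; last exact: Inv_Set.
    apply: Inv_Seq => [{h s} s h|]; first exact: Inv_Set.
    by rewrite /= (@Inv_reg s rStk h) //; apply: Inv_top.
  apply: Inv_Seq => [{h s} s h|]; last exact: Inv_Ask.
  apply: Inv_If => _; last exact: Inv_Set.
  by apply: Inv_Seq => [{h s} s h|]; exact: Inv_Set.
apply: Inv_If => _.
  apply: Inv_If => _.
    apply: Inv_Seq => [{h s} s h|]; first exact: Inv_Set.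
    by apply: Inv_If => hs; [exact: Inv_Set|exact: Inv_Pop].
  apply: Inv_Seq => [{h s} s h|]; last exact: Inv_Ask.
  apply: Inv_If => _; last exact: Inv_Set.
  apply: Inv_SeqA; last exact: Inv_push.
  move=> {h s} s h; apply: Inv_Seq => [{h s} s h|]; exact: Inv_Set.
apply: Inv_If => _ //; apply: Inv_If => hs.
  apply: Inv_Seq => [{hs h s} s h|]; last exact: Inv_Set.
  apply: Inv_Seq => [{h s} s h|]; last exact: Inv_Set.
  by apply: Inv_If => _; exact: Inv_Set.
apply: Inv_SeqA.
  by move=> {hs h s} s h; exact: Inv_Set.
apply: Inv_Pop => //; first exact: Inv_Set.
Qed.

End Flag.

Local Notation Inv := (Inv_ true).

Lemma Inv_rB s k : Inv s -> Inv (upd s rB k).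
Proof.
by case=> h ht; split=> // z zs zd zB; rewrite /upd; have /= /negbTE -> := zB; exact: h.
Qed.

Lemma dexec_Seq s c1 c2 : dx (Seq c1 c2) s = dx c2 (dx c1 s). Proof. by []. Qed.
Lemma dexec_Set s r e : dx (Set_ r e) s = upd s r (eval s e). Proof. by []. Qed.
Lemma dexec_Store s a e : dx (Store a e) s = upd s (eval s a) (eval s e).
Proof. by []. Qed.
Lemma dexec_IfT s e c1 c2 : eval s e != 0 -> dx (If e c1 c2) s = dx c1 s.
Proof. by move=> /= ->. Qed.
Lemma dexec_IfF s e c1 c2 : eval s e = 0 -> dx (If e c1 c2) s = dx c2 s.
Proof. by move=> /= ->. Qed.
Lemma dexec_Ask s : dx Ask s = upd s rT (oracle M (s (s rQ)) (s (s rP))).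
Proof. by []. Qed.
Lemma body3 s : s rMode = 3 -> dx body s = s.
Proof. by move=> hm; rewrite /= hm. Qed.
Local Arguments dexec : simpl never.

Record cfg := Cfg { c_mode : nat; c_p : nat; c_q : nat; c_stack : seq nat;
  c_cnt : nat; c_w : nat; c_den : nat }.

(** The abstraction relation. The oracle answer [rT], the loop counter [rB] and the cells beyond the
    stack top are left unspecified. *)
Definition St (c : cfg) s :=
  [/\ Inv s, s rMode = c_mode c, s rP = c_p c, s rQ = c_q c &
      s rTop = stk + size (c_stack c)] /\
  [/\ forall i, i < size (c_stack c) -> s (stk + i) = nth 0 (c_stack c) i,
      s rCnt = c_cnt c, s rW = c_w c & s rDen = c_den c].

(** One round of [For rB body], including the decrement. *)
Definition bstep s := dx body (upd s rB (s rB).-1).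

Definition reach c c' t := forall s, St c s -> St c' (iter t bstep s).

Lemma St_rB c s k : St c s -> St c (upd s rB k).
Proof.
case=> -[hi hm hp hq ht] [hs hc hw hd].
split; split; rewrite ?/upd //=; first exact: Inv_rB.
by move=> i hi'; case: eqP => [e|_]; [move: stk_gt; lia|exact: hs].
Qed.

Lemma reach0 c : reach c c 0. Proof. by []. Qed.

Lemma reach_trans c1 c2 c3 t1 t2 : reach c1 c2 t1 -> reach c2 c3 t2 ->
  reach c1 c3 (t1 + t2).
Proof. by move=> h1 h2 s /h1/h2; rewrite addnC iterD. Qed.

Lemma reach1 c c' : (forall s, St c s -> St c' (dx body s)) -> reach c c' 1.
Proof. by move=> h s /St_rB => /(_ (s rB).-1); exact: h. Qed.

Lemma reg_stk r k : r < data -> (r == stk + k) = false.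
Proof. by move=> h; apply/negbTE; move: stk_gt; lia. Qed.

Variables (base L m K : nat) (vtx : nat -> 'I_n).
Hypotheses (base_data : data <= base) (stop_stk : base + L + m <= stk).
Hypotheses (s0_base : s0 rBase = base) (s0_end : s0 rEnd = base + L).
Hypotheses (s0_stop : s0 rStop = base + L + m) (s0_K : s0 rK = K).
Hypothesis s0_vtx : forall a, base <= a < base + L + m -> s0 a = vtx a.
Hypotheses (M_sym : symmetric M) (M_irr : irreflexive M).

Lemma Inv_vtx s a : Inv s -> base <= a < base + L + m -> s a = vtx a.
Proof.
move=> [h _] ha; have a1 : a < stk by lia.
have a2 : a \notin dyn by rewrite !inE; move: ha base_data; lia.
have a3 : ~~ (true && (a == rB)) by move: ha base_data => /=; lia.
by rewrite h// s0_vtx.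
Qed.

Lemma oracleE (u v : 'I_n) : oracle M u v = M u v.
Proof. by rewrite /oracle !valK. Qed.

Lemma St_static c s : St c s ->
  [/\ s rBase = base, s rEnd = base + L, s rStop = base + L + m, s rStk = stk & s rK = K].
Proof. by case=> -[hi _ _ _ _] _; rewrite !(Inv_reg hi). Qed.

Lemma body0 s : s rMode = 0 -> dx body s = dx exact_step s.
Proof. by move=> hm; apply: dexec_IfT; rewrite /= hm. Qed.

Lemma body1 s : s rMode = 1 -> dx body s = dx scan_step s.
Proof.
move=> hm; rewrite /body (@dexec_IfF s (Leq (Reg rMode) (Const 0))); last by rewrite /= hm.
by apply: dexec_IfT; rewrite /= hm.
Qed.

Lemma body2 s : s rMode = 2 -> dx body s = dx return_step s.
Proof.
move=> hm; rewrite /body (@dexec_IfF s (Leq (Reg rMode) (Const 0))); last by rewrite /= hm.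
rewrite (@dexec_IfF s (Leq (Reg rMode) (Const 1))); last by rewrite /= hm.
by apply: dexec_IfT; rewrite /= hm.
Qed.

Lemma upd_eq s a v : upd s a v a = v. Proof. by rewrite /upd eqxx. Qed.
Lemma upd_ne s a v x : x != a -> upd s a v x = s x.
Proof. by rewrite /upd => /negbTE ->. Qed.
Lemma upd_reg_stk s r v k : r < data -> upd s r v (stk + k) = s (stk + k).
Proof. by move=> h; rewrite upd_ne// eq_sym reg_stk. Qed.
Lemma upd_stk_reg s r v k : r < data -> upd s (stk + k) v r = s r.
Proof. by move=> h; rewrite upd_ne// reg_stk. Qed.

Lemma St_dyn c s k : St c s -> St c (upd s rT k).
Proof.
case=> -[hi hm hp hq ht] [hs hc hw hd].
split; split; rewrite ?upd_ne//; first exact: Inv_dyn.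
by move=> i hi'; rewrite upd_reg_stk// hs.
Qed.

Lemma Ask_St c s u v : St c s -> s (c_q c) = val u -> s (c_p c) = val v ->
  exists s', [/\ dx Ask s = s', St c s' & s' rT = M u v].
Proof.
move=> hS hu hv; exists (upd s rT (M u v)); split; last by rewrite upd_eq.
  have [[_ _ hp hq _] _] := hS.
  by rewrite dexec_Ask hp hq hu hv oracleE.
exact: St_dyn.
Qed.

Lemma eval_orEq s (b : bool) e1 e2 : s rT = b ->
  (eval s (Leq (Bin OSub (Const 1) (Reg rT)) (Eq e1 e2)) != 0) =
  (eval s e1 == eval s e2) || b.
Proof.
move=> hb; rewrite -[eval s (Leq _ _)]/(nat_of_bool (1 - s rT <= eval s (Eq e1 e2))).
by rewrite eval_Eq hb; case: b {hb}; case: (eval s e1 == eval s e2).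
Qed.

Lemma reach_body c c' :
  (forall s, St c s ->
    [/\ s rBase = base, s rEnd = base + L, s rStop = base + L + m, s rStk = stk & s rK = K] ->
    St c s -> Inv (dx body s) -> St c' (dx body s)) -> reach c c' 1.
Proof.
move=> h; apply: reach1 => s hS; apply: (h s hS (St_static hS) hS).
by apply: Inv_body; case: hS => -[].
Qed.

Lemma exact_conflict p i (J : seq 'I_n) cnt w d : base <= p < base + L -> i < size J ->
  (nth (vtx p) J i == vtx p) || M (nth (vtx p) J i) (vtx p) ->
  reach (Cfg 0 p (stk + i) (map val J) cnt w d) (Cfg 0 p.+1 stk (map val J) cnt w d) 1.
Proof.
move=> hpL hiJ hz; apply: reach1 => s hS; have hS0 := hS.
have [hb he ho hk hK] := St_static hS.
case: hS => -[hi hm hp hq ht] [/= hs hc hw hd].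
have hI := Inv_body hi.
have hQ u : St (Cfg 0 p (stk + i) (map val J) cnt w d) u -> u (stk + i) = nth (vtx p) J i.
  by case=> _ [/= h _ _ _]; rewrite h ?size_map// (nth_map (vtx p)).
have hP u : St (Cfg 0 p (stk + i) (map val J) cnt w d) u -> u p = vtx p.
  by case=> -[hu _ _ _ _] _; rewrite (Inv_vtx hu)//; lia.
have [u [Eu hu ut]] := Ask_St hS0 (hQ _ hS0) (hP _ hS0).
have E : dx body s = upd (upd u rP p.+1) rQ stk.
  rewrite body0// /exact_step dexec_IfF; last by rewrite /= he hp leqNgt; case/andP: hpL => _ ->.
  rewrite dexec_IfF; last by rewrite /= ht hq size_map leq_add2l leqNgt hiJ.
  rewrite /exact_test dexec_Seq Eu.
  case: (hu) => -[_ _ up uq _] _; have [_ _ _ uk _] := St_static hu.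
  rewrite dexec_IfT; first by rewrite dexec_Seq !dexec_Set /= up addn1 upd_ne// uk.
  by rewrite (eval_orEq _ _ ut) /= uq up hQ// hP.
rewrite E in hI *.
have [_ [/= us uc uw ud]] := hu; have [[/= _ um _ _ ut'] _] := hu.
split; split; rewrite //= ?upd_ne//.
by move=> j hj; rewrite !upd_reg_stk// us.
Qed.

Lemma exact_skip p i (J : seq 'I_n) cnt w d : base <= p < base + L -> i < size J ->
  (nth (vtx p) J i == vtx p) || M (nth (vtx p) J i) (vtx p) = false ->
  reach (Cfg 0 p (stk + i) (map val J) cnt w d) (Cfg 0 p (stk + i.+1) (map val J) cnt w d) 1.
Proof.
move=> hpL hiJ hz; apply: reach_body => s hS0 [hb he ho hk hK] [[/= hi hm hp hq ht] [/= hs hc hw hd]] hI.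
have hQ u : St (Cfg 0 p (stk + i) (map val J) cnt w d) u -> u (stk + i) = nth (vtx p) J i.
  by case=> _ [/= h _ _ _]; rewrite h ?size_map// (nth_map (vtx p)).
have hP u : St (Cfg 0 p (stk + i) (map val J) cnt w d) u -> u p = vtx p.
  by case=> -[hu _ _ _ _] _; rewrite (Inv_vtx hu)//; lia.
have [u [Eu hu ut]] := Ask_St hS0 (hQ _ hS0) (hP _ hS0).
have E : dx body s = upd u rQ (stk + i.+1).
  rewrite body0// /exact_step dexec_IfF; last by rewrite /= he hp leqNgt; case/andP: hpL => _ ->.
  rewrite dexec_IfF; last by rewrite /= ht hq size_map leq_add2l leqNgt hiJ.
  rewrite /exact_test dexec_Seq Eu.
  case: (hu) => -[_ _ up uq _] _.
  rewrite dexec_IfF; first by rewrite dexec_Set /= uq addn1 addnS.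
  apply/eqP/negPn; rewrite (eval_orEq _ _ ut) /= uq up hQ// hP// -[_ == _ :> nat]/(_ == _).
  by apply/negbT.
rewrite E in hI *.
have [_ [/= us uc uw ud]] := hu; have [[/= _ um up _ ut'] _] := hu.
split; split; rewrite //= ?upd_ne//.
by move=> j hj; rewrite !upd_reg_stk// us.
Qed.

Lemma nth_push s (l : seq nat) x i :
  (forall i, i < size l -> s (stk + i) = nth 0 l i) -> i < size (rcons l x) ->
  upd s (stk + size l) x (stk + i) = nth 0 (rcons l x) i.
Proof.
move=> h; rewrite size_rcons ltnS leq_eqVlt nth_rcons => /predU1P[->|il].
  by rewrite upd_eq ltnn eqxx.
by rewrite il upd_ne ?h// eqn_add2l ltn_eqF.
Qed.

Lemma exact_pick p (J : seq 'I_n) cnt w d : base <= p < base + L -> size J < K ->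
  reach (Cfg 0 p (stk + size J) (map val J) cnt w d)
        (Cfg 0 p.+1 stk (map val (rcons J (vtx p))) cnt w d) 1.
Proof.
move=> hpL hJ; apply: reach_body => s hS0 [hb he ho hk hK] [[/= hi hm hp hq ht] [/= hs hc hw hd]] hI.
have hP : s p = vtx p by rewrite (Inv_vtx hi)//; lia.
rewrite size_map in ht.
have E : dx body s = upd (upd (upd (upd s (stk + size J) (vtx p)) rTop (stk + size J).+1) rP p.+1) rQ stk.
  rewrite body0// /exact_step dexec_IfF; last by rewrite /= he hp leqNgt; case/andP: hpL => _ ->.
  rewrite dexec_IfT; last by rewrite /= ht hq leqnn.
  rewrite /exact_append /Incr !dexec_Seq dexec_Store !dexec_Set /= ht hp hP.
  rewrite !(upd_eq, upd_stk_reg, upd_ne)// ht hp hk !addn1.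
  by rewrite dexec_IfT //= !(upd_eq, upd_stk_reg, upd_ne)// hk hK -addnS addKn hJ.
rewrite E in hI *.
split; split; rewrite //= ?(upd_eq, upd_stk_reg, upd_ne)//.
  by rewrite size_map size_rcons addnS.
move=> j hj; rewrite 3?upd_reg_stk// map_rcons -[size J](size_map val).
by apply: nth_push => //; rewrite -map_rcons.
Qed.

Lemma exact_overflow p (J : seq 'I_n) cnt w d : base <= p < base + L -> K <= size J ->
  reach (Cfg 0 p (stk + size J) (map val J) cnt w d)
        (Cfg 1 base (base + L) [::] cnt w d) 1.
Proof.
move=> hpL hJ; apply: reach_body => s hS0 [hb he ho hk hK] [[/= hi hm hp hq ht] [/= hs hc hw hd]] hI.
rewrite size_map in ht.
have E : exists u, dx body s = upd (upd (upd (upd u rQ (base + L)) rP base) rTop stk) rMode 1 /\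
    (forall r, r \in [:: rCnt; rW; rDen] -> u r = s r).
  exists (upd (upd (upd (upd s (stk + size J) (s p)) rTop (stk + size J).+1) rP p.+1) rQ stk).
  split; last by move=> r; rewrite !inE => /or3P[]/eqP ->;
    rewrite !(upd_eq, upd_stk_reg, upd_ne).
  rewrite body0// /exact_step dexec_IfF; last by rewrite /= he hp leqNgt; case/andP: hpL => _ ->.
  rewrite dexec_IfT; last by rewrite /= ht hq leqnn.
  rewrite /exact_append /Incr !dexec_Seq dexec_Store !dexec_Set /= ht hp.
  rewrite !(upd_eq, upd_stk_reg, upd_ne)// ht hp hk !addn1.
  rewrite dexec_IfF; last first.
    by rewrite /= !(upd_eq, upd_stk_reg, upd_ne)// hk hK -addnS addKn ltnNge hJ.
  rewrite !dexec_Seq !dexec_Set /= !(upd_eq, upd_stk_reg, upd_ne)//.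
  by rewrite hk he hb.
case: E => u [E hu]; rewrite E in hI *.
by split; split; rewrite //= ?(upd_eq, upd_ne, addn0)// hu.
Qed.

Lemma exact_done p q st cnt w d : base + L <= p ->
  reach (Cfg 0 p q st cnt w d) (Cfg 3 p q st (size st) 1 1) 1.
Proof.
move=> hpL; apply: reach_body => s hS0 [hb he ho hk hK] [[/= hi hm hp hq ht] [/= hs hc hw hd]] hI.
have E : dx body s = upd (upd (upd (upd s rCnt (size st)) rW 1) rDen 1) rMode 3.
  rewrite body0// /exact_step dexec_IfT; last by rewrite /= he hp hpL.
  by rewrite /exact_finish !dexec_Seq !dexec_Set /= ht hk addKn.
rewrite E in hI *.
split; split; rewrite //= ?(upd_eq, upd_ne)//.
by move=> j hj; rewrite !upd_reg_stk// hs.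
Qed.

Section Scan.
Variables (p q : nat) (st : seq nat) (cnt w d : nat).
Hypotheses (p_blk : base <= p < base + L + m) (q_blk : base <= q < base + L + m).

Lemma scan_match_root : vtx p = vtx q ->
  reach (Cfg 1 p q [::] cnt w d) (Cfg 2 p q [::] cnt.+1 w d) 1.
Proof.
move=> hpq; apply: reach_body => s hS0 [hb he ho hk hK] [[/= hi hm hp hq ht] [/= hs hc hw hd]] hI.
have E : dx body s = upd (upd s rCnt cnt.+1) rMode 2.
  rewrite body1// /scan_step dexec_IfT; last by
    rewrite eval_Eq /= hp hq !(Inv_vtx hi)// hpq eqxx.
  rewrite /scan_match dexec_Seq !dexec_Set dexec_IfT; last by rewrite /= ht hk addn0 leqnn.
  by rewrite dexec_Set /= hc addn1.
rewrite E in hI *.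
by split; split; rewrite //= ?(upd_eq, upd_ne)//.
Qed.

Lemma scan_match_child q' : vtx p = vtx q ->
  reach (Cfg 1 p q (rcons st q') cnt w d) (Cfg 2 p q' st cnt w d) 1.
Proof.
move=> hpq; apply: reach_body => s hS0 [hb he ho hk hK] [[/= hi hm hp hq ht] [/= hs hc hw hd]] hI.
have E : dx body s = upd (upd (upd s rTop (stk + size st)) rQ q') rMode 2.
  rewrite body1// /scan_step dexec_IfT; last by
    rewrite eval_Eq /= hp hq !(Inv_vtx hi)// hpq eqxx.
  rewrite /scan_match dexec_Seq !dexec_Set dexec_IfF; last first.
    by rewrite /= ht hk size_rcons addnS leqNgt ltnS leq_addr.
  rewrite /Pop dexec_Seq dexec_Set dexec_Store /= ht size_rcons addnS subn1 /=.
  rewrite upd_eq upd_reg_stk// hs ?size_rcons//.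
  by rewrite nth_rcons ltnn eqxx.
rewrite E in hI *.
split; split; rewrite //= ?(upd_eq, upd_ne)//.
move=> j hj; rewrite !upd_reg_stk// hs ?size_rcons ?(ltnW hj)//.
  by rewrite nth_rcons hj.
by apply: leq_trans hj _.
Qed.

Lemma scan_down : vtx p != vtx q -> M (vtx q) (vtx p) ->
  reach (Cfg 1 p q st cnt w d) (Cfg 1 base p (rcons st q) cnt w d) 1.
Proof.
move=> hpq hM; apply: reach_body => s hS0 [hb he ho hk hK] [[/= hi hm hp hq ht] [/= hs hc hw hd]] hI.
have hu v a : St (Cfg 1 p q st cnt w d) v -> base <= a < base + L + m -> v a = vtx a.
  by case=> -[hv _ _ _ _] _; exact: Inv_vtx.
have [u [Eu uS ut]] := Ask_St hS0 (hu _ _ hS0 q_blk) (hu _ _ hS0 p_blk).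
have E : dx body s = upd (upd (upd (upd u (stk + size st) q) rTop (stk + size st).+1) rQ p) rP base.
  rewrite body1// /scan_step dexec_IfF; last first.
    by rewrite eval_Eq /= hp hq !(Inv_vtx hi)// eq_sym -[_ == _ :> nat]/(vtx p == vtx q) (negbTE hpq).
  rewrite dexec_Seq Eu dexec_IfT; last by rewrite /= ut hM.
  case: (uS) => -[_ _ up uq utp] _; have [ub _ _ _ _] := St_static uS.
  rewrite /scan_push !dexec_Seq dexec_Store !dexec_Set /= utp uq.
  by rewrite !(upd_eq, upd_stk_reg, upd_ne)// utp up ub addn1.
rewrite E in hI *.
have [_ [/= us uc uw ud]] := uS; have [[/= _ um _ _ ut'] _] := uS.
split; split; rewrite //= ?(upd_eq, upd_stk_reg, upd_ne)//.
  by rewrite size_rcons addnS.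
by move=> j hj; rewrite 3?upd_reg_stk//; exact: nth_push.
Qed.

Lemma scan_next : vtx p != vtx q -> ~~ M (vtx q) (vtx p) ->
  reach (Cfg 1 p q st cnt w d) (Cfg 1 p.+1 q st cnt w d) 1.
Proof.
move=> hpq hM; apply: reach_body => s hS0 [hb he ho hk hK] [[/= hi hm hp hq ht] [/= hs hc hw hd]] hI.
have hu v a : St (Cfg 1 p q st cnt w d) v -> base <= a < base + L + m -> v a = vtx a.
  by case=> -[hv _ _ _ _] _; exact: Inv_vtx.
have [u [Eu uS ut]] := Ask_St hS0 (hu _ _ hS0 q_blk) (hu _ _ hS0 p_blk).
have E : dx body s = upd u rP p.+1.
  rewrite body1// /scan_step dexec_IfF; last first.
    by rewrite eval_Eq /= hp hq !(Inv_vtx hi)// eq_sym -[_ == _ :> nat]/(vtx p == vtx q) (negbTE hpq).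
  rewrite dexec_Seq Eu dexec_IfF; last by rewrite /= ut (negbTE hM).
  case: (uS) => -[_ _ up _ _] _.
  by rewrite dexec_Set /= up addn1.
rewrite E in hI *.
have [_ [/= us uc uw ud]] := uS; have [[/= _ um _ uq ut'] _] := uS.
split; split; rewrite //= ?(upd_eq, upd_stk_reg, upd_ne)//.
by move=> j hj; rewrite !upd_reg_stk// us.
Qed.

Lemma return_root : reach (Cfg 2 p q [::] cnt w d)
  (Cfg (if base + L + m <= q.+1 then 3 else 1) base q.+1 [::] cnt w d) 1.
Proof.
apply: reach_body => s hS0 [hb he ho hk hK] [[/= hi hm hp hq ht] [/= hs hc hw hd]] hI.
have E : dx body s = upd (upd (upd s rQ q.+1) rP base) rMode (if base + L + m <= q.+1 then 3 else 1).
  rewrite body2// /return_step dexec_IfT; last by rewrite /= ht hk addn0 leqnn.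
  rewrite /next_sample !dexec_Seq !dexec_Set /= hq addn1 upd_ne// hb.
  by case: ifP => h; [rewrite dexec_IfT|rewrite dexec_IfF];
    rewrite //= ?(upd_eq, upd_ne)// ho h.
rewrite E in hI *.
by split; split; rewrite //= ?(upd_eq, upd_ne)//.
Qed.

Lemma return_child q' : reach (Cfg 2 p q (rcons st q') cnt w d)
  (Cfg 1 q.+1 q' st cnt w d) 1.
Proof.
apply: reach_body => s hS0 [hb he ho hk hK] [[/= hi hm hp hq ht] [/= hs hc hw hd]] hI.
have E : dx body s = upd (upd (upd (upd s rP q.+1) rTop (stk + size st)) rQ q') rMode 1.
  rewrite body2// /return_step dexec_IfF; last first.
    by rewrite /= ht hk size_rcons addnS leqNgt ltnS leq_addr.
  rewrite /Pop !dexec_Seq dexec_Store !dexec_Set /= hq addn1.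
  rewrite !upd_eq (@upd_ne s rP _ rTop)// ht size_rcons addnS subn1 /=.
  rewrite !upd_reg_stk// hs ?size_rcons//.
  by rewrite nth_rcons ltnn eqxx.
rewrite E in hI *.
split; split; rewrite //= ?(upd_eq, upd_ne)//.
move=> j hj; rewrite !upd_reg_stk// hs ?size_rcons ?(ltnW hj)//.
  by rewrite nth_rcons hj.
by apply: leq_trans hj _.
Qed.

End Scan.

Definition prefix_ i := [seq vtx (base + j) | j <- iota 0 i].
Local Notation gr i := (greedy M (prefix_ i)).
Local Notation alv i := (alive M (gr i)).

Lemma prefixS i : prefix_ i.+1 = rcons (prefix_ i) (vtx (base + i)).
Proof. by rewrite /prefix_ -addn1 iotaD map_cat cats1. Qed.

(** The configuration after the tested vertex has met itself: a root is counted, a child hands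
    control to its parent, now known to be dominated. *)
Definition accept p q (st : seq nat) cnt w d :=
  if st is x :: st' then Cfg 2 p (last x st') (belast x st') cnt w d
  else Cfg 2 p q [::] cnt.+1 w d.

Lemma accept_rcons p q st q' cnt w d :
  accept p q (rcons st q') cnt w d = Cfg 2 p q' st cnt w d.
Proof. by case: st => //= x st; rewrite last_rcons belast_rcons. Qed.

Lemma scan_accept p q st cnt w d : base <= p < base + L + m ->
  base <= q < base + L + m -> vtx p = vtx q ->
  reach (Cfg 1 p q st cnt w d) (accept p q st cnt w d) 1.
Proof.
move=> hp hq hpq; case/lastP: st => [|st q'].
  exact: scan_match_root.
by rewrite accept_rcons; exact: scan_match_child.
Qed.

Lemma mem_gadd_dead I z v : v \notin alive M I -> (v \in gadd M I z) = (v \in I).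
Proof.
rewrite inE negb_and negbK /gadd; case: ifPn => // nz; rewrite !inE.
by case: eqP => [->|//]; rewrite (negbTE nz) orbF => ->.
Qed.

(** Induction on the prefix, for all vertices and stacks at once. When the scan of v meets a
    neighbour z, the hypothesis for the same prefix runs the test of z. If z is alive it next meets
    itself and v is dominated. Otherwise z is dominated, since v has no picked neighbour, and v goes
    on. The factor 2 pays for the push and for the step that ends the child's test. *)
Lemma scan_run i q st cnt w d : i <= L -> base <= q < base + L + m ->
  exists t p, t <= 2 * work M (prefix_ i) (vtx q) /\
    reach (Cfg 1 base q st cnt w d)
      (if vtx q \in alv i then Cfg 1 (base + i) q st cnt w d
       else if vtx q \in gr i then accept p q st cnt w d
       else Cfg 2 p q st cnt w d) t.
Proof.
elim: i q st cnt => [|i IH] q st cnt iL hq.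
  exists 0, 0; split=> //; rewrite addn0.
  suff -> : vtx q \in alv 0 by exact: reach0.
  by apply/aliveP; split=> [|u]; rewrite in_set0.
have [t [p [tw hr]]] := IH q st cnt (ltnW iL) hq.
have hz : base <= base + i < base + L + m by lia.
have indI : indep M (gr i) by apply: greedy_indep.
rewrite prefixS work_rcons greedy_rcons /charge.
move: tw hr; set v := vtx q; set z := vtx (base + i); set I := gr i => tw.
case: (boolP (v \in alive M I)) => va hr; last first.
  exists t, p; split; first by lia.
  rewrite mem_gadd_dead// (negbTE (_ : v \notin alive M (gadd M I z))) //.
  by apply: contra va; apply: subsetP; exact: alive_gadd_sub.
have [vI vn] := aliveP M I v va.
have [zv|zv] := eqVneq z v.
  exists (t + 1), (base + i); split; first by rewrite zv M_irr; lia.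
  have h := @scan_accept (base + i) q st cnt w d hz hq zv.
  rewrite -zv (negbTE (alive_gadd_self M I z)) gadd_alive ?zv// setU11.
  exact: reach_trans hr h.
have [Mvz|Mvz] := boolP (M v z); last first.
  exists (t + 1), 0; split; first by lia.
  have -> : v \in alive M (gadd M I z).
    have [za|za] := boolP (z \in alive M I); last by rewrite gadd_dead.
    rewrite gadd_alive//; apply/aliveP; rewrite !inE eq_sym (negbTE zv); split=> // u.
    by rewrite !inE => /predU1P[->|/vn //]; rewrite M_sym.
  rewrite addnS; apply: reach_trans hr _; exact: scan_next.
have hd : reach (Cfg 1 (base + i) q st cnt w d) (Cfg 1 base (base + i) (rcons st q) cnt w d) 1.
  exact: scan_down.
have [t' [p' [tw' hr']]] := IH (base + i) (rcons st q) cnt (ltnW iL) hz.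
move: tw' hr'; rewrite -/z -/I => tw'.
have zI : (z \in I) = false.
  by apply/negP => /vn; rewrite M_sym Mvz.
rewrite zI; case: (boolP (z \in alive M I)) => za hr'.
  exists (t + (1 + (t' + 1))), (base + i); split; first by lia.
  have -> : v \in alive M (gadd M I z) = false.
    by apply/negP => /(alive_gadd_nbr M_sym)/(_ za); rewrite Mvz.
  have -> : v \in gadd M I z = false.
    by rewrite gadd_alive// !inE eq_sym (negbTE zv) (negbTE vI).
  apply: reach_trans hr _; apply: reach_trans hd _; apply: reach_trans hr' _.
  have := @scan_accept (base + i) (base + i) (rcons st q) cnt w d hz hz erefl.
  by rewrite accept_rcons.
exists (t + (1 + (t' + 1))), 0; split; first by lia.
rewrite gadd_dead// va.
apply: reach_trans hr _; apply: reach_trans hd _; apply: reach_trans hr' _.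
rewrite addnS; exact: return_child.
Qed.

Section Covered.
Hypothesis covered : alv L = set0.
Local Notation I := (gr L).
Local Notation y := (prefix_ L).

(** Coverage leaves no vertex alive, so the outcome is settled within the sequence and the scan does
    not run on into the samples stored behind it. *)
Lemma sample_run q cnt w d : base <= q < base + L + m ->
  exists t, t <= 3 * work M y (vtx q) /\
    reach (Cfg 1 base q [::] cnt w d)
      (Cfg (if base + L + m <= q.+1 then 3 else 1) base q.+1 [::]
         (cnt + (vtx q \in I)) w d) t.
Proof.
move=> hq; have [t [p [tw hr]]] := scan_run [::] cnt w d (leqnn L) hq.
have w0 := work_gt0 M y (vtx q).
exists (t + 1); split; first by lia.
apply: reach_trans hr _; rewrite covered in_set0.
case: (vtx q \in I); rewrite ?addn1 ?addn0 /=; exact: return_root.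
Qed.

Definition samples j := [seq vtx (base + L + i) | i <- iota 0 j].

Lemma samples_run j w d : 0 < j -> j <= m ->
  exists t, t <= 3 * \sum_(v <- samples j) work M y v /\
    reach (Cfg 1 base (base + L) [::] 0 w d)
      (Cfg (if m <= j then 3 else 1) base (base + L + j) [::]
         (count [in I] (samples j)) w d) t.
Proof.
elim: j => // j IH _ jm.
have hq : base <= base + L + j < base + L + m by lia.
have E : samples j.+1 = rcons (samples j) (vtx (base + L + j)).
  by rewrite /samples -addn1 iotaD map_cat cats1.
rewrite E -cats1 big_cat /= big_seq1 count_cat /= addn0.
have -> : (m <= j.+1) = (base + L + m <= (base + L + j).+1) by lia.
have [t [tw hr]] := sample_run (count [in I] (samples j)) w d hq.
rewrite addnS; case: (posnP j) => [j0|j0].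
  move: hr tw E; rewrite j0 !addn0 => hr tw E; exists t; split; first by lia.
  by move: hr; rewrite /samples /= add0n.
have [t' [tw' hr']] := IH j0 (ltnW jm).
exists (t' + t); split; first by lia.
by apply: reach_trans hr' _; rewrite leqNgt jm.
Qed.

End Covered.

Definition conflict (z u : 'I_n) := (u == z) || M u z.

Lemma exact_scan p (J : seq 'I_n) cnt w d : base <= p < base + L ->
  forall r, r <= find (conflict (vtx p)) J -> 
  reach (Cfg 0 p stk (map val J) cnt w d) (Cfg 0 p (stk + r) (map val J) cnt w d) r.
Proof.
move=> hp; elim=> [_|r IH hr]; first by rewrite addn0; exact: reach0.
rewrite -[X in reach _ _ X]addn1; apply: reach_trans (IH (ltnW hr)) _.
apply: exact_skip => //; first by apply: leq_trans hr (find_size _ _).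
exact: (before_find (vtx p) hr).
Qed.

Lemma exact_vertex i (J : seq 'I_n) cnt w d : i < L -> size J <= K ->
  [set x in J] = gr i -> uniq J ->
  exists t J', [/\ t <= K.+1, [set x in J'] = gr i.+1, uniq J' &
    reach (Cfg 0 (base + i) stk (map val J) cnt w d)
      (if size J' <= K then Cfg 0 (base + i).+1 stk (map val J') cnt w d
       else Cfg 1 base (base + L) [::] cnt w d) t].
Proof.
move=> iL JK EJ uJ; have hp : base <= base + i < base + L by lia.
rewrite prefixS greedy_rcons; set z := vtx (base + i).
have indI : indep M (gr i) by apply: greedy_indep.
have memJ u : (u \in gr i) = (u \in J) by rewrite -EJ inE.
have h := exact_scan (cnt := cnt) (w := w) (d := d) hp (leqnn (find (conflict z) J)).
have zE : has (conflict z) J = (z \notin alive M (gr i)).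
  apply/hasP/idP => [[u uJ' cu]|].
    apply/negP => /aliveP[zI zn]; case/orP: cu => [/eqP e|Muz].
      by move: zI; rewrite memJ -e uJ'.
    by have := zn u; rewrite memJ uJ' => /(_ isT); rewrite Muz.
  rewrite inE negb_and !negbK => /orP[zI|/existsP[u /andP[uI Muz]]].
    by exists z; rewrite -?memJ// /conflict eqxx.
  by exists u; rewrite -?memJ// /conflict Muz orbT.
case: (boolP (has (conflict z) J)) => hz.
  exists (find (conflict z) J + 1), J; split=> //.
  - by have := hz; rewrite has_find; lia.
  - by rewrite gadd_dead// -zE.
  - rewrite JK; apply: reach_trans h _; apply: exact_conflict => //; first by rewrite -has_find.
    exact: (nth_find z hz).
have fz : find (conflict z) J = size J by apply/hasNfind.
have za : z \in alive M (gr i) by rewrite -[_ \in _]negbK -zE.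
exists (size J + 1), (rcons J z); split; first by lia.
- by rewrite gadd_alive// -EJ; apply/setP => x; rewrite !inE mem_rcons in_cons.
- by rewrite rcons_uniq uJ andbT -memJ; have /aliveP[] := za.
rewrite size_rcons -[X in reach _ _ (X + 1)]fz; apply: reach_trans h _; rewrite fz.
by case: ltnP => JK'; [exact: exact_pick|exact: exact_overflow].
Qed.

(** Prefix sets only grow, so once the cap is exceeded the machine has left the exact phase for good
    and further prefixes cost nothing more. *)
Lemma exact_run i w d : i <= L ->
  exists2 t, t <= i * K.+1 &
    if #|gr i| <= K then
      exists J, [/\ [set x in J] = gr i, uniq J &
        reach (Cfg 0 base stk [::] 0 w d) (Cfg 0 (base + i) stk (map val J) 0 w d) t]
    else reach (Cfg 0 base stk [::] 0 w d) (Cfg 1 base (base + L) [::] 0 w d) t.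
Proof.
elim: i => [_|i IH iL].
  have e : [set x in [::]] = gr 0 by apply/setP => x; rewrite !inE.
  exists 0 => //; rewrite /prefix_ /= cards0; exists [::]; split=> //.
  by rewrite addn0; exact: reach0.
have [t tK] := IH (ltnW iL).
have sub : gr i \subset gr i.+1 by rewrite prefixS greedy_rcons; exact: gadd_sub.
case: ifP => giK; last first.
  move=> hr; exists t; first by lia.
  by rewrite leqNgt (leq_trans _ (subset_leq_card sub)) // ltnNge giK.
have cardJ (J : seq 'I_n) k : [set x in J] = gr k -> uniq J -> size J = #|gr k|.
  by move=> <- uJ; rewrite cardsE; apply/esym/card_uniqP.
move=> [J [EJ uJ hr]].
have JK : size J <= K by rewrite (cardJ J i).
have [t' [J' [tK' EJ' uJ' hr']]] := exact_vertex 0 w d iL JK EJ uJ.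
exists (t + t'); first by lia.
rewrite -(cardJ J' i.+1)// addnS; move: hr'; case: ifP => J'K hr'.
  by exists J'; split=> //; exact: reach_trans hr'.
exact: reach_trans hr'.
Qed.

Definition good_end cnt w d w' d' :=
  if #|gr L| <= K then [/\ cnt = #|gr L|, w' = 1 & d' = 1]
  else [/\ cnt = count [in gr L] (samples m), w' = w & d' = d].

Lemma block_run w d : 0 < m -> alv L = set0 ->
  exists t c, [/\ t <= L * K.+1 + 1 + 3 * \sum_(v <- samples m) work M (prefix_ L) v,
    reach (Cfg 0 base stk [::] 0 w d) c t, c_mode c = 3 &
    good_end (c_cnt c) w d (c_w c) (c_den c)].
Proof.
move=> m0 cov; have [t tK] := exact_run w d (leqnn L).
rewrite /good_end; case: ifP => hK.
  move=> [J [EJ uJ hr]].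
  exists (t + 1), (Cfg 3 (base + L) stk (map val J) (size J) 1 1); split=> //; first by lia.
    have := @exact_done (base + L) stk (map val J) 0 w d (leqnn _).
    by rewrite size_map => h; apply: reach_trans hr h.
  by split=> //=; rewrite -EJ cardsE; apply/esym/card_uniqP.
move=> hr; have [t' [tw' hr']] := samples_run cov w d m0 (leqnn m).
rewrite leqnn in hr'.
by exists (t + t'), (Cfg 3 base (base + L + m) [::] (count [in gr L] (samples m)) w d);
  split=> //; [lia|exact: reach_trans hr'].
Qed.

End Body.

(** [Inv_body] with the flag off, applied to a reference memory whose counter is the current one,
    shows that [body] leaves the counter alone. *)
Lemma body_rB n (M : rel 'I_n) s0 s : (data <= s0 rStk)%N -> Inv_ s0 true s ->
  dexec M body s rB = s rB.
Proof.
move=> hk [h ht].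
have hI : Inv_ (upd s0 rB (s rB)) false s.
  split=> // x xs xd _; rewrite /upd; case: eqP => [->//|/eqP xB].
  by apply: h => //=.
have [h2 _] := @Inv_body n M (upd s0 rB (s rB)) hk false s hI.
by rewrite h2//; apply: leq_trans hk.
Qed.

(** * The program *)

Definition Add (e1 e2 : expr) := Bin OAdd e1 e2.
Definition Mul (e1 e2 : expr) := Bin OMul e1 e2.

(** The minimum with [n] keeps all later numbers polynomial in [n], however small [eps] is. *)
Definition clip (E : nat) :=
  If (Leq (Const E) (Reg 0)) (Set_ rE (Const E)) (Set_ rE (Reg 0)).
Definition sqrt_init := Seq (Set_ rS (Const 1)) (Set_ rI (Reg 0)).
(** [rS] becomes the least power of two whose square reaches [n], and [rL] its exponent. A total of
    [n] rounds is always enough, and the idle ones fit into the time bound. *)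
Definition sqrt_step :=
  If (Leq (Add (Mul (Reg rS) (Reg rS)) (Const 1)) (Reg 0))
    (Seq (Set_ rS (Mul (Const 2) (Reg rS))) (Incr rL)) Skip.
(** With e in [rE], the ratio [rW0 / rDen0] is [n / rSmp] divided by [1 - 1/(4 e)]. The division
    compensates the downward error tolerated in the number of hits, so that an accurate sample never
    underestimates. *)
Definition params (A : nat) :=
  Seq (Set_ rL (Mul (Const A) (Add (Reg rL) (Const 1))))
  (Seq (Set_ rLen (Mul (Reg 0) (Reg rL)))
  (Seq (Set_ rSmp (Mul (Reg rS) (Reg rL)))
  (Seq (Set_ rK (Mul (Reg rS) (Mul (Reg rE) (Reg rE))))
  (Seq (Set_ rBud (Mul (Const 100) (Mul (Mul (Reg rL) (Mul (Reg rL) (Reg rL)))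
                     (Mul (Reg 0) (Reg rK)))))
  (Seq (Set_ rDen0 (Mul (Reg rSmp) (Bin OSub (Mul (Const 4) (Reg rE)) (Const 1))))
  (Seq (Set_ rW0 (Mul (Const 4) (Mul (Reg rE) (Reg 0))))
  (Seq (Set_ rP (Const data))
  (Seq (Set_ rStop (Const data))
  (Seq (Set_ rI (Mul (Reg rL) (Add (Reg rLen) (Reg rSmp))))
  (Seq (Set_ rStk (Add (Const data) (Reg rI)))
       (Set_ rAtt (Reg rL)))))))))))).
Definition draw := Seq (Rand (Reg rP) (Reg 0)) (Incr rP).
Definition shift :=
  Seq (Set_ rBase (Reg rStop))
  (Seq (Set_ rEnd (Add (Reg rBase) (Reg rLen)))
  (Seq (Set_ rStop (Add (Reg rEnd) (Reg rSmp)))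
       (Set_ rTop (Reg rStk)))).
Definition reset :=
  Seq (Set_ rP (Reg rBase)) (Seq (Set_ rQ (Reg rStk))
    (Seq (Set_ rCnt (Const 0)) (Seq (Set_ rMode (Const 0))
    (Seq (Set_ rW (Reg rW0)) (Set_ rDen (Reg rDen0)))))).
(** Every attempt moves on to a fresh block of draws. After a finished attempt the outcome registers
    are not reset, and the remaining attempts idle. *)
Definition start :=
  Seq shift (Seq (If (Eq (Reg rMode) (Const 3)) Skip reset) (Set_ rB (Reg rBud))).
Definition attempt := Seq start (For rB body).
Definition finish := Set_ 0 (Mul (Reg rCnt) (Reg rW)).

Definition prelude (A E : nat) :=
  Seq (clip E) (Seq sqrt_init (Seq (For rI sqrt_step) (params A))).
Definition prog (A E : nat) :=
  Seq (prelude A E) (Seq (For rI draw) (Seq (For rAtt attempt) finish)).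

Lemma pr_bind_ge (R : realType) (A B : Type) (p : ctree A) (f : A -> ctree B)
    (E : pred B) (x : R) :
  post p (fun a => x <= pr R E (f a)) -> x <= pr R E (cbind p f).
Proof.
elim: p => //= m k IH h.
rewrite -[leLHS](@avg_cst R m.+1 isT) ler_wpM2l ?invr_ge0 ?ler0n//.
by apply: ler_sum => i _; exact: IH.
Qed.

Lemma post_Seq n (M : rel 'I_n) F c1 c2 s Q :
  post (exec M F (Seq c1 c2) s) Q <->
  post (exec M F c1 s) (fun s' => post (exec M F c2 s') Q).
Proof. exact: post_bind. Qed.

Lemma post_Seqs n (M : rel 'I_n) F c1 c2 s Q : simple c1 ->
  post (exec M F (Seq c1 c2) s) Q <-> post (exec M F c2 (dexec M c1 s)) Q.
Proof. by move=> h; rewrite post_Seq post_simple. Qed.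

(** * The drawing loop as an average over lists *)

Section Draws.
Variables (R : realType) (n : nat) (M : rel 'I_n) (F : nat).
Hypothesis n_gt0 : (0 < n)%N.

Definition draw1 s x : memory :=
  upd (upd (upd s rI (s rI).-1) (s rP) x) rP (s rP).+1.

Fixpoint drawn (s : memory) (l : seq 'I_n) : memory :=
  if l is x :: l' then drawn (draw1 s x) l' else s.

Lemma pr_unif (A : Type) (E : pred A) m k (f : nat -> ctree A) : (0 < k)%N -> m = k.-1 ->
  pr R E (Unif (fun i : 'I_m.+1 => f i)) = k%:R^-1 * \sum_(i < k) pr R E (f i).
Proof. by case: k => // k _ ->. Qed.

Lemma pr_draw s (A : Type) (E : pred A) (f : memory -> ctree A) :
  s 0%N = n -> (data <= s rP)%N ->
  pr R E (cbind (exec M F draw s) f) =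
  n%:R^-1 * \sum_(i < n) pr R E (f (upd (upd s (s rP) i) rP (s rP).+1)).
Proof.
move=> s0 sP.
pose g i := f (upd (upd s (s rP) i) rP (upd s (s rP) i rP + 1)%N).
rewrite -[LHS]/(pr R E (Unif (fun i : 'I_(s 0%N).-1.+1 => g i))).
rewrite (@pr_unif _ E _ n) ?s0//.
congr (_ * _); apply: eq_bigr => i _; congr (pr R E (f (upd _ _ _))).
by rewrite upd_ne ?addn1//; apply/negP => /eqP e; move: sP; rewrite -e.
Qed.

Lemma pr_draws k s (A : Type) (E : pred A) (f : memory -> ctree A) :
  (k < F)%N -> s rI = k -> s 0%N = n -> (data <= s rP)%N ->
  pr R E (cbind (exec M F (For rI draw) s) f) = Ex k (fun l => pr R E (f (drawn s l))).
Proof.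
rewrite /For exec_While.
suff h f' : (k < f')%N -> s rI = k -> s 0%N = n -> (data <= s rP)%N ->
  pr R E (cbind (wloop (Fetch (Const rI)) (exec M F (Seq (decr rI) draw)) f' s) f) =
  Ex k (fun l => pr R E (f (drawn s l))) by exact: h.
elim: f' k s => // f' IH [|k] s kf sI s0 sP; first by rewrite /= sI.
have -> : pr R E (cbind (wloop (Fetch (Const rI)) (exec M F (Seq (decr rI) draw)) f'.+1 s) f) =
  pr R E (cbind (exec M F draw (upd s rI k)) (fun s' =>
    cbind (wloop (Fetch (Const rI)) (exec M F (Seq (decr rI) draw)) f' s') f)).
  by rewrite -cbindA /= sI /= subn1.
have sI' x : x != rI -> upd s rI k x = s x by exact: upd_ne.
rewrite pr_draw ?sI'//=; congr (_ * _); apply: eq_bigr => i _.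
have dP y : (y < data)%N -> y != s rP.
  by move=> yd; apply/negP => /eqP e; move: sP; rewrite -e leqNgt yd.
rewrite (IH k) ?sI//.
- by apply: eq_Ex => l _; rewrite /draw1 sI.
- by rewrite upd_ne// upd_ne ?dP// upd_eq.
- by rewrite upd_ne// upd_ne ?dP// upd_ne.
- by rewrite upd_eq leqW.
Qed.

Lemma drawn_spec s l : (data <= s rP)%N -> s rI = size l ->
  [/\ forall i, (i < size l)%N -> drawn s l (s rP + i)%N = nth 0%N (map val l) i,
      drawn s l rI = 0%N, drawn s l rP = (s rP + size l)%N &
      forall x, x \notin [:: rI; rP] -> ~~ (s rP <= x < s rP + size l)%N ->
        drawn s l x = s x].
Proof.
elim: l s => [|x l IH] s sP sI /=.
  by split=> //; rewrite ?addn0// sI.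
have d1P : draw1 s x rP = (s rP).+1 by rewrite /draw1 upd_eq.
have dne y : (y < data)%N -> y != s rP.
  by move=> yd; apply/negP => /eqP e; move: sP; rewrite -e leqNgt yd.
have d1I : draw1 s x rI = size l.
  by rewrite /draw1 upd_ne// upd_ne ?dne// upd_eq sI.
have [h1 h2 h3 h4] := IH (draw1 s x) (leqW sP : (data <= (s rP).+1)%N) d1I.
rewrite d1P in h1 h3 h4.
split=> //; last 2 first.
- by rewrite h3 addSnnS.
- move=> y; rewrite !inE => /norP[yI yP] yr; rewrite h4 ?inE ?negb_or ?yI//; last by lia.
  by rewrite /draw1 upd_ne// !upd_ne//; lia.
case=> [_|i il] /=.
  rewrite addn0 h4; last by lia.
    by rewrite /draw1 upd_ne ?upd_eq// eq_sym dne.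
  by rewrite !inE negb_or ![s rP == _]eq_sym !dne.
by rewrite addnS -addSn h1.
Qed.

End Draws.

(** * Parameters, attempts and outcome for a fixed list of draws *)

Section Prelude.
Variables (n A E : nat) (M : rel 'I_n) (F : nat).
Hypotheses (n_gt0 : (0 < n)%N) (nF : (n < F)%N).
Local Open Scope nat_scope.
Local Arguments dexec : simpl never.

Definition clipped_of := minn E n.
Definition hlog_of := up_log 4 n.
Definition sq_of := 2 ^ hlog_of.
Definition lam_of := A * (hlog_of + 1).
Definition seqlen_of := n * lam_of.
Definition smplen_of := sq_of * lam_of.
Definition cap_of := sq_of * (clipped_of * clipped_of).
Definition budget_of := 100 * (lam_of * (lam_of * lam_of) * (n * cap_of)).
Definition den := smplen_of * (4 * clipped_of - 1).
Definition weight := 4 * (clipped_of * n).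
Definition ndraws_of := lam_of * (seqlen_of + smplen_of).
Definition stack_base_of := data + ndraws_of.

Definition static_ s :=
  [/\ [/\ s 0 = n, s rLen = seqlen_of, s rSmp = smplen_of & s rK = cap_of],
      [/\ s rBud = budget_of, s rW0 = weight & s rDen0 = den] & s rStk = stack_base_of].

Definition loaded s :=
  [/\ static_ s, [/\ s rP = data, s rStop = data & s rMode = 0] &
      [/\ s rI = ndraws_of & s rAtt = lam_of]].

Definition sqrt_inv k s :=
  [/\ [/\ s 0 = n & s rE = clipped_of],
      s rS = 2 ^ s rL,
      s rL = 0 \/ 4 ^ (s rL).-1 < n,
      n <= 4 ^ s rL \/ s rL + k = n &
      forall x, x \notin [:: 0; rI; rE; rS; rL] -> s x = 0].

Lemma sqrt_inv_step k s : sqrt_inv k.+1 s ->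
  sqrt_inv k (dexec M sqrt_step (upd s rI k)) /\ dexec M sqrt_step (upd s rI k) rI = k.
Proof.
case=> -[h0 hE] hS hmin hk hx.
have sS : 2 ^ s rL * 2 ^ s rL = 4 ^ s rL by rewrite -expnMn.
rewrite /sqrt_step; have [lt|ge] := ltnP (4 ^ s rL) n; last first.
  rewrite dexec_IfF; last by rewrite /= !(upd_eq, upd_ne)// hS h0 sS addn1 ltnNge ge.
  rewrite /dexec upd_eq; split=> //; split; rewrite ?upd_ne//; first by left.
  by move=> x hx'; rewrite upd_ne ?hx//; move: hx'; rewrite !inE !negb_or => /and3P[].
rewrite dexec_IfT; last by rewrite /= !(upd_eq, upd_ne)// hS h0 sS addn1 lt.
have -> : dexec M (Seq (Set_ rS (Mul (Const 2) (Reg rS))) (Incr rL)) (upd s rI k) =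
  upd (upd (upd s rI k) rS (2 * s rS)) rL (s rL).+1.
  by rewrite dexec_Seq /Incr !dexec_Set /= !upd_ne// addn1.
split; last by rewrite !(upd_eq, upd_ne).
split; rewrite ?(upd_eq, upd_ne)//.
- by rewrite hS expnS.
- by right.
- case: hk => [/(leq_trans lt)|hk]; first by rewrite ltnn.
  by right; rewrite addSnnS.
- move=> x hx'; rewrite !upd_ne ?hx//; move: hx'; rewrite !inE !negb_or;
    by case/and5P.
Qed.

Lemma sqrt_exit s : sqrt_inv 0 s -> s rL = hlog_of /\ s rS = sq_of.
Proof.
case=> _ hS hmin hk _.
have nl : n <= 4 ^ s rL.
  by case: hk => // <-; rewrite addn0 ltnW// ltn_expl.
suff e : s rL = hlog_of by rewrite hS e.
rewrite /hlog_of; case: hmin => [l0|lt].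
  by move: nl; rewrite l0 expn0; case: n n_gt0 => [|[|]]// _ _; rewrite up_log1.
have [l0|l0] := posnP (s rL).
  by move: nl; rewrite l0 expn0; case: n n_gt0 => [|[|]]// _ _; rewrite up_log1.
have E1 : s rL = (s rL).-1.+1 by rewrite prednK.
by rewrite E1; apply/esym/up_log_eq => //; rewrite lt /= prednK.
Qed.

Lemma params_loaded s : s 0 = n -> s rE = clipped_of -> s rL = hlog_of -> s rS = sq_of ->
  s rMode = 0 -> loaded (dexec M (params A) s).
Proof.
move=> h0 hE hL hS hm.
have step c r e u v : eval u e = v -> dexec M (Seq (Set_ r e) c) u = dexec M c (upd u r v).
  by move=> <-.
rewrite /params.
rewrite (step _ _ _ _ lam_of); last by rewrite /= ?(upd_eq, upd_ne)// ?hL ?h0 ?hS ?hE.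
rewrite (step _ _ _ _ seqlen_of); last by rewrite /= ?(upd_eq, upd_ne)// ?hL ?h0 ?hS ?hE.
rewrite (step _ _ _ _ smplen_of); last by rewrite /= ?(upd_eq, upd_ne)// ?hL ?h0 ?hS ?hE.
rewrite (step _ _ _ _ cap_of); last by rewrite /= ?(upd_eq, upd_ne)// ?hL ?h0 ?hS ?hE.
rewrite (step _ _ _ _ budget_of); last by rewrite /= ?(upd_eq, upd_ne)// ?hL ?h0 ?hS ?hE.
rewrite (step _ _ _ _ den); last by rewrite /= ?(upd_eq, upd_ne)// ?hL ?h0 ?hS ?hE.
rewrite (step _ _ _ _ weight); last by rewrite /= ?(upd_eq, upd_ne)// ?hL ?h0 ?hS ?hE.
rewrite (step _ _ _ _ data); last by rewrite /= ?(upd_eq, upd_ne)// ?hL ?h0 ?hS ?hE.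
rewrite (step _ _ _ _ data); last by rewrite /= ?(upd_eq, upd_ne)// ?hL ?h0 ?hS ?hE.
rewrite (step _ _ _ _ ndraws_of); last by rewrite /= ?(upd_eq, upd_ne)// ?hL ?h0 ?hS ?hE.
rewrite (step _ _ _ _ stack_base_of); last by rewrite /= ?(upd_eq, upd_ne)// ?hL ?h0 ?hS ?hE.
rewrite dexec_Set.
have -> : forall u v, eval (upd u rStk v) (Reg rL) = u rL by move=> u v; rewrite /= upd_ne.
by do !split; rewrite !(upd_eq, upd_ne).
Qed.

Definition sqrt_start := upd (upd (upd (init_memory n) rE clipped_of) rS 1) rI n.

Lemma clip_eq : dexec M (clip E) (init_memory n) = upd (init_memory n) rE clipped_of.
Proof.
rewrite /clip /clipped_of; case: (leqP E n) => h.
  by rewrite dexec_IfT // /= /init_memory upd_eq h.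
by rewrite dexec_IfF // /= /init_memory upd_eq leqNgt h.
Qed.

Lemma prelude_start : dexec M sqrt_init (dexec M (clip E) (init_memory n)) = sqrt_start /\
  sqrt_inv n sqrt_start.
Proof.
split.
  rewrite clip_eq.
  by rewrite /sqrt_init dexec_Seq !dexec_Set /= !upd_ne.
rewrite /sqrt_start /init_memory; split; rewrite ?(upd_eq, upd_ne)//.
- by left.
- by right.
- move=> x; rewrite !inE !negb_or => /and5P[x0 xI xE xS xL].
  by rewrite !upd_ne.
Qed.

Lemma prelude_post : post (exec M F (prelude A E) (init_memory n)) loaded.
Proof.
rewrite /prelude; apply/post_Seqs => //; apply/post_Seqs => //.
have [-> hinv] := prelude_start.
apply/post_Seq.
apply: post_mono (@For_post n M F rI sqrt_step sqrt_inv n _ _ nF hinv _).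
- move=> s [hs _]; have [sl ss] := sqrt_exit hs.
  case: hs => -[h0 hE] _ _ _ hx; apply/post_simple => //.
  by apply: params_loaded => //; rewrite hx.
- by move=> k s _ hs sr; apply/post_simple => //; exact: sqrt_inv_step.
- by rewrite /sqrt_start upd_eq.
Qed.

Hypotheses (M_sym : symmetric M) (M_irr : irreflexive M).

Definition blk_of := seqlen_of + smplen_of.
Definition chunk (l : seq 'I_n) a := take blk_of (drop (a * blk_of) l).

Definition picked_of (c : seq 'I_n) := greedy M (take seqlen_of c).
Definition covered_of (c : seq 'I_n) := alive M (picked_of c) == set0.
Definition cheap_of (c : seq 'I_n) :=
  seqlen_of * cap_of.+1 + 1 +
    3 * \sum_(v <- drop seqlen_of c) work M (take seqlen_of c) v <= budget_of.
Definition result (c : seq 'I_n) cnt w d :=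
  if #|picked_of c| <= cap_of then [/\ cnt = #|picked_of c|, w = 1 & d = 1]
  else [/\ cnt = count [in picked_of c] (drop seqlen_of c), w = weight & d = den].

Definition att_frame a s := static_ s /\ s rStop = data + a * blk_of.
Definition att_data (l : seq 'I_n) s :=
  forall i, i < ndraws_of -> s (data + i) = nth 0 (map val l) i.
(** A missing answer is recorded as evidence that every block so far was too expensive; a single
    cheap block then forces an answer. *)
Definition att_out (l : seq 'I_n) a s :=
  if s rMode == 3 then
    exists2 j, j < a & result (chunk l j) (s rCnt) (s rW) (s rDen)
  else forall j, j < a -> ~~ cheap_of (chunk l j).

Lemma iter_idle k s x : s rMode = 3 -> x != rB -> iter k (bstep M) s x = s x.
Proof.
move=> hm hx; suff h : forall y, y != rB -> iter k (bstep M) s y = s y by exact: h.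
elim: k => // k IH y hy; rewrite iterS /bstep body3; first by rewrite upd_ne// IH.
by rewrite upd_ne// IH.
Qed.

Lemma for_body s0 : data <= s0 rStk -> Inv_ s0 true s0 -> s0 rB < F ->
  post (exec M F (For rB body) s0)
    (fun s => s = iter (s0 rB) (bstep M) s0 /\ Inv_ s0 true s).
Proof.
move=> hk hI hB.
pose I k s := s = iter (s0 rB - k) (bstep M) s0 /\ Inv_ s0 true s.
apply: post_mono (@For_post n M F rB body I (s0 rB) _ s0 hB _ erefl).
- by move=> s [[hs hi] _]; rewrite subn0 in hs.
- move=> k s kB [hs hi] hk'; apply/post_simple => //.
  have hi' : Inv_ s0 true (upd s rB k) by apply: Inv_rB.
  split; last by rewrite (body_rB M hk hi') upd_eq.
  split; last exact: Inv_body.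
  have -> : s0 rB - k = (s0 rB - k.+1).+1 by lia.
  by rewrite iterS -hs /bstep hk'.
- by rewrite /I subnn.
Qed.

Definition vtx_of (l : seq 'I_n) (a : nat) := nth (Ordinal n_gt0) l (a - data).

Lemma prefix_vtx l b k : b + k <= size l ->
  [seq vtx_of l (data + b + j) | j <- iota 0 k] = take k (drop b l).
Proof.
move=> bk; apply: (@eq_from_nth _ (Ordinal n_gt0)).
  by rewrite size_map size_iota size_takel// size_drop; lia.
move=> i; rewrite size_map size_iota => ik.
rewrite (nth_map 0) ?size_iota// nth_iota// nth_take// nth_drop /vtx_of.
by congr nth; lia.
Qed.

Lemma fits a : a < lam_of -> a.+1 * blk_of <= ndraws_of.
Proof. by move=> alam; rewrite /ndraws_of -/blk_of leq_mul2r alam orbT. Qed.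

Definition start_dom := [:: rBase; rEnd; rStop; rB] ++ dyn.

Lemma shift_eq a s : att_frame a s ->
  dexec M shift s = upd (upd (upd (upd s rBase (data + a * blk_of))
    rEnd (data + a * blk_of + seqlen_of)) rStop (data + a.+1 * blk_of)) rTop stack_base_of.
Proof.
move=> [[[_ hLen hSmp _] _ hStk] hStop].
rewrite /shift !dexec_Seq !dexec_Set /= !(upd_eq, upd_ne)// hLen hSmp hStk hStop.
by rewrite mulSn /blk_of [seqlen_of + _ + _]addnC !addnA.
Qed.

Lemma start_spec a s : att_frame a s -> exists s0,
  [/\ dexec M start s = s0, forall x, x \notin start_dom -> s0 x = s x,
      [/\ s0 rBase = data + a * blk_of, s0 rEnd = data + a * blk_of + seqlen_of,
          s0 rStop = data + a.+1 * blk_of, s0 rTop = stack_base_of & s0 rB = budget_of],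
      s rMode = 3 -> forall x, x \in [:: rMode; rCnt; rW; rDen] -> s0 x = s x &
      s rMode != 3 -> [/\ s0 rMode = 0, s0 rP = data + a * blk_of, s0 rQ = stack_base_of &
         [/\ s0 rCnt = 0, s0 rW = weight & s0 rDen = den]]].
Proof.
move=> hfr; have hsh := shift_eq hfr.
have [[[h0 hLen hSmp hK] [hBud hW0 hD0] hStk] hStop] := hfr.
set base := data + a * blk_of in hStop hsh *.
pose s1 := upd (upd (upd (upd s rBase base) rEnd (base + seqlen_of)) rStop (data + a.+1 * blk_of)) rTop stack_base_of.
have E1 c : dexec M (Seq shift c) s = dexec M c s1 by rewrite dexec_Seq hsh.
rewrite /start E1.
have s1ne x : x \notin [:: rBase; rEnd; rStop; rTop] -> s1 x = s x.
  by rewrite !inE !negb_or => /and4P[x1 x2 x3 x4]; rewrite /s1 !upd_ne.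
have e2 : s1 rBase = base by rewrite /s1 !(upd_eq, upd_ne).
have e3 : s1 rEnd = base + seqlen_of by rewrite /s1 !(upd_eq, upd_ne).
have e4 : s1 rStop = data + a.+1 * blk_of by rewrite /s1 !(upd_eq, upd_ne).
have e5 : s1 rTop = stack_base_of by rewrite /s1 !(upd_eq, upd_ne).
clearbody s1; clear E1.
rewrite dexec_Seq; have [m3|m3] := eqVneq (s rMode) 3.
  exists (upd s1 rB budget_of); split.
  - rewrite dexec_IfT; last by rewrite eval_Eq /= s1ne// m3.
    by rewrite -[dexec M Skip s1]/s1 dexec_Set /= s1ne// hBud.
  - move=> x; rewrite mem_cat negb_or !inE !negb_or => /andP[/and4P[? ? ? ?]].
    case/and5P=> ? ? ? ? /and4P[? ? ? ?].
    by rewrite upd_ne// s1ne// !inE !negb_or; apply/and4P.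
  - by split; rewrite ?(upd_eq, upd_ne).
  - by move=> _ x; rewrite !inE => /or4P[]/eqP ->; rewrite upd_ne// s1ne.
  - by [].
exists (upd (upd (upd (upd (upd (upd (upd s1
   rP base) rQ stack_base_of) rCnt 0) rMode 0) rW weight) rDen den) rB budget_of); split.
- rewrite dexec_IfF; last by rewrite eval_Eq /= s1ne// (negbTE m3).
  rewrite /reset !dexec_Seq !dexec_Set /= !(upd_eq, upd_ne)// e2.
  by rewrite (s1ne rStk)// (s1ne rW0)// (s1ne rDen0)// (s1ne rBud)// hW0 hD0 hBud hStk.
- move=> x; rewrite mem_cat negb_or !inE !negb_or => /andP[/and4P[? ? ? ?]].
  case/and5P=> ? ? ? ? /and4P[? ? ? ?].
  by rewrite !upd_ne// s1ne// !inE !negb_or; apply/and4P.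
- by split; rewrite ?(upd_eq, upd_ne).
- by move=> h; rewrite h eqxx in m3.
- by do !split; rewrite ?(upd_eq, upd_ne).
Qed.

Lemma attempt_post a s : 0 < lam_of -> budget_of < F -> a < lam_of -> att_frame a s ->
  post (exec M F attempt s) (fun s' =>
    [/\ att_frame a.+1 s', s' rAtt = s rAtt &
        forall l, size l = ndraws_of -> att_data l s -> att_data l s' /\
          (covered_of (chunk l a) -> att_out l a s -> att_out l a.+1 s')]).
Proof.
move=> lam0 BF alam hfr; apply/post_Seqs => //.
have [s0 [-> s0ne [hb he ho hTop hB] hdone hnew]] := start_spec hfr.
have [[[h0 hLen hSmp hK] [hBud hW0 hD0] hStk] hStop] := hfr.
have hk : s0 rStk = stack_base_of by rewrite s0ne.
have hk' : data <= s0 rStk by rewrite hk /stack_base_of leq_addr.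
have hI : Inv_ s0 true s0 by split=> //; rewrite hk hTop.
have hF : s0 rB < F by rewrite hB.
apply: post_mono (for_body hk' hI hF) => s' [hs' hi']; rewrite hB in hs'.
have e x : x \notin start_dom -> x < data -> s' x = s x.
  move=> x1 x2; rewrite -s0ne//; apply: (@Inv_reg s0 hk' true) => //.
  by apply: contra x1; rewrite /start_dom !inE => ->; rewrite !orbT.
split.
- split; first by do !split; rewrite e.
  by rewrite (@Inv_reg s0 hk' true).
- by rewrite e.
move=> l sl hdata.
have s0data i : i < ndraws_of -> s0 (data + i) = nth 0 (map val l) i.
  by move=> it; rewrite s0ne ?hdata// !inE; lia.
have hdata' : att_data l s'.
  move=> i it; have [hi2 _] := hi'.
  have i1 : data + i < s0 rStk by rewrite hk /stack_base_of ltn_add2l.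
  have i2 : data + i \notin dyn by rewrite !inE; lia.
  have i3 : ~~ (true && (data + i == rB)) by rewrite /=; lia.
  by rewrite hi2 ?s0data.
split=> // cov; rewrite /att_out.
have [m3|m3] := eqVneq (s rMode) 3.
  have idle x : x \in [:: rMode; rCnt; rW; rDen] -> s' x = s x.
    move=> hx; rewrite -(hdone m3 x hx) hs' iter_idle//; first by rewrite hdone.
    by apply/negP => /eqP xB; rewrite xB in hx.
  move=> [j ja hj]; rewrite !idle// m3 eqxx; exists j => //; exact: ltnW.
move=> hexp.
have [hm0 hp0 hq0 [hc0 hw0 hd0]] := hnew m3.
set base := data + a * blk_of in hb he hp0.
have hK0 : s0 rK = cap_of by rewrite s0ne.
have hbase : data <= base by rewrite leq_addr.
have blk_a : base + seqlen_of + smplen_of = data + a.+1 * blk_of.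
  by rewrite /base mulSn /blk_of; lia.
have hfit := fits alam.
have hend : base + seqlen_of + smplen_of <= s0 rStk.
  by rewrite hk blk_a /stack_base_of leq_add2l.
have hvtx q : base <= q < base + seqlen_of + smplen_of -> s0 q = vtx_of l q.
  move=> hq; have hq2 : q = data + (q - data) by lia.
  have hq3 : q - data < ndraws_of by move: hfit; rewrite mulSn; move: hq; rewrite blk_a mulSn; lia.
  by rewrite {1}hq2 s0data// (nth_map (Ordinal n_gt0)) ?sl.
have hst : St s0 (Cfg 0 base (s0 rStk) [::] 0 weight den) s0.
  by split; split; rewrite //= ?hk ?addn0.
have m_gt0 : 0 < smplen_of by rewrite muln_gt0 expn_gt0.
have blkl : a * blk_of + blk_of <= size l by rewrite sl; move: hfit; rewrite mulSn addnC.
have ypre : prefix_ base (vtx_of l) seqlen_of = take seqlen_of (chunk l a).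
  rewrite /prefix_ prefix_vtx; last by move: blkl; rewrite /blk_of; lia.
  by rewrite /chunk take_takel// leq_addr.
have vpre : samples base seqlen_of (vtx_of l) smplen_of = drop seqlen_of (chunk l a).
  rewrite /samples -addnA prefix_vtx; last by move: blkl; rewrite /blk_of; lia.
  rewrite /chunk (_ : take blk_of _ = take (smplen_of + seqlen_of) (drop (a * blk_of) l)); last first.
    by rewrite addnC.
  by rewrite -take_drop drop_drop addnC.
rewrite -blk_a in ho.
have [|t [c [tle hr hm hres]]] := @block_run n M s0 hk' base seqlen_of smplen_of cap_of (vtx_of l)
   hbase hend hb he ho hK0 hvtx M_sym M_irr weight den m_gt0.
  by rewrite ypre; exact/eqP.
have [[hiT hmT _ _ _] [_ hcT hwT hdT]] := hr s0 hst.
rewrite hm in hmT.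
case: eqP => [h3|/eqP h3].
  (* Mode 3 is absorbing up to [rB], so the states at time [t] and at the end of the budget agree,
     whichever comes first. *)
  exists a => //; have heq x : x != rB -> s' x = iter t (bstep M) s0 x.
    move=> hx; case: (leqP t budget_of) => htb.
      by rewrite hs' -(subnK htb) iterD iter_idle.
    by rewrite -(subnK (ltnW htb)) iterD -hs' iter_idle.
  rewrite !heq// hcT hwT hdT; move: hres.
  by rewrite /good_end /result /picked_of ypre vpre.
move=> j; rewrite ltnS leq_eqVlt => /predU1P[->|ja]; last exact: hexp.
apply/negP => hch; have htb : t <= budget_of.
  by apply: leq_trans tle _; rewrite ypre vpre.
by move: h3; rewrite hs' -(subnK htb) iterD iter_idle// hmT.
Qed.

Definition success (l : seq 'I_n) s := exists j cnt w d,
  [/\ j < lam_of, result (chunk l j) cnt w d, s 0 = cnt * w & s 1 = d].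

Lemma attempts_post l s : size l = ndraws_of -> 0 < lam_of -> budget_of < F -> lam_of < F ->
  (forall a, a < lam_of -> covered_of (chunk l a)) ->
  (exists2 a, a < lam_of & cheap_of (chunk l a)) ->
  att_frame 0 s -> s rAtt = lam_of -> s rMode = 0 -> att_data l s ->
  post (exec M F (Seq (For rAtt attempt) finish) s) (success l).
Proof.
move=> sl lam0 BF lamF cov [a0 a0lam a0cheap] hfr hA hm hd.
apply/post_Seq.
pose I k s := [/\ att_frame (lam_of - k) s, att_data l s & att_out l (lam_of - k) s].
apply: post_mono (@For_post n M F rAtt attempt I lam_of _ s lamF _ hA).
- move=> s' [[hf' hd' ho'] _]; rewrite subn0 in hf' ho'; apply/post_simple => //.
  move: ho'; rewrite /att_out; case: eqP => [_ [j ja hj]|_ /(_ _ a0lam)]; last by rewrite a0cheap.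
  exists j, (s' rCnt), (s' rW), (s' rDen); split=> //.
- move=> k s' kl [hf' hd' ho'] hk'.
  have hf2 : att_frame (lam_of - k.+1) (upd s' rAtt k).
    by case: hf' => -[[? ? ? ?] [? ? ?] ?] ?; do !split; rewrite upd_ne.
  have hd2 : att_data l (upd s' rAtt k).
    by move=> i it; rewrite upd_ne ?hd'.
  have ho2 : att_out l (lam_of - k.+1) (upd s' rAtt k) by [].
  have alam : lam_of - k.+1 < lam_of by lia.
  apply: post_mono (attempt_post lam0 BF alam hf2) => s2 [hf3 hA3 h3].
  have [hd3 ho3] := h3 l sl hd2.
  have ek : (lam_of - k.+1).+1 = lam_of - k by lia.
  rewrite ek in hf3 ho3; split; last by rewrite hA3 upd_eq.
  by split=> //; apply: ho3 => //; exact: cov.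
by rewrite /I subnn; split=> //; rewrite /att_out hm.
Qed.

End Prelude.

(** * Running time *)

Section RunningTime.
Local Open Scope nat_scope.

Lemma halts_Seq n (M : rel 'I_n) F c1 c2 s T1 T2 :
  halts_within T1 (exec M F c1 s) ->
  post (exec M F c1 s) (fun s' => halts_within T2 (exec M F c2 s')) ->
  halts_within (T1 + T2) (exec M F (Seq c1 c2) s).
Proof. exact: halts_bind. Qed.

Lemma halts_Seqs n (M : rel 'I_n) F c1 c2 s T1 T2 : simple c1 ->
  dcost M c1 s <= T1 -> halts_within T2 (exec M F c2 (dexec M c1 s)) ->
  halts_within (T1 + T2) (exec M F (Seq c1 c2) s).
Proof.
move=> h hT h2; apply: halts_Seq; last exact/post_simple.
by apply: halts_mono hT _; exact: halts_simple.
Qed.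

Lemma post_and (A : Type) (p : ctree A) (Q1 Q2 : A -> Prop) :
  post p Q1 -> post p Q2 -> post p (fun a => Q1 a /\ Q2 a).
Proof. by elim: p => //= m k IH h1 h2 i; exact: IH. Qed.

Lemma bitlen_lin x : bitlen x <= x.+1.
Proof. by rewrite bitlen_le// ltnW// ltn_expl. Qed.

Lemma expn5_bound v : 1 < v -> v + v * ((v + v) * v) <= v ^ 5.
Proof.
move=> v1; rewrite !expnS expn0 muln1.
have a0 : v + v <= v * v by rewrite addnn -mul2n leq_mul2r v1 orbT.
have a1 : v * ((v + v) * v) <= v * (v * (v * v)).
  by rewrite leq_mul2l mulnA leq_mul2r a0 !orbT.
have a3 : v <= v * (v * (v * v)) by rewrite leq_pmulr// !muln_gt0; lia.
apply: leq_trans (leq_add a3 a1) _.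
by rewrite addnn -mul2n leq_mul2r v1 orbT.
Qed.

Section Time.
Variables (n A E : nat) (M : rel 'I_n) (F : nat).
Hypotheses (n_gt0 : 0 < n) (A_gt0 : 0 < A).
Hypotheses (M_sym : symmetric M) (M_irr : irreflexive M).
Local Arguments dexec : simpl never.
Local Notation clipped := (clipped_of n E).
Local Notation hlog := (hlog_of n).
Local Notation sq := (sq_of n).
Local Notation lam := (lam_of n A).
Local Notation seqlen := (seqlen_of n A).
Local Notation smplen := (smplen_of n A).
Local Notation cap := (cap_of n E).
Local Notation budget := (budget_of n A E).
Local Notation ndraws := (ndraws_of n A).
Local Notation stack_base := (stack_base_of n A).

(** [start] without [shift], which adds registers and so is not tame. The values written by [shift]
    are addresses, bounded by the stack base. *)
Definition tail_ :=
  Seq (If (Eq (Reg rMode) (Const 3)) Skip reset) (Set_ rB (Reg rBud)).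
Definition grow := cgrowth body + cgrowth tail_.
(** [V0] bounds the cells during the square root loop, [V1] up to the end of the drawing, [V2]
    during all attempts. The fifth power absorbs the additive growth over all rounds, see
    [expn5_bound]. *)
Definition V0 := 2 * n + (1000 + A + grow).
Definition V1 := V0 ^ cdeg (params A).
Definition V2 := V1 ^ 5.

Lemma V0_gt1 : 1 < V0. Proof. by rewrite /V0; lia. Qed.

Lemma V1_ge : V0 <= V1.
Proof. by rewrite -[X in X <= _]expn1 leq_exp2l ?V0_gt1// cdeg_gt0. Qed.

Lemma sqrt_mbound k s : sqrt_inv n E k s -> s rI <= n -> mbound V0 s.
Proof.
case=> -[h0 hE] hS hmin _ hx hI x.
have hSn : s rS <= 2 * n.
  rewrite hS; case: hmin => [->|lt]; first by rewrite expn0; lia.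
  case: (s rL) lt => [|j] /= lt; first by rewrite expn0; lia.
  rewrite expnS leq_mul2l /=; apply: leq_trans (ltnW lt).
  by case: j {lt} => // j; rewrite leq_exp2r.
have hL : s rL <= 2 * n by apply: leq_trans hSn; rewrite hS ltnW// ltn_expl.
case: (boolP (x \in [:: 0; rI; rE; rS; rL])) => [|/hx -> //].
have hEn : s rE <= n by rewrite hE geq_minr.
by rewrite !inE /V0 => /or4P[/eqP->|/eqP->|/eqP->|/orP[]/eqP->]; lia.
Qed.

Lemma mbound_loaded s : loaded n A E s -> mbound V1 s ->
  [/\ n <= V1, lam <= V1, budget <= V1, stack_base <= V1 & ndraws <= V1].
Proof.
case=> -[[h0 _ _ _] [hB _ _] hS] _ [hI hA] h.
by split; [rewrite -h0|rewrite -hA|rewrite -hB|rewrite -hS|rewrite -hI]; exact: h.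
Qed.

Lemma prelude_mbound : n < F ->
  post (exec M F (prelude A E) (init_memory n)) (fun s => loaded n A E s /\ mbound V1 s).
Proof.
move=> nF; apply: post_and; first exact: prelude_post.
rewrite /prelude; apply/post_Seqs => //; apply/post_Seqs => //.
have [e hinv] := prelude_start E M.
rewrite e; apply/post_Seq.
apply: post_mono (@For_post n M F rI sqrt_step (sqrt_inv n E) n _ _ nF hinv _).
- move=> s [hs sI]; apply/post_simple; first by [].
  apply: dexec_deg; first exact: V0_gt1.
  + by [].
  + by rewrite /= /V0; lia.
  + by apply: sqrt_mbound hs _; rewrite sI.
- by move=> k s _ hs sr; apply/post_simple => //; exact: sqrt_inv_step.
- by rewrite /sqrt_start upd_eq.
Qed.

Variable b : nat.
Hypothesis V0_b : V0 < 2 ^ b.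

Lemma b_gt0 : 0 < b.
Proof. by case: b V0_b => //; rewrite expn0; have := V0_gt1; lia. Qed.

Lemma bits k : 0 < k -> bitlen (V0 ^ k) <= k * b.
Proof. by move=> k0; apply: bitlen_expn => //; exact: b_gt0. Qed.

(** An exponent of [V0] large enough for every value computed after [clip]. *)
Definition kap := cdeg sqrt_step + cdeg (params A) * (5 * (cdeg start + cdeg finish) + 6).
Local Notation bt := (kap * b).

Lemma bits_kap k : 0 < k -> k <= kap -> bitlen (V0 ^ k) <= bt.
Proof.
by move=> k0 kk; apply: leq_trans (bits k0) _; rewrite leq_mul2r kk orbT.
Qed.

Lemma bitlen_V x : x <= V2 -> bitlen x <= bt.
Proof.
move=> xV; apply: leq_trans (bitlen_mono xV) _; rewrite /V2 /V1 -expnM.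
have := cdeg_gt0 (params A) => d0; apply: bits_kap; first by rewrite muln_gt0 d0.
rewrite /kap; set d := cdeg (params A) in d0 *; set x1 := cdeg start + _.
have : d * 5 <= d * (5 * x1 + 6) by rewrite leq_mul2l; lia.
lia.
Qed.

Definition draw_inv k s :=
  [/\ static_ n A E s, [/\ s rP = data + (ndraws - k), s rStop = data & s rMode = 0],
      s rAtt = lam & mbound V1 s].

Lemma draw_inv_step k s x : k < ndraws -> stack_base <= V1 -> x < n -> draw_inv k.+1 s ->
  draw_inv k (upd (upd (upd s rI k) (s rP) x) rP (s rP).+1) /\
  upd (upd (upd s rI k) (s rP) x) rP (s rP).+1 rI = k.
Proof.
move=> kN hV xn [[[h0 hLen hSmp hK] [hBud hW0 hD0] hStk] [hP hStop hM] hA hb].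
have ne r : r < data -> r != s rP.
  by move=> rd; rewrite hP; apply/negP => /eqP e; rewrite e in rd; lia.
have hx : x <= V1.
  by apply: leq_trans (ltnW xn) _; apply: leq_trans V1_ge; rewrite /V0; lia.
have hPV : (s rP).+1 <= stack_base by rewrite hP /stack_base_of; lia.
have kV : k <= V1 by apply: leq_trans hV; rewrite /stack_base_of; lia.
split; last by rewrite upd_ne// upd_ne ?ne// upd_eq.
split.
- by do !split; rewrite upd_ne// upd_ne ?ne// upd_ne.
- split; rewrite ?upd_eq//; last 2 first.
  + by rewrite upd_ne// upd_ne ?ne// upd_ne.
  + by rewrite upd_ne// upd_ne ?ne// upd_ne.
  by rewrite hP; lia.
- by rewrite upd_ne// upd_ne ?ne// upd_ne.
do !apply: mbound_upd => //.
exact: leq_trans hV.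
Qed.

Lemma exec_draw_post s (Q : memory -> Prop) : s 0 = n -> s rP != rP ->
  (forall x, x < n -> Q (upd (upd s (s rP) x) rP (s rP).+1)) ->
  post (exec M F draw s) Q.
Proof.
move=> h0 hP hQ /= i.
have hi : i < n by apply: leq_trans (ltn_ord i) _; rewrite h0 prednK.
by rewrite upd_ne 1?eq_sym// addn1; exact: hQ.
Qed.

Lemma exec_draw_halts V s : mbound V s -> V <= V1 -> n <= V -> data <= V -> s 0 = n -> s rP != rP ->
  (s rP).+1 <= V ->
  halts_within (20 * bt) (exec M F draw s).
Proof.
move=> hb VV nV dV h0 hP hPV.
have V12 : V1 <= V2.
  rewrite /V2 -[X in X <= _]expn1 leq_exp2l//.
  by apply: leq_trans V0_gt1 V1_ge.
have B x : x <= V -> bitlen x <= bt.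
  by move=> xV; apply: bitlen_V; apply: leq_trans xV (leq_trans VV V12).
have b1 : 0 < bt by apply: leq_trans (B 0 _).
have B1 := B (s rP) (hb _); have B2 := B rP (leq_trans _ dV).
have B3 := B 0 (leq0n _); have B4 : bitlen (s 0) <= bt by apply: B.
have B5 := B _ hPV; have B6 : bitlen 1 <= bt by [].
rewrite /=; split; first by have := B2 isT; lia.
move=> i; rewrite upd_ne 1?eq_sym// addn1; split=> //.
have := B2 isT; lia.
Qed.

Lemma draws_time s : ndraws < F -> stack_base <= V1 -> loaded n A E s -> mbound V1 s ->
  halts_within (ndraws.+1 * (20 * bt + 9 * bt)) (exec M F (For rI draw) s) /\
  post (exec M F (For rI draw) s) (draw_inv 0).
Proof.
move=> NF hV [hst [hP hStop hM] [hI hA]] hb.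
have hinv : draw_inv ndraws s.
  by split=> //; split=> //; rewrite subnn addn0.
have nP k s' : draw_inv k s' -> (s' rP != rP) /\ s' 0 = n.
  case=> [[[h0 _ _ _] _ _] [hP' _ _] _ _]; split=> //.
  by rewrite hP'; apply/negP => /eqP; lia.
have V0V := V1_ge.
have step k s' : k < ndraws -> draw_inv k.+1 s' -> s' rI = k.+1 ->
    post (exec M F draw (upd s' rI k)) (fun s2 => draw_inv k s2 /\ s2 rI = k).
  move=> kN hs' _; have [h1 h2] := nP _ _ hs'.
  apply: exec_draw_post; rewrite ?upd_ne// => x xn.
  exact: draw_inv_step.
split; last by apply: post_mono (For_post step NF hinv hI) => s' [].
have hN : ndraws <= V1 by apply: leq_trans hV; rewrite /stack_base_of leq_addl.
have V12 : V1 <= V2 by rewrite /V2 -[X in X <= _]expn1 leq_exp2l//; apply: leq_trans V0_gt1 V1_ge.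
apply: (For_halts (I := draw_inv)) => //.
- move=> k s' kN hs' _; have [h1 h2] := nP _ _ hs'.
  have [_ [hP' _ _] _ hb'] := hs'.
  apply: (@exec_draw_halts V1); rewrite ?upd_ne//.
  + apply: mbound_upd => //; by apply: leq_trans (ltnW kN) hN.
  + by apply: leq_trans V0V; rewrite /V0; lia.
  + by apply: leq_trans V0V; rewrite /V0; lia.
  + by apply: leq_trans hV; rewrite hP' /stack_base_of; lia.
- by apply: bitlen_V; apply: leq_trans V12; apply: leq_trans V0V; rewrite /V0; lia.
- by apply: bitlen_V; apply: leq_trans V12.
Qed.

Definition attempt_cost :=
  csize start * bt + budget.+1 * (csize body * bt + 9 * bt).

Lemma attempt_time a s W : a < lam -> budget < F -> budget <= V1 -> stack_base <= V1 ->
  att_frame n A E a s -> mbound W s -> V1 <= W -> W + budget.+1 * grow <= V2 ->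
  halts_within attempt_cost (exec M F attempt s) /\
  post (exec M F attempt s) (mbound (W + budget.+1 * grow)).
Proof.
move=> alam BF BV SV hfr hb VW WV.
have [s0 [es0 s0ne [_ _ _ hTop hB] _ _]] := start_spec M hfr.
have [[_ _ hStk] hStop] := hfr.
have gB : cgrowth body <= grow by rewrite leq_addr.
have gT : cgrowth tail_ <= grow by rewrite leq_addl.
have V01 := V1_ge; have V0g : grow <= V0 by rewrite /V0; lia.
have WV2 : W <= V2 by lia.
have W1 : 1 < W by apply: leq_trans VW; apply: leq_trans V01; exact: V0_gt1.
have fit := @fits n A a alam.
have hs0b : mbound (W + cgrowth tail_) s0.
  rewrite -es0 -[dexec M start s]/(dexec M tail_ (dexec M shift s)) (shift_eq M hfr).
  have hSB : stack_base <= W by apply: leq_trans VW.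
  have hS3 : data + a.+1 * blk_of n A <= W.
    by apply: leq_trans hSB; rewrite leq_add2l.
  have hS2 : data + a * blk_of n A + seqlen <= W.
    by apply: leq_trans hS3; rewrite mulSn /blk_of; lia.
  have hS1 : data + a * blk_of n A <= W by apply: leq_trans hS2; rewrite leq_addr.
  by apply: dexec_tame => //; do !apply: mbound_upd => //.
have hk : s0 rStk = stack_base by rewrite s0ne.
have hk' : data <= s0 rStk by rewrite hk leq_addr.
have hI : Inv_ s0 true s0 by split=> //; rewrite hk hTop.
pose I k s' := Inv_ s0 true s' /\ mbound (W + cgrowth tail_ + (budget - k) * cgrowth body) s'.
have bnd k : k <= budget -> W + cgrowth tail_ + k * cgrowth body <= W + budget.+1 * grow.
  move=> kB; rewrite mulSn -addnA leq_add2l leq_add//; exact: leq_mul.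
have updI k s' : k < budget -> I k.+1 s' ->
    Inv_ s0 true (upd s' rB k) /\
    mbound (W + cgrowth tail_ + (budget - k.+1) * cgrowth body) (upd s' rB k).
  move=> kB [h1 h2]; split; first exact: Inv_rB.
  by apply: mbound_upd => //; lia.
have step k s' : k < budget -> I k.+1 s' -> s' rB = k.+1 ->
    post (exec M F body (upd s' rB k)) (fun s2 => I k s2 /\ s2 rB = k).
  move=> kB hI' _; have [h1 h2] := updI _ _ kB hI'.
  apply/post_simple => //; split; last by rewrite (body_rB M hk' h1) upd_eq.
  split; first exact: Inv_body.
  apply: mbound_le (dexec_tame M body_tame h2).
  have -> : budget - k = (budget - k.+1).+1 by lia.
  by rewrite mulSn; lia.
have hI0 : I budget s0 by split=> //; rewrite subnn mul0n addn0.
have V02 : V0 <= V2 by lia.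
split; last first.
  apply/post_Seqs => //; rewrite es0.
  apply: post_mono (For_post step BF hI0 hB) => s' [[_ h] _].
  by apply: mbound_le h; rewrite subn0 bnd.
apply: halts_Seqs => //.
  apply: (@dcost_deg _ _ W) => //.
    by apply: leq_trans VW; apply: leq_trans V01; rewrite /= /V0; lia.
  apply: (@leq_trans (bitlen (V2 ^ cdeg start))).
    by apply: bitlen_mono; rewrite leq_exp2r// cdeg_gt0.
  rewrite /V2 /V1 -!expnM.
  have d0 := cdeg_gt0 (params A); have d1 := cdeg_gt0 start.
  have pos x z : 0 < x -> 0 < z -> 0 < x * (5 * z) by move=> hx hz; rewrite !muln_gt0 hx hz.
  apply: bits_kap; first exact: pos.
  rewrite /kap; set d := cdeg (params A); set x1 := cdeg start; set x2 := cdeg finish.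
  have : d * (5 * x1) <= d * (5 * (x1 + x2) + 6) by rewrite leq_mul2l; lia.
  lia.
rewrite es0.
apply: (For_halts step) => //.
- move=> k s' kB hI' _; have [h1 h2] := updI _ _ kB hI'.
  apply: halts_mono _ (halts_simple M F _ _) => //.
  apply: (dcost_tame M body_tame h2).
  apply: bitlen_V; have := bnd (budget - k.+1).+1; rewrite mulSn; lia.
- by apply: bitlen_V; apply: leq_trans V02; rewrite /V0; lia.
- by apply: bitlen_V; lia.
Qed.

Definition prog_time :=
  csize (clip E) * (n + cgrowth (clip E)).+1 + (csize sqrt_init * bt +
  (n.+1 * (csize sqrt_step * bt + 9 * bt) + csize (params A) * bt)) +
  (ndraws.+1 * (20 * bt + 9 * bt) +
   (lam.+1 * (attempt_cost + 9 * bt) + csize finish * bt)).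

Lemma sqrt_step_simple : simple sqrt_step. Proof. by []. Qed.
Lemma params_simple : simple (params A). Proof. by []. Qed.
Lemma finish_simple : simple finish. Proof. by []. Qed.

Lemma bits_sqrt_step : bitlen (V0 ^ cdeg sqrt_step) <= bt.
Proof. by apply: bits_kap; [exact: cdeg_gt0|exact: leq_addr]. Qed.

Lemma bits_params : bitlen (V0 ^ cdeg (params A)) <= bt.
Proof.
apply: bits_kap; first exact: cdeg_gt0.
rewrite /kap; set d := cdeg (params A); set x1 := cdeg start; set x2 := cdeg finish.
have : d * 1 <= d * (5 * (x1 + x2) + 6) by rewrite leq_mul2l; lia.
lia.
Qed.

Lemma prog_halts : n < F -> ndraws < F -> lam < F -> budget < F ->
  halts_within prog_time (run M F (prog A E)).
Proof.
move=> nF NF lF BF; rewrite /run /prog.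
have V01 := V1_ge; have V0g : grow <= V0 by rewrite /V0; lia.
have V0_1 := V0_gt1.
have V12 : V1 <= V2 by rewrite /V2 -[X in X <= _]expn1 leq_exp2l//; lia.
apply: halts_Seq.
  apply: halts_Seqs => //.
    (* [clip] handles the constant [E], which is not bounded in terms of [n]. Its bit length is
       crudely replaced by a linear bound, which costs only a term of order [n + E]. *)
    apply: (@dcost_tame _ _ n) => //; last exact: bitlen_lin.
    by move=> x; rewrite /init_memory /upd; case: ifP.
  have [e hinv] := prelude_start E M.
  have V02 : V0 <= V2 := leq_trans V01 V12.
  apply: halts_Seqs => //.
    rewrite clip_eq; apply: (@dcost_tame _ _ n) => //.
      apply: mbound_upd; last exact: geq_minr.
      by apply: mbound_upd.
    by apply: bitlen_V; apply: leq_trans V02; rewrite /V0 /=; lia.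
  rewrite e.
  have step k s : k < n -> sqrt_inv n E k.+1 s -> s rI = k.+1 ->
      post (exec M F sqrt_step (upd s rI k)) (fun s' => sqrt_inv n E k s' /\ s' rI = k).
    by move=> _ hs _; apply/post_simple; [|exact: sqrt_inv_step].
  apply: halts_Seq.
    have hr : sqrt_start n E rI = n by rewrite /sqrt_start upd_eq.
    apply: (For_halts step _ _ _ nF hinv hr).
    - move=> k s kn hs sr.
      have h := sqrt_mbound hs; rewrite sr in h; have {}h := h kn.
      have kV : k <= V0 by rewrite /V0; lia.
      have hu : mbound V0 (upd s rI k) by apply: mbound_upd h kV.
      apply: halts_mono (halts_simple M F _ sqrt_step_simple).
      have fc : cconst sqrt_step <= V0 by rewrite /= /V0; lia.
      exact: (dcost_deg M V0_1 sqrt_step_simple fc hu bits_sqrt_step).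
    - by apply: bitlen_V; apply: leq_trans V02; rewrite /V0; lia.
    - by apply: bitlen_V; apply: leq_trans V02; rewrite /V0; lia.
  apply: post_mono (For_post step nF hinv _) => [s [hs sI]|]; last by rewrite /sqrt_start upd_eq.
  have hu : mbound V0 s by apply: sqrt_mbound hs _; rewrite sI.
  apply: halts_mono (halts_simple M F _ params_simple).
  have fc : cconst (params A) <= V0 by rewrite /= /V0; lia.
  exact: (dcost_deg M V0_1 params_simple fc hu bits_params).
apply: post_mono (prelude_mbound nF) => s [hl hb].
have [nV lV BV SV NV] := mbound_loaded hl hb.
have [dt dp] := draws_time NF SV hl hb.
apply: halts_Seq dt _; apply: post_mono dp => s1 [hst [hP hStop hM] hA hb1].
pose I k s := att_frame n A E (lam - k) s /\ mbound (V1 + (lam - k) * (budget.+1 * grow)) s.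
have hI0 : I lam s1.
  by rewrite /I subnn mul0n addn0; split=> //; split=> //; rewrite mul0n addn0.
have top : V1 + lam * (budget.+1 * grow) <= V2.
  have h1 : lam * (budget.+1 * grow) <= V1 * ((V1 + V1) * V1).
    by rewrite leq_mul// leq_mul//; lia.
  apply: leq_trans (leq_add (leqnn _) h1) _.
  by apply: expn5_bound; lia.
have updI k u : k < lam -> I k.+1 u ->
    att_frame n A E (lam - k.+1) (upd u rAtt k) /\
    mbound (V1 + (lam - k.+1) * (budget.+1 * grow)) (upd u rAtt k).
  move=> kl [[[[? ? ? ?] [? ? ?] ?] ?] h]; split.
    by do !split; rewrite upd_ne.
  by apply: mbound_upd => //; lia.
have stepb k : k < lam -> V1 + (lam - k.+1) * (budget.+1 * grow) + budget.+1 * grow =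
    V1 + (lam - k) * (budget.+1 * grow).
  by move=> kl; rewrite -addnA -mulSnr; congr (_ + _ * _); lia.
have att k u : k < lam -> I k.+1 u ->
   halts_within attempt_cost (exec M F attempt (upd u rAtt k)) /\
   post (exec M F attempt (upd u rAtt k)) (mbound (V1 + (lam - k) * (budget.+1 * grow))).
  move=> kl hI; have [h1 h2] := updI _ _ kl hI; rewrite -stepb//.
  have alam : lam - k.+1 < lam by lia.
  apply: (attempt_time alam BF BV SV h1 h2 (leq_addr _ _)).
  rewrite stepb//; apply: leq_trans top; rewrite leq_add2l leq_mul2r leq_subr orbT//.
have step k u : k < lam -> I k.+1 u -> u rAtt = k.+1 ->
    post (exec M F attempt (upd u rAtt k)) (fun s2 => I k s2 /\ s2 rAtt = k).
  move=> kl hI _; have [h1 h2] := updI _ _ kl hI; have [_ h3] := att _ _ kl hI.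
  have lam0 : 0 < lam by lia.
  have alam : lam - k.+1 < lam by lia.
  apply: post_mono (post_and h3 (attempt_post n_gt0 nF M_sym M_irr lam0 BF alam h1)) => s2.
  case=> h4 [h5 h6 _]; split; last by rewrite h6 upd_eq.
  split; last exact: h4.
  by move: h5; rewrite subnSK.
apply: halts_Seq.
  apply: (For_halts step _ _ _ lF hI0 hA).
  - by move=> k s' kl hI' _; have [h _] := att _ _ kl hI'; exact: h.
  - by apply: bitlen_V; apply: leq_trans V12; apply: leq_trans V01; rewrite /V0; lia.
  - by apply: bitlen_V; exact: leq_trans V12.
apply: post_mono (For_post step lF hI0 hA) => s2 [[_ hb2] _].
apply: halts_mono (halts_simple M F _ finish_simple).
rewrite subn0 in hb2.
have fc : cconst finish <= V2.
  by apply: leq_trans V12; apply: leq_trans V01; rewrite /= /V0; lia.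
apply: (dcost_deg M (leq_trans (leq_trans V0_1 V01) V12) finish_simple fc (mbound_le top hb2)).
rewrite /V2 /V1 -!expnM.
have d0 := cdeg_gt0 (params A); have d1 := cdeg_gt0 finish.
have pos x z : 0 < x -> 0 < z -> 0 < x * (5 * z) by move=> hx hz; rewrite !muln_gt0 hx hz.
apply: bits_kap; first exact: pos.
rewrite /kap; set d := cdeg (params A); set x1 := cdeg start; set x2 := cdeg finish.
have : d * (5 * x2) <= d * (5 * (x1 + x2) + 6) by rewrite leq_mul2l; lia.
lia.
Qed.

End Time.

End RunningTime.

(** * Success probability *)

Lemma seq_perm n (s : seq 'I_n) : uniq s -> size s = n ->
  exists pi : {perm 'I_n}, [seq pi i | i <- enum 'I_n] = s.
Proof.
case: n s => [|n'] s us ss.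
  exists 1%g; have -> : enum 'I_0 = [::] by apply/eqP; rewrite -size_eq0 size_enum_ord.
  by move/size0nil: ss => ->.
pose f (i : 'I_n'.+1) := nth ord0 s i.
have f_inj : injective f.
  by move=> i j /eqP; rewrite /f nth_uniq ?ss// => /eqP /val_inj.
exists (perm f_inj); apply: (@eq_from_nth _ ord0).
  by rewrite size_map size_enum_ord.
move=> i; rewrite size_map size_enum_ord => hi.
by rewrite (nth_map ord0) ?size_enum_ord// permE /f nth_enum_ord.
Qed.

(** * Every maximal independent set is a greedy set *)

Section MaximalIndependent.
Variables (n : nat) (M : rel 'I_n).
Local Open Scope nat_scope.

Lemma foldl_gadd_dead (I : {set 'I_n}) (s : seq 'I_n) : indep M I ->
  {in s, forall v, v \notin alive M I} -> foldl (gadd M) I s = I.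
Proof.
move=> indI; elim: s => //= v s IH h.
rewrite gadd_dead//; last by apply: h; rewrite mem_head.
by apply: IH => u us; apply: h; rewrite in_cons us orbT.
Qed.

Lemma foldl_gadd_indep (J I : {set 'I_n}) (s : seq 'I_n) : indep M I -> [set x in s] \subset I ->
  J \subset I -> foldl (gadd M) J s = J :|: [set x in s].
Proof.
move=> indI; elim: s J => /= [|v s IH] J hs hJ.
  by apply/setP => x; rewrite !inE orbF.
have vI : v \in I by apply: (subsetP hs); rewrite inE mem_head.
have -> : gadd M J v = v |: J.
  rewrite /gadd; case: ifP => // /existsP[u /andP[uJ Muv]].
  by have := indI u v (subsetP hJ _ uJ) vI; rewrite Muv.
rewrite IH.
- by apply/setP => x; rewrite !inE -orbA orbCA.
- by apply: subset_trans hs; apply/subsetP => x; rewrite !inE => ->; rewrite orbT.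
- by rewrite subUset sub1set vI.
Qed.

(** Let the permutation list [I] before its complement: independence admits all of [I], maximality
    rejects the rest. *)
Lemma maximal_rgmis I : indep M I -> alive M I = set0 ->
  exists pi, rgmis M pi = I.
Proof.
move=> indI maxI.
have us : uniq (enum I ++ enum (~: I)).
  rewrite cat_uniq !enum_uniq andbT /=; apply/hasPn => x.
  by rewrite mem_enum inE => xI; rewrite /= mem_enum.
have ss : size (enum I ++ enum (~: I)) = n.
  by rewrite size_cat -!cardE cardsC card_ord.
have [pi hpi] := seq_perm us ss.
exists pi; rewrite /rgmis hpi -/(gadd M) foldl_cat.
have E0 : [set x in enum I] = I by apply/setP => x; rewrite inE mem_enum.
rewrite (@foldl_gadd_indep set0 I)// ?sub0set ?E0//.
rewrite set0U; apply: foldl_gadd_dead => // v _.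
by rewrite maxI in_set0.
Qed.

End MaximalIndependent.

(** * Failure probabilities of a single block *)

Section BlockProbability.
Variables (R : realType) (n A E : nat) (M : rel 'I_n).
Hypotheses (n_gt0 : (0 < n)%N) (A_gt0 : (0 < A)%N) (E_gt0 : (0 < E)%N).
Hypotheses (M_sym : symmetric M) (M_irr : irreflexive M).
Local Notation Ex := (@Ex R n).
Local Notation N := (n%:R : R).
Local Notation clipped := (clipped_of n E).
Local Notation hlog := (hlog_of n).
Local Notation sq := (sq_of n).
Local Notation lam := (lam_of n A).
Local Notation seqlen := (seqlen_of n A).
Local Notation smplen := (smplen_of n A).
Local Notation cap := (cap_of n E).
Local Notation budget := (budget_of n A E).
Local Notation blk := (blk_of n A).
Local Notation covered := (covered_of A M).
Local Notation picked := (picked_of A M).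
Local Notation cheap := (cheap_of A E M).

Let N_gt0 : 0 < N. Proof. by rewrite ltr0n. Qed.

Definition accurate (c : seq 'I_n) : bool :=
  let mu := smplen%:R * (#|picked c|%:R / N) in
  let d := (4 * clipped)%:R^-1 in
  (#|picked c| <= cap)%N ||
  ((1 - d) * mu <= (count [in picked c] (drop seqlen c))%:R <= (1 + d) * mu).

(** Each vertex escapes all [n lam] draws with probability [(1 - 1/n)^(n lam)], at most
    [expR (- lam)]; a union bound over the vertices follows. *)
Lemma Ex_uncovered : Ex blk (fun c => (~~ covered c)%:R) <= N * expR (- lam%:R).
Proof.
rewrite Ex_cat; apply: le_trans (_ : Ex seqlen (fun l => \sum_(v < n) (v \notin l)%:R) <= _).
  apply: Ex_le => l sl; rewrite -[leRHS](Ex_cst n_gt0 smplen); apply: Ex_le => l' _.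
  rewrite /covered_of /picked_of take_cat sl ltnn subnn take0 cats0.
  case: (set_0Vmem (alive M (greedy M l))) => [->|[v va]].
    by rewrite eqxx; apply: sumr_ge0 => v _; rewrite ler0n.
  have vl : v \notin l by apply: contraTN va; exact: alive_mem.
  rewrite (bigD1 v)//= vl; apply: (@le_trans _ _ 1).
    by case: (_ == _).
  by rewrite lerDl; apply: sumr_ge0 => u _; rewrite ler0n.
rewrite Ex_sum (eq_bigr (fun=> (1 - N^-1) ^+ seqlen)); last by move=> v _; exact: Ex_never.
rewrite sumr_const card_ord -[leLHS]mulr_natl ler_wpM2l ?ler0n//.
have -> : - lam%:R = seqlen%:R * (- N^-1) :> R.
  by rewrite /seqlen_of natrM mulrAC mulrN divff ?mulN1r// lt0r_neq0.
rewrite expRM_natl; apply: lerXn2r; rewrite ?nnegrE ?expR_ge0//.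
  by rewrite subr_ge0 invf_le1// ler1n.
exact: expR_ge1Dx.
Qed.

Lemma sq_ge : (n <= sq * sq)%N.
Proof. by rewrite /sq_of -expnMn; exact: up_logP. Qed.

Lemma clipped_gt0 : (0 < clipped)%N.
Proof. by rewrite leq_min E_gt0. Qed.

(** With [d = 1/(4 e)] and more than [sq e^2] picked vertices, the Chernoff exponent [d^2 mu / 4] is
    at least [lam sq^2 / (64 n)], and [sq^2 >= n]. The samples are independent of the sequence, so
    the bound holds for each fixed sequence. *)
Lemma Ex_inaccurate : Ex blk (fun c => (~~ accurate c)%:R) <= 2 * expR (- (lam%:R / 64)).
Proof.
rewrite Ex_cat -[leRHS](Ex_cst n_gt0 seqlen); apply: Ex_le => l sl.
have pE l' : picked (l ++ l') = greedy M l.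
  by rewrite /picked_of take_cat sl ltnn subnn take0 cats0.
have dE l' : drop seqlen (l ++ l') = l' by rewrite drop_cat sl ltnn subnn drop0.
have e0 := clipped_gt0.
set k := #|greedy M l|.
case: (leqP k cap) => hk.
  rewrite (eq_Ex (g := fun=> 0)); last first.
    by move=> l' _; rewrite /accurate pE -/k hk.
  by rewrite Ex_cst// mulr_ge0 ?expR_ge0.
set mu := smplen%:R * (k%:R / N).
set d := (4 * clipped)%:R^-1 : R.
have d0 : 0 < d by rewrite invr_gt0 ltr0n muln_gt0.
have d1 : d <= 1 / 2.
  rewrite mul1r lef_pV2 ?posrE ?ltr0n ?muln_gt0// ler_nat; lia.
rewrite (eq_Ex (g := fun l' => (~~ ((1 - d) * mu <= (hits (greedy M l) l')%:R <= (1 + d) * mu))%:R)); last first.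
  by move=> l' _; rewrite /accurate pE dE -/k leqNgt hk.
apply: le_trans (chernoff n_gt0 d0 d1 erefl) _.
rewrite ler_wpM2l// ler_expR lerN2 -/k -/mu.
rewrite /d /mu.
have hk' : sq%:R * (clipped%:R * clipped%:R) <= k%:R :> R by rewrite -!natrM ler_nat ltnW.
have hs : N <= sq%:R * sq%:R by rewrite -natrM ler_nat sq_ge.
have eR : 0 < clipped%:R :> R by rewrite ltr0n.
have -> : smplen%:R = sq%:R * lam%:R :> R by rewrite -natrM.
rewrite [(4 * _)%:R]natrM.
set s := sq%:R in hk' hs *; set e := clipped%:R in hk' eR *; set L := lam%:R.
have s0 : 0 <= s by rewrite ler0n.
have L0 : 0 <= L by rewrite ler0n.
have -> : (4 * e)^-1 ^+ 2 * (s * L * (k%:R / N)) / 4 = L / 64 * ((s * k%:R) / (N * (e * e))).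
  by field; rewrite !lt0r_neq0.
rewrite ler_peMr ?divr_ge0// ler_pdivlMr ?mul1r; last by rewrite !mulr_gt0.
apply: le_trans (ler_wpM2l s0 hk'); rewrite [leRHS]mulrA ler_wpM2r//.
by rewrite mulr_ge0// ltW.
Qed.

Lemma Ex_sum_iid k (f : 'I_n -> R) :
  Ex k (fun l => \sum_(v <- l) f v) = k%:R * (N^-1 * \sum_v f v).
Proof.
elim: k => [|k IH]; first by rewrite /= big_nil mul0r.
rewrite -natr1 mulrDl mul1r -{}IH /=.
under eq_bigr => i _ do rewrite (eq_Ex (fun l _ => big_cons _ _ _ _ _ _)) ExD Ex_cst//.
by rewrite big_split /= mulrDr [X in _ + X = _]avg_cst// addrC.
Qed.

Lemma lam_gt0 : (0 < lam)%N.
Proof. by rewrite muln_gt0 A_gt0 addn1. Qed.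

Lemma hlog_lam : (hlog < lam)%N.
Proof. by rewrite /lam_of addn1 leq_pmull. Qed.

(** [seqlen] is at most [2^(2 hlog + lam)], so its harmonic number is at most [2 hlog + lam + 1],
    which is of order [lam]. *)
Lemma Ex_work_le :
  Ex seqlen (fun y => (\sum_v work M y v)%:R) <= N * (7 * n%:R * lam%:R ^+ 2).
Proof.
apply: le_trans (Ex_work R M_sym n_gt0 seqlen) _; rewrite ler_wpM2l ?ler0n//.
have hH : harmonic R seqlen <= (2 * hlog + lam)%N.+1%:R.
  apply: le_trans _ (harmonic_exp2 R (2 * hlog + lam)); apply: harmonic_le.
  rewrite expnD expnM; apply: leq_mul; first exact: up_logP.
  by rewrite ltnW// ltn_expl.
have h1 : (2 + (2 * hlog + lam).+1 <= 6 * lam)%N.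
  by have := hlog_lam; have := lam_gt0; lia.
have h2 : 2 + harmonic R seqlen <= 6 * lam%:R.
  by apply: le_trans (lerD (lexx _) hH) _; rewrite -natrD -natrM ler_nat.
have l1 : 1 <= lam%:R :> R by rewrite ler1n lam_gt0.
have n1 : 1 <= N by rewrite ler1n.
rewrite /seqlen_of natrM.
have h3 : N * lam%:R * (2 + harmonic R (n * lam)) <= N * lam%:R * (6 * lam%:R).
  by rewrite ler_wpM2l// mulr_ge0.
apply: le_trans (lerD (lexx _) h3) _.
have h4 : 1 <= N * lam%:R ^+ 2 by rewrite mulr_ege1// expr_ge1.
rewrite expr2 in h4 *; lra.
Qed.

(** Markov's inequality at [a], twice the bound on the expected work on the samples. In units of [X]
    the exact phase costs at most 3, and samples of total work below [a] cost at most 42, so the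
    budget of 100 is not exhausted. *)
Lemma Ex_expensive : Ex blk (fun c => (~~ cheap c)%:R) <= 1 / 2.
Proof.
pose f c := \sum_(v <- drop seqlen c) (work M (take seqlen c) v)%:R : R.
pose a := (14 * (sq * lam) * (n * (lam * lam)))%:R : R.
have lg0 := lam_gt0; have e0 := clipped_gt0.
have sg0 : (0 < sq)%N by rewrite expn_gt0.
have pos (x y z : nat) : (0 < x -> 0 < y -> 0 < z -> 0 < 14 * (x * y) * (z * (y * y)))%N.
  by move=> x0 y0 z0; rewrite !muln_gt0 x0 y0 z0.
have a0 : 0 < a by rewrite ltr0n; exact: pos.
apply: le_trans (Ex_markov (f := f) a0 _ _) _.
- by move=> c _; apply: sumr_ge0 => v _; rewrite ler0n.
- move=> c _; rewrite /cheap_of -ltnNge /f -natr_sum ler_nat => h.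
  set S := (\sum_(v <- _) _)%N in h *.
  set X := (lam * (lam * lam) * (n * cap))%N.
  have bE : budget = (100 * X)%N by [].
  have e1 : (lam * (lam * lam) * (n * sq) <= X)%N.
    rewrite leq_mul2l leq_mul2l /cap_of leq_pmulr ?muln_gt0 ?e0//.
    by rewrite !orbT.
  have e2 : (seqlen * cap.+1 + 1 <= 3 * X)%N.
    have c1 : (0 < cap)%N by rewrite !muln_gt0 sg0 e0.
    have x1 : (n * lam * cap <= X)%N.
      rewrite /X mulnAC [(n * cap * lam)%N]mulnC leq_mul2r; apply/orP; right.
      by rewrite leq_pmulr// muln_gt0 lg0.
    have x2 : (n * lam <= n * lam * cap)%N by rewrite leq_pmulr.
    have x3 : (0 < n * lam)%N by rewrite muln_gt0 n_gt0.
    rewrite /seqlen_of mulnS; lia.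
  have e3 : (14 * (sq * lam) * (n * (lam * lam)) = 14 * (lam * (lam * lam) * (n * sq)))%N by ring.
  rewrite e3; lia.
rewrite ler_pdivrMr// Ex_cat.
rewrite (eq_Ex (g := fun l => smplen%:R * N^-1 * (\sum_v work M l v)%:R)); last first.
  move=> l sl.
  rewrite (eq_Ex (g := fun l' => \sum_(v <- l') (work M l v)%:R)); last first.
    move=> l' _; rewrite /f take_cat drop_cat sl ltnn subnn take0 drop0 cats0 //.
  by rewrite Ex_sum_iid natr_sum mulrA.
rewrite ExZ; apply: le_trans (ler_wpM2l _ Ex_work_le) _.
  by rewrite divr_ge0 ?ler0n.
have n0 : N != 0 by rewrite lt0r_neq0.
have -> : a = 14 * (sq%:R * lam%:R) * (N * (lam%:R * lam%:R)) by rewrite /a -!natrM.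
have -> : smplen%:R = sq%:R * lam%:R :> R by rewrite -natrM.
set s := sq%:R; set L := lam%:R.
by rewrite [leLHS](_ : _ = 1 / 2 * (14 * (s * L) * (N * (L * L))))//; field.
Qed.

End BlockProbability.

(** * Combining the independent blocks *)

Section Blocks.
Variables (R : realType) (n K : nat) (g h : pred (seq 'I_n)) (q : R).
Hypothesis n_gt0 : (0 < n)%N.
Hypotheses (g_q : Ex (R := R) K (fun c => (~~ g c)%:R) <= q)
           (h_half : Ex (R := R) K (fun c => (~~ h c)%:R) <= 1 / 2).
Local Notation Ex := (@Ex R n).

Definition nth_block (l : seq 'I_n) a := take K (drop (a * K) l).

Lemma nth_block0 c l : size c = K -> nth_block (c ++ l) 0 = c.
Proof. by move=> sc; rewrite /nth_block mul0n drop0 -sc take_size_cat. Qed.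

Lemma nth_blockS c l a : size c = K -> nth_block (c ++ l) a.+1 = nth_block l a.
Proof.
move=> sc; rewrite /nth_block mulSn; congr take.
by rewrite drop_cat sc ltnNge leq_addr /= addKn.
Qed.

Lemma Ex_has_bad k :
  Ex (k * K) (fun l => (has (fun a => ~~ g (nth_block l a)) (iota 0 k))%:R) <= k%:R * q.
Proof.
elim: k => [|k IH]; first by rewrite mul0n /= mul0r.
rewrite mulSn Ex_cat -natr1 mulrDl mul1r addrC.
apply: le_trans (lerD g_q IH); rewrite -[X in _ <= _ + X](Ex_cst n_gt0 K) -ExD.
apply: Ex_le => c sc; rewrite -[X in _ <= X + _](Ex_cst n_gt0 (k * K)) -ExD.
apply: Ex_le => l _ /=; rewrite nth_block0//.
rewrite -[1%N]addn0 iotaDl has_map.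
rewrite (@eq_has _ _ (fun a => ~~ g (nth_block l a))); last first.
  by move=> a /=; rewrite add1n nth_blockS.
by rewrite -natrD ler_nat; case: (~~ g c); case: has.
Qed.

Lemma Ex_all_bad k :
  Ex (k * K) (fun l => (all (fun a => ~~ h (nth_block l a)) (iota 0 k))%:R) <= (1 / 2) ^+ k.
Proof.
elim: k => [|k IH]; first by rewrite mul0n /= expr0.
rewrite mulSn Ex_cat exprS.
apply: le_trans (ler_wpM2r _ h_half); last by apply: exprn_ge0; lra.
rewrite mulrC -ExZ; apply: Ex_le => c sc.
rewrite (eq_Ex (g := fun l => (~~ h c)%:R * (all (fun a => ~~ h (nth_block l a)) (iota 0 k))%:R)).
  by rewrite ExZ mulrC ler_wpM2r.
move=> l _ /=; rewrite nth_block0// -[1%N]addn0 iotaDl all_map.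
rewrite (@eq_all _ _ (fun a => ~~ h (nth_block l a))); last first.
  by move=> a /=; rewrite add1n nth_blockS.
by rewrite -natrM mulnb.
Qed.

Lemma Ex_blocks k :
  Ex (k * K) (fun l => (has (fun a => ~~ g (nth_block l a)) (iota 0 k) ||
                        all (fun a => ~~ h (nth_block l a)) (iota 0 k))%:R)
  <= k%:R * q + (1 / 2) ^+ k.
Proof.
by apply: le_trans (lerD (Ex_has_bad k) (Ex_all_bad k)); exact: Ex_union.
Qed.

End Blocks.

(** * Accuracy of the output and success probability of the program *)

Section Correctness.
Variables (R : realType) (n A E : nat) (M : rel 'I_n).
Hypotheses (n_gt0 : (0 < n)%N) (A_gt0 : (0 < A)%N) (E_gt0 : (0 < E)%N).
Hypotheses (M_sym : symmetric M) (M_irr : irreflexive M).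
Variable eps : R.
Hypothesis E_eps : E%:R^-1 <= eps.
Local Notation lam := (lam_of n A).
Local Notation cap := (cap_of n E).

Let approx (s : memory) : bool :=
  [exists pi : {perm 'I_n}, is_mult_approx eps #|rgmis M pi|%:R (output R s)].

(** The normalisation turns the lower deviation into [k] itself and the upper one into
    [k (4 e + 1) / (4 e - 1)], which is at most [k (1 + 1/e)]. *)
Lemma estimate_approx (N e m k X : R) : 0 < N -> 1 <= e -> 0 < m -> 0 <= k -> e^-1 <= eps ->
  (1 - (4 * e)^-1) * (m * (k / N)) <= X <= (1 + (4 * e)^-1) * (m * (k / N)) ->
  k <= X * (4 * (e * N)) / (m * (4 * e - 1)) <= (1 + eps) * k.
Proof.
move=> N0 e1 m0 k0 eeps /andP[hl hu].
have e0 : 0 < e by lra.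
have d0 : 0 < m * (4 * e - 1) by rewrite mulr_gt0//; lra.
have w0 : 0 <= 4 * (e * N) by rewrite !mulr_ge0// ltW.
have nz : [/\ N != 0, e != 0, m != 0 & 4 * e - 1 != 0].
  by split; apply: lt0r_neq0 => //; lra.
have [nz1 nz2 nz3 nz4] := nz.
apply/andP; split.
  rewrite ler_pdivlMr//; apply: le_trans (ler_wpM2r w0 hl).
  rewrite [leRHS](_ : _ = k * (m * (4 * e - 1)))//; by field; rewrite nz1.
rewrite ler_pdivrMr//; apply: le_trans (ler_wpM2r w0 hu) _.
rewrite [leLHS](_ : _ = k * m * (4 * e + 1)); last by field; rewrite nz1.
apply: le_trans (_ : (1 + e^-1) * k * (m * (4 * e - 1)) <= _); last first.
  by rewrite ler_wpM2r ?(ltW d0)// ler_wpM2r// lerD2l.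
rewrite [leRHS](_ : _ = k * m * ((1 + e^-1) * (4 * e - 1))); last by ring.
rewrite ler_wpM2l ?mulr_ge0 ?(ltW m0)//.
rewrite (_ : (1 + e^-1) * (4 * e - 1) = 4 * e + 3 - e^-1); last by field.
have : e^-1 <= 1 by rewrite invf_le1.
lra.
Qed.

Lemma result_approx c s cnt w d : covered_of A M c -> accurate R A E M c ->
  result A E M c cnt w d -> s 0%N = (cnt * w)%N -> s 1%N = d -> approx s.
Proof.
move=> /eqP cov acc res h0 h1.
have [pi hpi] := maximal_rgmis (@greedy_indep n M M_sym M_irr _) cov.
apply/existsP; exists pi; rewrite hpi /is_mult_approx /output h0 h1.
move: acc res; rewrite /accurate /result; set k := #|picked_of A M c|.
case: leqP => hk /=.
  move=> _ [-> -> ->]; rewrite muln1 divr1 lexx ler_peMl ?ler0n//.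
  by rewrite lerDl; apply: le_trans E_eps; rewrite invr_ge0 ler0n.
move=> acc [-> -> ->].
have kn : (k <= n)%N by rewrite -[leqRHS]card_ord max_card.
have sg0 : (0 < sq_of n)%N by rewrite expn_gt0.
(* Had the clipping taken effect, the cap would be at least [n] and could not be exceeded. *)
have eE : clipped_of n E = E.
  apply/minn_idPl; rewrite leqNgt; apply/negP => nE.
  have eN : clipped_of n E = n by apply/minn_idPr; exact: ltnW.
  have : (n * 1 <= cap)%N.
    rewrite /cap_of eN mulnCA leq_mul2l; apply/orP; right.
    by rewrite muln_gt0 sg0.
  by rewrite muln1 => h; move: hk; rewrite ltnNge (leq_trans kn h).
rewrite /weight /den eE natrM [(_ * (_ - _))%:R]natrM.
rewrite [(4 * (E * n))%:R]natrM [(E * n)%:R]natrM natrB; last by rewrite muln_gt0.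
move: acc; rewrite eE [(4 * E)%:R]natrM; apply: estimate_approx => //.
- by rewrite ltr0n.
- by rewrite ler1n.
- by rewrite ltr0n muln_gt0 sg0 lam_gt0.
Qed.

Variable F : nat.
Hypotheses (nF : (n < F)%N) (NF : (ndraws_of n A < F)%N) (lF : (lam < F)%N)
  (BF : (budget_of n A E < F)%N).

Lemma prog_pr :
  1 - (lam%:R * (n%:R * expR (- lam%:R) + 2 * expR (- (lam%:R / 64))) + (1 / 2) ^+ lam)
  <= pr R approx (run M F (prog A E)).
Proof.
pose good c := covered_of A M c && accurate R A E M c.
set q := _ + 2 * _.
have gq : Ex (R := R) (blk_of n A) (fun c => (~~ good c)%:R) <= q.
  apply: le_trans (lerD (Ex_uncovered R A M n_gt0) (Ex_inaccurate R M n_gt0 A_gt0 E_gt0)).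
  by apply: Ex_union => c _; rewrite negb_and.
have hh := Ex_expensive R n_gt0 A_gt0 E_gt0 M_sym.
pose last := Seq (For rAtt attempt) finish.
have -> : run M F (prog A E) = cbind (exec M F (prelude A E) (init_memory n))
  (fun s => cbind (exec M F (For rI draw) s) (exec M F last)) by [].
apply: pr_bind_ge.
apply: post_mono (prelude_post A E M n_gt0 nF) => s [hst [hP hStop hM] [hI hA]].
have h0 : s 0%N = n by have [[? _ _ _] _ _] := hst.
have hP' : (data <= s rP)%N by rewrite hP.
rewrite (@pr_draws R n M F n_gt0 (ndraws_of n A))//.
apply: le_trans (lerB (lexx 1) (Ex_blocks n_gt0 gq hh lam)) _.
rewrite -[X in X - _](Ex_cst n_gt0 (lam * blk_of n A)) -ExB.
apply: Ex_le => l sl.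
case: (boolP (_ || _)) => [_|]; first by rewrite subrr; exact: pr_ge0.
rewrite negb_or => /andP[/hasPn hgood /allPn[a ha /negPn hcheap]].
rewrite subr0; suff -> : pr R approx (exec M F last (drawn s l)) = 1 by [].
have sI : s rI = size l by rewrite hI sl.
have [d1 d2 d3 d4] := drawn_spec n_gt0 hP' sI.
have dreg x : (x < data)%N -> x \notin [:: rI; rP] -> drawn s l x = s x.
  by move=> xd xn; apply: d4 => //; rewrite hP; lia.
have gd j : (j < lam)%N -> good (chunk A l j).
  by move=> jl; apply/negPn/hgood; rewrite mem_iota.
apply: pr_post; apply: post_mono (attempts_post n_gt0 nF M_sym M_irr sl _ BF lF _ _ _ _ _ _).
- move=> s' [j [cnt [w [d [jl hres e0 e1]]]]].
  have /andP[hc hacc] := gd j jl.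
  exact: (result_approx hc hacc hres e0 e1).
- exact: lam_gt0.
- by move=> j jl; have /andP[] := gd j jl.
- by exists a => //; move: ha; rewrite mem_iota.
- case: hst => -[? ? ? ?] [? ? ?] ?; split; last by rewrite dreg.
  by do !split; rewrite dreg.
- by rewrite dreg.
- by rewrite dreg.
- move=> i il; rewrite -d1 ?sl//; by rewrite hP.
Qed.

End Correctness.

(** * The theorem *)

(** Writing [lam = 128 x], the Chernoff exponent [lam / 64] is [2 x]. One factor [expR (- x)]
    absorbs the multiplier [lam] of the union bound; the other is at most [2^-x]. As
    [x >= 9 + 2 h (c + 1)] with [4^h >= n], this is at most [n^-(c+1) / 512]. *)
Definition attempts_factor (c : nat) : nat := 128 * (2 * c + 11).

Lemma expR1_le4 (R : realType) : expR 1 <= 4 :> R.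
Proof.
have h : 1 - 1 / 2 <= expR (- (1 / 2)) :> R by exact: expR_ge1Dx.
have h0 := expR_gt0 (1 / 2 : R).
have h2 : expR (1 / 2) <= 2 :> R.
  have := ler_wpM2l (ltW h0) h; rewrite -expRD subrr expR0; lra.
have -> : 1 = 1 / 2 + 1 / 2 :> R by lra.
rewrite expRD; nra.
Qed.

Lemma failure_small (R : realType) (n c L : nat) : (0 < n)%N ->
  L = lam_of n (attempts_factor c) ->
  L%:R * (n%:R * expR (- L%:R) + 2 * expR (- (L%:R / 64))) + (1 / 2) ^+ L
    <= n%:R ^- c :> R.
Proof.
move=> n_gt0 Ldef.
pose h := hlog_of n; pose x := ((2 * c + 11) * (h + 1))%N.
have LE : L = (128 * x)%N by rewrite Ldef /lam_of /attempts_factor mulnA.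
rewrite {}LE {Ldef}.
have nR : 1 <= n%:R :> R by rewrite ler1n.
have e0 (t : R) := expR_gt0 t.
have x_exp : x%:R <= expR x%:R :> R by have := expR_ge1Dx (x%:R : R); lra.
have L64 : (128 * x)%N%:R / 64 = x%:R + x%:R :> R by rewrite natrM; field.
have hL : expR (- (128 * x)%N%:R) <= expR (- (x%:R + x%:R)) :> R.
  by rewrite ler_expR lerN2 natrM; have := ler0n R x; lra.
have split_exp : expR (- (x%:R + x%:R)) = expR (- x%:R) * expR (- x%:R) :> R.
  by rewrite opprD expRD.
have cancel : x%:R * expR (- x%:R) <= 1 :> R.
  have := ler_wpM2r (ltW (e0 (- x%:R))) x_exp.
  by rewrite -expRD subrr expR0.
have half : (1 / 2) ^+ (128 * x) <= expR (- x%:R) :> R.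
  have -> : expR (- x%:R) = expR (-1) ^+ x :> R by rewrite -expRM_natl mulrN1.
  rewrite exprM; apply: lerXn2r; rewrite ?nnegrE ?expR_ge0 ?exprn_ge0//; try by lra.
  have h4 : 4^-1 <= expR (-1) :> R.
    by rewrite expRN lef_pV2 ?posrE//; exact: expR1_le4.
  apply: le_trans h4; have -> : 4^-1 = (1 / 2) ^+ 2 :> R by field.
  by apply: ler_wiXn2l => //; lra.
have two_x : expR (- x%:R) <= (1 / 2) ^+ x :> R.
  have -> : expR (- x%:R) = expR (-1) ^+ x :> R by rewrite -expRM_natl mulrN1.
  apply: lerXn2r; rewrite ?nnegrE ?expR_ge0//; first by lra.
  rewrite expRN mul1r lef_pV2 ?posrE//; have := expR_ge1Dx (1 : R); lra.
have n4 : n%:R <= 4 ^+ h :> R by rewrite -natrX ler_nat; exact: up_logP.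
have pow : (1 / 2) ^+ x <= 512^-1 * (n%:R ^- c.+1) :> R.
  apply: le_trans (_ : (1 / 2) ^+ (9 + 2 * h * c.+1) <= _).
    by apply: ler_wiXn2l; [lra|lra|rewrite /x; lia].
  rewrite exprD 2!exprM.
  have -> : (1 / 2) ^+ 9 = 512^-1 :> R by field.
  have -> : (1 / 2) ^+ 2 = 4^-1 :> R by field.
  rewrite ler_wpM2l ?invr_ge0// -exprVn.
  apply: lerXn2r; rewrite ?nnegrE ?exprn_ge0 ?invr_ge0//.
  by rewrite exprVn lef_pV2 ?posrE ?exprn_gt0// ltr0n.
have nc0 : 0 < n%:R ^- c :> R by rewrite invr_gt0 exprn_gt0// ltr0n.
have pow2 : (1 / 2) ^+ x <= 512^-1 * (n%:R^-1 * n%:R ^- c) :> R.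
  by rewrite -invfM -exprS.
rewrite L64.
set q := expR (- x%:R) in e0 hL split_exp cancel half two_x *.
have q0 : 0 < q by exact: expR_gt0.
have b1 : (128 * x)%N%:R * (n%:R * expR (- (128 * x)%N%:R) + 2 * expR (- (x%:R + x%:R))) <=
    (128 * x)%N%:R * ((n%:R + 2) * (q * q)) :> R.
  rewrite ler_wpM2l ?ler0n// -split_exp.
  have := ler_wpM2l (le_trans ler01 nR) hL; lra.
have b2 : (128 * x)%N%:R * ((n%:R + 2) * (q * q)) <= 128 * (n%:R + 2) * q :> R.
  rewrite natrM.
  have -> : 128 * x%:R * ((n%:R + 2) * (q * q)) = (128 * (n%:R + 2) * q) * (x%:R * q) by ring.
  by rewrite ler_piMr// !mulr_ge0 ?(ltW q0)//; lra.
(* The factor [512 n] covers [128 (n + 2) + 1], and is cancelled by the nine halvings and the extra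
   power of [n] provided in [pow]. *)
apply: le_trans (_ : 512 * n%:R * q <= _).
  apply: le_trans (lerD (le_trans b1 b2) half) _; nra.
apply: le_trans (ler_wpM2l _ (le_trans two_x pow2)) _; first by lra.
set w := n%:R ^- c; have n0 : n%:R != 0 :> R by rewrite lt0r_neq0//; lra.
by rewrite [leLHS](_ : _ = w)//; field.
Qed.

(** * The running time as a product of size, precision and logarithms *)

Section TimeArith.
Local Open Scope nat_scope.

Lemma V0_bits n A G : (0 < n)%N ->
  (2 * n + (1000 + A + G) < 2 ^ ((1002 + A + G) * (hlog_of n + 1)))%N.
Proof.
move=> n_gt0; set H := (1000 + A + G)%N; set h := hlog_of n.
have n4 : (n <= 4 ^ h)%N by exact: up_logP.
have h1 : (2 * n <= 2 ^ (2 * h + 1))%N.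
  by rewrite expnD expnM mulnC leq_mul2r.
have h2 : (H < 2 ^ H)%N by exact: ltn_expl.
have h3 : (2 <= 2 ^ (2 * h + 1))%N by rewrite addn1 expnS leq_pmulr// expn_gt0.
have h4 : (2 <= 2 ^ H)%N by rewrite -[X in X <= _]expn1 leq_exp2l// /H; lia.
apply: (@leq_trans (2 ^ (2 * h + 1) * 2 ^ H)%N); first by nia.
by rewrite -expnD leq_exp2l// /H; nia.
Qed.

(** Stated for arbitrary numbers so that the sizes of the program parts stay opaque. Of the five
    factors [u], four come from [lm] times [bud] and one from the bit length [bt]. The separate term
    in [E] is the charge for the constant in [clip]. *)
Lemma time_arith (ccl gcl ci cs cp cst cb cf kp A n sq u E E2 lm P bud N bt : nat) :
  0 < n -> 0 < sq -> 0 < u -> 0 < A -> 0 < E2 -> gcl <= 2 * E + 20 ->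
  lm = A * u -> P = n * (sq * E2) -> bud = 100 * (lm * (lm * lm) * P) ->
  N = lm * (n * lm + sq * lm) -> bt = kp * u ->
  ccl * (n + gcl).+1 + (ci * bt + (n.+1 * (cs * bt + 9 * bt) + cp * bt)) +
   (N.+1 * (20 * bt + 9 * bt) +
    (lm.+1 * (cst * bt + bud.+1 * (cb * bt + 9 * bt) + 9 * bt) + cf * bt))
  <= (22 * ccl + kp * (ci + 2 * (cs + 9) + cp + 29 * (2 * A ^ 2 + 1) +
      (A + 1) * (cst + 9) + (A + 1) * (100 * A ^ 3 + 1) * (cb + 9) + cf)) * (P * u ^ 5)
     + 2 * ccl * E.
Proof.
move=> n0 s0 u0 A0 e0 hg lmE PE budE NE btE.
pose Y := P * u ^ 4.
have P0 : 0 < P by rewrite PE !muln_gt0 n0 s0 e0.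
have nP : n <= P by rewrite PE leq_pmulr// muln_gt0 s0.
have sP : sq <= P.
  by rewrite PE mulnCA leq_pmulr// muln_gt0 n0.
have up k : 0 < u ^ k by rewrite expn_gt0 u0.
have PY : P <= Y by rewrite leq_pmulr.
have Y0 : 0 < Y by rewrite muln_gt0 P0 up.
have uY : u <= Y.
  apply: (@leq_trans (u ^ 4)); last by rewrite leq_pmull.
  by rewrite -[X in X <= _]expn1 leq_pexp2l.
have ZE : P * u ^ 5 = u * Y by rewrite /Y; ring.
rewrite ZE; set Z := u * Y.
have YZ : Y <= Z by rewrite leq_pmull.
have bX X k : X <= k * Y -> bt * X <= k * (kp * Z).
  move=> h; have -> : k * (kp * Z) = bt * (k * Y) by rewrite btE /Z; ring.
  by rewrite leq_mul2l h orbT.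
have t1 : ccl * (n + gcl).+1 <= 22 * ccl * Z + 2 * ccl * E.
  have -> : 22 * ccl * Z + 2 * ccl * E = ccl * (22 * Z + 2 * E) by ring.
  rewrite leq_mul2l; apply/orP; right; lia.
have t2 : bt * ci <= ci * (kp * Z) by apply: bX; rewrite leq_pmulr.
have t3 : bt * ((cs + 9) * n.+1) <= (2 * (cs + 9)) * (kp * Z).
  apply: bX; have -> : 2 * (cs + 9) * Y = (cs + 9) * (2 * Y) by ring.
  rewrite leq_mul2l; apply/orP; right; lia.
have t4 : bt * cp <= cp * (kp * Z) by apply: bX; rewrite leq_pmulr.
have NY : N <= 2 * A ^ 2 * Y.
  have -> : N = A ^ 2 * (u ^ 2 * (n + sq)) by rewrite NE lmE; ring.
  have -> : 2 * A ^ 2 * Y = A ^ 2 * (2 * P * u ^ 4) by rewrite /Y; ring.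
  rewrite leq_mul2l; apply/orP; right; rewrite mulnC; apply: leq_mul; first lia.
  by rewrite leq_pexp2l.
have t5 : bt * (29 * N.+1) <= 29 * (2 * A ^ 2 + 1) * (kp * Z).
  apply: bX; have -> : 29 * (2 * A ^ 2 + 1) * Y = 29 * (2 * A ^ 2 * Y + Y) by ring.
  rewrite leq_mul2l /=; lia.
have lmu : lm.+1 <= (A + 1) * u by rewrite lmE mulnDl mul1n; lia.
have lY : lm.+1 <= (A + 1) * Y by apply: leq_trans lmu _; rewrite leq_mul2l uY orbT.
have bY : lm.+1 * bud.+1 <= (A + 1) * (100 * A ^ 3 + 1) * Y.
  have -> : (A + 1) * (100 * A ^ 3 + 1) * Y = ((A + 1) * u) * ((100 * A ^ 3 + 1) * (u ^ 3 * P)).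
    by rewrite /Y; ring.
  apply: leq_mul => //.
  have -> : bud = 100 * A ^ 3 * (u ^ 3 * P) by rewrite budE lmE; ring.
  rewrite [leqRHS]mulnDl mul1n -addn1 leq_add2l muln_gt0 up P0 //.
have t6 : bt * (lm.+1 * (cst + 9) + lm.+1 * bud.+1 * (cb + 9)) <=
    ((A + 1) * (cst + 9) + (A + 1) * (100 * A ^ 3 + 1) * (cb + 9)) * (kp * Z).
  apply: bX; rewrite mulnDl; apply: leq_add.
    by rewrite [leqRHS]mulnAC leq_mul2r lY orbT.
  by rewrite [leqRHS]mulnAC leq_mul2r bY orbT.
have t7 : bt * cf <= cf * (kp * Z) by apply: bX; rewrite leq_pmulr.
clearbody Z.
move: t1 t2 t3 t4 t5 t6 t7; set W := kp * Z.
set X1 := 2 * A ^ 2 + 1; set X2 := (A + 1) * (100 * A ^ 3 + 1) * (cb + 9).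
set X3 := (A + 1) * (cst + 9).
move=> t1 t2 t3 t4 t5 t6 t7.
have -> : (22 * ccl + kp * (ci + 2 * (cs + 9) + cp + 29 * X1 + X3 + X2 + cf)) * Z + 2 * ccl * E =
  (22 * ccl * Z + 2 * ccl * E) + (ci * W + (2 * (cs + 9) * W + cp * W)) +
  (29 * X1 * W + ((X3 + X2) * W + cf * W)) by rewrite /W; ring.
have -> : ci * bt = bt * ci by ring.
have -> : n.+1 * (cs * bt + 9 * bt) = bt * ((cs + 9) * n.+1) by ring.
have -> : N.+1 * (20 * bt + 9 * bt) = bt * (29 * N.+1) by ring.
have -> : lm.+1 * (cst * bt + bud.+1 * (cb * bt + 9 * bt) + 9 * bt) =
  bt * (lm.+1 * (cst + 9) + lm.+1 * bud.+1 * (cb + 9)) by ring.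
have -> : cp * bt = bt * cp by ring.
have -> : cf * bt = bt * cf by ring.
by rewrite !leq_add.
Qed.

(** The size of [clip E] does not depend on [E], so [clip 0] stands for it; the constant of the
    theorem can then be fixed before [eps]. *)
Definition time_factor (A : nat) : nat :=
  22 * csize (clip 0) + kap A * (1002 + A + grow) *
    (csize sqrt_init + 2 * (csize sqrt_step + 9) + csize (params A) +
     29 * (2 * A ^ 2 + 1) + (A + 1) * (csize start + 9) +
     (A + 1) * (100 * A ^ 3 + 1) * (csize body + 9) + csize finish).

Lemma prog_time_le n A E : 0 < n -> 0 < A -> 0 < E ->
  prog_time n A E ((1002 + A + grow) * (hlog_of n + 1)) <=
  time_factor A * (n * (sq_of n * (E * E)) * (hlog_of n + 1) ^ 5) + 2 * csize (clip 0) * E.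
Proof.
move=> n0 A0 E0.
have s0 : 0 < sq_of n by rewrite expn_gt0.
have e0 : 0 < clipped_of n E by rewrite leq_min E0.
have hg : cgrowth (clip E) <= 2 * E + 20 by rewrite /=; lia.
have ec : csize (clip E) = csize (clip 0) by [].
have cE : clipped_of n E <= E by exact: geq_minl.
rewrite /prog_time /attempt_cost /time_factor ec.
move: (csize (clip 0)) (csize sqrt_init) (csize sqrt_step) (csize (params A))
  (csize start) (csize body) (csize finish) (kap A) grow => ccl ci cs cp cst cb cf kp gw.
have u0 : 0 < hlog_of n + 1 by rewrite addn1.
apply: leq_trans (@time_arith ccl _ ci cs cp cst cb cf (kp * (1002 + A + gw)) A n (sq_of n)
  (hlog_of n + 1) E (clipped_of n E * clipped_of n E) (lam_of n A) _ (budget_of n A E) (ndraws_of n A) _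
  n0 s0 u0 A0 _ hg erefl erefl erefl erefl (mulnA _ _ _)) _.
  by rewrite muln_gt0 e0.
rewrite leq_add2r leq_mul2l leq_mul2r leq_mul2l leq_mul2l leq_mul//.
by rewrite !orbT.
Qed.

End TimeArith.

(** * Comparison with the real logarithm and square root *)

Section RealBounds.
Variables (R : realType) (n : nat).
Hypothesis n_gt0 : (0 < n)%N.
Local Notation N := (n%:R : R).

Let N_ge1 : 1 <= N. Proof. by rewrite ler1n. Qed.
Let N_gt0 : 0 < N. Proof. by rewrite ltr0n. Qed.

(** Since [4^(hlog - 1) < n] and [ln 4 >= 1], a positive [hlog] is at most [1 + ln n]. *)
Lemma hlog_ln : (hlog_of n + 1)%:R <= 2 * (1 + ln N).
Proof.
have l0 : 0 <= ln N by exact: ln_ge0.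
rewrite natrD; have [h0|h0] := posnP (hlog_of n); first by rewrite h0; lra.
have n1 : (1 < n)%N by move: h0; rewrite /hlog_of up_log_gt0.
have h1 : (4 ^ (hlog_of n).-1 < n)%N by exact: up_log_gtn.
have h2 : 4 ^+ (hlog_of n).-1 <= N by rewrite -natrX ler_nat ltnW.
have h3 : 1 <= ln 4 :> R.
  have : ln (expR 1) <= ln 4 :> R by rewrite ler_ln ?posrE ?expR_gt0//; exact: expR1_le4.
  by rewrite expRK.
have h4 : (hlog_of n).-1%:R <= ln N.
  apply: le_trans (_ : ln (4 ^+ (hlog_of n).-1) <= _).
    by rewrite lnXn// -[leRHS]mulr_natr ler_peMl.
  by rewrite ler_ln ?posrE ?exprn_gt0.
have -> : hlog_of n = (hlog_of n).-1.+1 by rewrite prednK.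
rewrite -natr1; lra.
Qed.

Lemma sq_sqrt : (sq_of n)%:R <= 2 * Num.sqrt N.
Proof.
have s0 : 0 <= Num.sqrt N by exact: sqrtr_ge0.
have [h0|h0] := posnP (hlog_of n).
  have : Num.sqrt 1 <= Num.sqrt N by rewrite ler_sqrt.
  rewrite sqrtr1 /sq_of h0 expn0; lra.
have n1 : (1 < n)%N by move: h0; rewrite /hlog_of up_log_gt0.
have h1 : (4 ^ (hlog_of n).-1 < n)%N by exact: up_log_gtn.
rewrite /sq_of -(prednK h0) expnS natrM ler_wpM2l//.
rewrite -[leLHS]ger0_norm// -sqrtr_sqr ler_sqrt//.
by rewrite -natrX ler_nat -expnM mulnC expnM ltnW.
Qed.

Lemma powR_three_halves : N `^ (3 / 2) = N * Num.sqrt N.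
Proof.
rewrite (_ : 3 / 2 = 1 + 2^-1); last by lra.
rewrite powRD; last by rewrite (lt0r_neq0 N_gt0) implybT.
by rewrite powRr1 ?powR12_sqrt// ltW.
Qed.

End RealBounds.

(** The 256 is 8 times 32: [sq <= 2 sqrt n] and [E <= 2 / eps] used twice give 8, the fifth power of
    [2 (1 + ln n)] gives 32. The term linear in [E] is at most [2 / eps] and is absorbed by the main
    term. *)
Lemma time_real (R : realType) (n E D D2 : nat) (eps : R) : (0 < n)%N ->
  0 < eps -> eps < 1 -> E%:R <= 2 / eps ->
  (D * (n * (sq_of n * (E * E)) * (hlog_of n + 1) ^ 5) + D2 * E)%N%:R <=
  (256 * D%:R + 2 * D2%:R) * (n%:R `^ (3 / 2) / eps ^+ 2) * (1 + ln n%:R) ^+ 5.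
Proof.
move=> n0 eps0 eps1 E_hi.
have D0 : 0 <= D%:R :> R by exact: ler0n.
have D20 : 0 <= D2%:R :> R by exact: ler0n.
apply: le_trans (_ : D%:R * (n%:R * ((sq_of n)%:R * (E%:R * E%:R)) *
    (hlog_of n + 1)%:R ^+ 5) + D2%:R * E%:R <= _).
  by rewrite natrD !natrM natrX.
rewrite powR_three_halves//.
set r := Num.sqrt n%:R; set l := ln n%:R.
have l0 : 0 <= l by apply: ln_ge0; rewrite ler1n.
have N1 : 1 <= n%:R :> R by rewrite ler1n.
have r1 : 1 <= r.
  have : Num.sqrt 1 <= r by rewrite ler_sqrt// ltr0n.
  by rewrite sqrtr1.
have ER : 0 <= E%:R :> R by exact: ler0n.
have ei1 : 1 <= eps^-1 by rewrite invf_ge1// ltW.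
have ei0 := le_trans ler01 ei1.
have i2 : eps^-1 <= eps^-1 ^+ 2 by rewrite expr2 ler_peMl.
have hp : n%:R * ((sq_of n)%:R * (E%:R * E%:R)) <= 8 * (n%:R * r / eps ^+ 2) :> R.
  have -> : 8 * (n%:R * r / eps ^+ 2) = n%:R * ((2 * r) * ((2 / eps) * (2 / eps))).
    by field; exact: lt0r_neq0.
  rewrite ler_wpM2l//; apply: ler_pM => //; last exact: ler_pM.
  - by rewrite mulr_ge0.
  - exact: sq_sqrt.
have hu : (hlog_of n + 1)%:R ^+ 5 <= 32 * (1 + l) ^+ 5 :> R.
  have -> : 32 * (1 + l) ^+ 5 = (2 * (1 + l)) ^+ 5 by rewrite exprMn; ring.
  by apply: lerXn2r; rewrite ?nnegrE//; [lra|exact: hlog_ln].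
have X1 : 1 <= (1 + l) ^+ 5 by apply: exprn_ege1; lra.
set X := (1 + l) ^+ 5 in hu X1 *; set Y := n%:R * r / eps ^+ 2 in hp *.
have Y0 : 0 <= Y by rewrite /Y !mulr_ge0 ?invr_ge0 ?sqr_ge0//; lra.
have hE : E%:R <= 2 * Y.
  apply: le_trans E_hi _; rewrite ler_wpM2l// /Y -exprVn.
  apply: le_trans i2 _; rewrite ler_peMl ?sqr_ge0//.
  by rewrite mulr_ege1.
have h1 : n%:R * ((sq_of n)%:R * (E%:R * E%:R)) * (hlog_of n + 1)%:R ^+ 5 <= 8 * Y * (32 * X).
  by apply: ler_pM => //; rewrite ?exprn_ge0// !mulr_ge0.
have h2 : D%:R * (n%:R * ((sq_of n)%:R * (E%:R * E%:R)) * (hlog_of n + 1)%:R ^+ 5) <=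
    D%:R * (8 * Y * (32 * X)) by rewrite ler_wpM2l.
have h3 : D2%:R * E%:R <= D2%:R * (2 * Y) by rewrite ler_wpM2l.
have d0 : 0 <= D2%:R * (2 * Y) by apply: mulr_ge0 => //; exact: mulr_ge0.
have h4 : D2%:R * (2 * Y) <= D2%:R * (2 * Y) * X by rewrite ler_peMr.
have -> : (256 * D%:R + 2 * D2%:R) * Y * X =
  D%:R * (8 * Y * (32 * X)) + D2%:R * (2 * Y) * X by ring.
exact: lerD h2 (le_trans h3 h4).
Qed.

Theorem theorem1p3 (R : realType) (c : nat) :
  exists (C : R) (k : nat),
  forall eps : R, 0 < eps < 1 ->
  exists P : cmd,
  forall (n : nat) (M : rel 'I_n),
    (0 < n)%N -> symmetric M -> irreflexive M ->
  exists fuel T : nat,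
    [/\ halts_within T (run M fuel P),
        T%:R <= C * (n%:R `^ (3 / 2) / eps ^+ 2) * (1 + ln n%:R) ^+ k
      & 1 - n%:R ^- c <=
        pr R (fun s => [exists pi : {perm 'I_n},
                 is_mult_approx eps #|rgmis M pi|%:R (output R s)])
             (run M fuel P) ].
Proof.
pose A := attempts_factor c.
have A0 : (0 < A)%N by rewrite /A /attempts_factor muln_gt0 addn_gt0 orbT.
pose D : nat := time_factor A; pose D2 : nat := (2 * csize (clip 0))%N.
exists (256 * D%:R + 2 * D2%:R), 5%N => eps /andP[eps0 eps1].
(* The successor makes [1/E <= eps]; as [1/eps > 1], it costs at most a factor 2 in
   [E <= 2 / eps]. *)
pose E := (Num.truncn eps^-1).+1.
have ei0 : 0 <= eps^-1 by rewrite invr_ge0 ltW.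
have E_lo : eps^-1 <= E%:R by rewrite ltW// /E; have /andP[] := truncn_itv ei0.
have E_hi : E%:R <= 2 / eps.
  have /andP[h _] := truncn_itv ei0; rewrite /E -natr1.
  have : 1 <= eps^-1 by rewrite invf_ge1// ltW.
  lra.
have E_eps : E%:R^-1 <= eps by rewrite -[leRHS]invrK lef_pV2 ?posrE ?invr_gt0 ?ltr0n.
exists (prog A E) => n M n0 Msym Mirr.
(* Fuel exceeding the number of rounds of each of the four loops; it does not enter the running
   time. *)
pose F := (n + ndraws_of n A + lam_of n A + budget_of n A E).+1.
exists F, (prog_time n A E ((1002 + A + grow) * (hlog_of n + 1))).
have [F1 F2 F3 F4] : [/\ n < F, ndraws_of n A < F, lam_of n A < F & budget_of n A E < F]%N.
  by split; rewrite /F; lia.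
split.
- apply: prog_halts => //; exact: V0_bits.
- have hT := prog_time_le n0 A0 (ltn0Sn _ : (0 < E)%N).
  apply: le_trans (time_real D D2 n0 eps0 eps1 E_hi).
  by rewrite ler_nat; exact: hT.
- apply: le_trans (prog_pr n0 A0 (ltn0Sn _) Msym Mirr E_eps F1 F2 F3 F4).
  by rewrite lerD2l lerN2; exact: failure_small.
Qed.
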